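(* Let $0<\alpha<1$, $\theta>0$, and let $\nu$ be a Thorin measure. If $L$ is GGC$_\alpha^{(b,c)}(\theta,\nu)$, it follows that GGC$_\alpha^{(1,0)}(\theta,\nu)$ = GGC$(\alpha\theta,\varrho_{\alpha,\nu})$ and GGC$_\alpha^{(1,1)}(\theta,\nu)$ = GGC$(\alpha\theta,\Lambda_{\alpha,\nu})$. That is, in the first case $L\overset{d}{=}G_{\alpha\theta}M_{\alpha\theta}(\varrho_{\alpha,\nu})$ and in the second $L\overset{d}{=}G_{\alpha\theta}M_{\alpha\theta}(\Lambda_{\alpha,\nu})$. These points lead to the following results: (i) $M_{\alpha\theta}(\varrho_{\alpha,\nu})\overset{d}{=}M_{\alpha\theta}(\varrho_\alpha)\,[M_\theta(\nu)]^{1/\alpha}$, the factors on the right being independent. (ii) $A^{(\alpha,\alpha\theta)}_{\alpha,\xi_\theta}\overset{d}{=}M_{\alpha\theta}(\Lambda_{\alpha,\nu})\overset{d}{=}Y_{\alpha\theta,1}$, where, with $M\overset{d}{=}M_{\alpha\theta}(\varrho_{\alpha,\nu})$, $Y_{\alpha\theta,1}$ has the law of $M/(M+1)$ under the change of measure with density $(1+M)^{-\alpha\theta}/\mathbb{E}[(1+M)^{-\alpha\theta}]$. The results apply for arbitrary Thorin measures $\nu$, but yield results specific to Dirichlet mean functionals by setting $\nu=H$, a probability measure.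
   Context: A Thorin measure is a sigma-finite measure $\nu$ on $(0,\infty)$ with $\int\log(1+\lambda x)\nu(dx)<\infty$ for $\lambda>0$ (finite or infinite total mass). GGC$(\theta,\nu)$ is the law with Laplace transform $\exp(-\theta\int\log(1+\lambda x)\nu(dx))$. For a Thorin measure $\nu$ and $\theta>0$, $M_\theta(\nu)$ denotes the positive random variable whose law is characterized by $\mathbb{E}[(1+\lambda M_\theta(\nu))^{-\theta}]=\exp(-\theta\int\log(1+\lambda x)\nu(dx))$, so that GGC$(\theta,\nu)$ is the law of $G_\theta M_\theta(\nu)$; when $\nu$ is a probability measure it is the mean of a Dirichlet process with shape $\theta\nu$ (a Dirichlet mean functional). $G_a$: independent Gamma(shape $a$, scale 1). $S_\alpha$: positive $\alpha$-stable, $\mathbb{E}[e^{-\lambda S_\alpha}]=e^{-\lambda^\alpha}$; $X_\alpha\overset{d}{=}S_\alpha/S'_\alpha$ (independent copies), with density $\varrho_\alpha(y)=\frac{\sin(\pi\alpha)}{\pi}\frac{y^{\alpha-1}}{y^{2\alpha}+2y^\alpha\cos(\pi\alpha)+1}$, $y>0$. Let $f$ be the density of $Z^{1/\alpha}S_\alpha$ with $Z$ a GGC$(\theta,\nu)$ variable independent of $S_\alpha$. For $b>0$, $c\ge0$, GGC$_\alpha^{(b,c)}(\theta,\nu)$ is the law with density proportional to $e^{-(c/b)x}b^{-1}f(x/b)$; thus GGC$_\alpha^{(1,0)}(\theta,\nu)$ is the law of $Z^{1/\alpha}S_\alpha$ and GGC$_\alpha^{(1,1)}(\theta,\nu)$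 is its exponential tilt, with density proportional to $e^{-x}f(x)$. $\varrho_{\alpha,\nu}(x)=\frac{\sin(\pi\alpha)}{\pi}\int_0^\infty\frac{x^{\alpha-1}r}{x^{2\alpha}+2x^\alpha r\cos(\alpha\pi)+r^2}\nu(dr)$ (density of a measure, also denoted $\varrho_{\alpha,\nu}$). $\Lambda_{\alpha,\nu}(dx)=\int_0^\infty\Lambda_{\alpha,r/(1+r)}(dx)\nu(dr)$, where $\Lambda_{\alpha,p}$ is the law of $\frac{(p/(1-p))^{1/\alpha}X_\alpha}{1+(p/(1-p))^{1/\alpha}X_\alpha}$. $A^{(\alpha,\alpha\theta)}_{\alpha,p}$ ($p$-skewed generalized Bessel bridge occupation time) has law on $[0,1]$ characterized by $\mathbb{E}[(1+\lambda A^{(\alpha,\alpha\theta)}_{\alpha,p})^{-\alpha\theta}]=(1-p+p(1+\lambda)^\alpha)^{-\theta}$; $\xi_\theta$ has law proportional to $(1-u)^\theta\tilde Q(du)$ with $\tilde Q$ the law of $M_\theta(\nu)/(M_\theta(\nu)+1)$; and $A^{(\alpha,\alpha\theta)}_{\alpha,\xi_\theta}$ given $\xi_\theta=p$ is distributed as $A^{(\alpha,\alpha\theta)}_{\alpha,p}$. *)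

(* Defs.v *)
From HB Require Import structures.
From mathcomp Require Import all_boot all_order all_algebra.
From mathcomp Require Import ring lra.
From mathcomp Require Import all_classical all_reals all_analysis measurable_realfun.

Set Implicit Arguments.
Unset Strict Implicit.
Unset Printing Implicit Defensive.

Import Order.TTheory GRing.Theory Num.Theory.
Import numFieldNormedType.Exports.

Local Open Scope classical_set_scope.
Local Open Scope ring_scope.

(* Random variables enter only through their laws, which are Borel
   probabilities on R; independent variables are modelled by the product law
   on R * R.  A measure is total on [set R] but only constrained on measurable
   sets, so equality in law is equality on measurable sets. *)
Definition same_law {R : realType} (P Q : probability R R) : Prop :=
  forall A : set R, measurable A -> P A = Q A.

(* P satisfies C, and C determines it: "the law characterized by C is P". *)
Definition is_the_law {R : realType} (C : probability R R -> Prop)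
    (P : probability R R) : Prop :=
  forall Q : probability R R, C Q <-> same_law Q P.

Section measurable_maps.
Context {R : realType}.

Lemma measurable_invR : measurable_fun [set: R] (@GRing.inv R).
Proof.
rewrite (_ : @GRing.inv R = fun x => if x == 0 then 0 else x^-1); last first.
  by apply/funext => x; case: eqP => // ->; rewrite invr0.
apply: measurable_fun_if => //.
- by apply: measurable_fun_eqr.
- rewrite setTI; apply: open_continuous_measurable_fun.
    rewrite (_ : _ @^-1` _ = [set r : R | r != 0])//.
    by apply/seteqP; split => x /=; case: (x == 0).
  by apply/in_setP => x /= x0; apply: inv_continuous; rewrite x0.
Qed.

Lemma measurable_funVR d (T : measurableType d) (f : T -> R) :
  measurable_fun setT f -> measurable_fun setT (fun x => (f x)^-1).
Proof. by move=> mf; exact: (measurableT_comp measurable_invR). Qed.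

Definition prodR (z : R * R) : R := z.1 * z.2.

Lemma measurable_prodR : measurable_fun setT prodR.
Proof. by apply: measurable_funM. Qed.

HB.instance Definition _ :=
  isMeasurableFun.Build _ _ _ _ prodR measurable_prodR.

Definition ratioR (z : R * R) : R := z.1 / z.2.

Lemma measurable_ratioR : measurable_fun setT ratioR.
Proof. by apply: measurable_funM => //; exact: measurable_funVR. Qed.

HB.instance Definition _ :=
  isMeasurableFun.Build _ _ _ _ ratioR measurable_ratioR.

Definition mul_root (alpha : R) (z : R * R) : R := z.1 * z.2 `^ alpha^-1.

Lemma measurable_mul_root alpha : measurable_fun setT (mul_root alpha).
Proof.
apply: measurable_funM => //.
exact: (measurableT_comp (measurable_powR _)).
Qed.

HB.instance Definition _ alpha :=
  isMeasurableFun.Build _ _ _ _ (mul_root alpha) (measurable_mul_root alpha).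

Definition to_unit (m : R) : R := m / (m + 1).

Lemma measurable_to_unit : measurable_fun setT to_unit.
Proof.
apply: measurable_funM => //; apply: measurable_funVR.
exact: measurable_funD.
Qed.

HB.instance Definition _ :=
  isMeasurableFun.Build _ _ _ _ to_unit measurable_to_unit.

Definition skew_map (alpha p x : R) : R :=
  (p / (1 - p)) `^ alpha^-1 * x / (1 + (p / (1 - p)) `^ alpha^-1 * x).

Lemma measurable_skew2 alpha :
  measurable_fun setT (fun z : R * R => skew_map alpha z.1 z.2).
Proof.
have m1 : measurable_fun setT
    (fun z : R * R => (z.1 / (1 - z.1)) `^ alpha^-1 * z.2).
  apply: measurable_funM => //.
  apply: (measurableT_comp (measurable_powR _)).
  apply: measurable_funM => //; apply: measurable_funVR.
  exact: measurable_funB.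
apply: measurable_funM => //; apply: measurable_funVR.
exact: measurable_funD.
Qed.

Lemma measurable_skew alpha p : measurable_fun setT (skew_map alpha p).
Proof. exact: (measurable_fun_pair2 p (@measurable_skew2 alpha)). Qed.

HB.instance Definition _ alpha p :=
  isMeasurableFun.Build _ _ _ _ (skew_map alpha p) (measurable_skew alpha p).

End measurable_maps.

Section laws.
Context {R : realType}.
Implicit Types (alpha theta a b c p : R) (P : probability R R)
  (nu : {measure set R -> \bar R}).

(* Thorin measures and the other measures on (0,oo) are measures on R that
   do not charge ]-oo, 0]. *)
Definition Thorin nu : Prop :=
  [/\ sigma_finite [set: R] nu, nu `]-oo, 0]%classic = 0%E &
      forall lam : R, 0 < lam ->
        (\int[nu]_(x in `]0%R, +oo[) (ln (1 + lam * x))%:E < +oo)%E].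

Definition Thorin_exponent nu (lam : R) : R :=
  \int[nu]_(x in `]0, +oo[) ln (1 + lam * x).

Definition GGC_law theta nu P : Prop :=
  [/\ Thorin nu, P `]-oo, 0[%classic = 0%E &
      forall lam : R, 0 <= lam ->
        (\int[P]_x (expR (- (lam * x)))%:E =
         (expR (- (theta * Thorin_exponent nu lam)))%:E)%E].

(* the law of M_theta(nu).  The transform determines it, but it exists only when
   nu has total mass at most 1 (and is nonzero): already for nu = 2 delta_1 the
   right-hand side decays in lam faster than any such mixture. *)
Definition M_law theta nu P : Prop :=
  [/\ Thorin nu, P `]-oo, 0]%classic = 0%E &
      forall lam : R, 0 <= lam ->
        (\int[P]_x ((1 + lam * x) `^ (- theta))%:E =
         (expR (- (theta * Thorin_exponent nu lam)))%:E)%E].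

Definition has_density (f : R -> R) P : Prop :=
  [/\ measurable_fun [set: R] f, forall x, 0 <= f x &
      forall A, measurable A ->
        P A = (\int[lebesgue_measure]_(x in A) (f x)%:E)%E].

Definition gamma_fun a : R :=
  \int[lebesgue_measure]_(x in `]0, +oo[) (x `^ (a - 1) * expR (- x)).

Definition gamma_law a P : Prop :=
  has_density (fun x =>
    if 0 < x then x `^ (a - 1) * expR (- x) / gamma_fun a else 0) P.

Definition stable_law alpha P : Prop :=
  P `]-oo, 0]%classic = 0%E /\
  forall lam : R, 0 <= lam ->
    (\int[P]_x (expR (- (lam * x)))%:E = (expR (- (lam `^ alpha)))%:E)%E.

(* the law of X_alpha = S / S' for independent copies of S *)
Definition X_law (S : probability R R) : probability R R :=
  distribution (S \x S)%E ratioR.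

(* the law of Z^(1/alpha) S, with Z and S independent *)
Definition root_scaled_law alpha (S Z : probability R R) : probability R R :=
  distribution (S \x Z)%E (mul_root alpha).

Definition product_law (P Q : probability R R) : probability R R :=
  distribution (P \x Q)%E prodR.

(* the law of M / (M + 1) *)
Definition unit_law (M : probability R R) : probability R R :=
  distribution M to_unit.

(* S is the law of S_alpha, L is GGC_alpha^(b,c)(theta, nu) *)
Definition GGC_alpha_law alpha (S : probability R R) b c theta nu
    (L : probability R R) : Prop :=
  exists (Z : probability R R) (f : R -> R),
    [/\ GGC_law theta nu Z, has_density f (root_scaled_law alpha S Z) &
        exists2 k : R, 0 < k &
          has_density (fun x => k * (expR (- (c / b * x)) * (b^-1 * f (x / b))))
            L].

(* the law of A_(alpha,p)^(alpha, alpha theta) *)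
Definition A_law alpha theta p nu : Prop :=
  nu `[0, 1]%classic = 1%E /\
  forall lam : R, 0 <= lam ->
    (\int[nu]_x ((1 + lam * x) `^ (- (alpha * theta)))%:E =
     ((1 - p + p * (1 + lam) `^ alpha) `^ (- theta))%:E)%E.

(* the law of xi_theta, where M is the law of M_theta(nu) *)
Definition xi_law theta (M P : probability R R) : Prop :=
  exists2 k : R, 0 < k & forall B, measurable B ->
    P B = (k%:E * \int[unit_law M]_(u in B) ((1 - u) `^ theta)%:E)%E.

(* the law of A_(alpha,xi)^(alpha, alpha theta), for xi of law Xi: the
   conditional law given xi = p is the law of A_(alpha,p) *)
Definition A_mixture_law alpha theta (Xi P : probability R R) : Prop :=
  exists2 K : R.-pker R ~> R,
    forall p, 0 < p < 1 -> A_law alpha theta p (K p) &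
    forall B, measurable B -> P B = (\int[Xi]_p K p B)%E.

(* the law of M / (M + 1) after the change of measure with density
   (1 + M)^(- a) / E[(1 + M)^(- a)] *)
Definition Y_law a (M P : probability R R) : Prop :=
  forall B, measurable B ->
    P B = (((\int[M]_m (1 + m) `^ (- a))^-1)%:E *
           \int[M]_(m in to_unit @^-1` B) ((1 + m) `^ (- a))%:E)%E.

End laws.

Section density_measure.
Local Open Scope ereal_scope.
Context {R : realType}.
Variable g : R -> \bar R.
Hypotheses (mg : measurable_fun [set: R] g) (g0 : forall x, 0 <= g x).

Definition density_measure (A : set R) : \bar R :=
  \int[lebesgue_measure]_(x in A) g x.

Let density_measure0 : density_measure set0 = 0.
Proof. exact: integral_set0. Qed.

Let density_measure_ge0 A : 0 <= density_measure A.
Proof. exact: integral_ge0. Qed.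

Let density_measure_sigma_additive : semi_sigma_additive density_measure.
Proof.
move=> /= F mF tF mUF; rewrite /density_measure; apply: cvg_toP.
  apply: ereal_nondecreasing_is_cvgn => m n mn.
  by apply: lee_sum_nneg_natr => // k _ _; exact: integral_ge0.
by rewrite ge0_integral_bigcup//; exact: measurable_funTS.
Qed.

HB.instance Definition _ := isMeasure.Build _ _ _ density_measure
  density_measure0 density_measure_ge0 density_measure_sigma_additive.

Definition measure_of_density : {measure set R -> \bar R} := density_measure.

End density_measure.

(* The bounds on alpha make the densities nonnegative, and sigma-finiteness of
   nu makes rho_nu_density measurable, so that both define measures. *)
Section rho.
Context {R : realType}.
Variable alpha : R.
Hypothesis ha : 0 < alpha < 1.

Definition rho_fun (r x : R) : R :=
  x `^ (alpha - 1) * r /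
  (x `^ (2 * alpha) + 2 * x `^ alpha * r * cos (alpha * pi) + r ^+ 2).

(* the density of X_alpha on (0,oo) *)
Definition rho_density (y : R) : \bar R :=
  (sin (pi * alpha) / pi *
   (y `^ (alpha - 1) /
    (y `^ (2 * alpha) + 2 * y `^ alpha * cos (pi * alpha) + 1)))%:E.

(* possibly +oo on a null set *)
Definition rho_nu_density (nu : {measure set R -> \bar R}) (x : R) : \bar R :=
  ((sin (pi * alpha) / pi)%:E *
   \int[nu]_(r in `]0%R, +oo[) (rho_fun r x)%:E)%E.

Lemma sin_alpha_ge0 : 0 <= sin (pi * alpha) / pi.
Proof.
case/andP: ha => a0 a1; rewrite divr_ge0 ?pi_ge0// sin_ge0_pi//.
apply/andP; split; first by rewrite mulr_ge0 ?pi_ge0// ltW.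
by rewrite ger_pMr ?pi_gt0// ltW.
Qed.

Lemma rho_fun_ge0 r x : 0 < r -> 0 < x -> 0 <= rho_fun r x.
Proof.
move=> r0 x0; rewrite /rho_fun divr_ge0//; first by rewrite mulr_ge0 ?powR_ge0 ?ltW.
rewrite (mulrC 2) powRrM powR_mulrn ?powR_ge0//.
set t := x `^ alpha.
have t0 : 0 <= t by exact: powR_ge0.
have : 0 <= (t - r) ^+ 2 by exact: sqr_ge0.
have := cos_geN1 (alpha * pi).
move: (cos _) => c c1 s.
have : 0 <= t * r * (c + 1) by rewrite mulr_ge0 ?(mulr_ge0 t0 (ltW r0))//; lra.
by nra.
Qed.

Lemma measurable_rho_fun :
  measurable_fun setT (fun z : R * R => rho_fun z.2 z.1).
Proof.
have mp a : measurable_fun setT (fun z : R * R => z.1 `^ a).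
  exact: (measurableT_comp (measurable_powR _)).
apply: measurable_funM; first exact: measurable_funM.
apply: measurable_funVR; apply: measurable_funD; last exact: measurable_funX.
apply: measurable_funD => //.
by do 3?[apply: measurable_funM => //].
Qed.

Definition rho_pos_density : R -> \bar R := rho_density \_ `]0, +oo[.

Lemma rho_pos_density_ge0 y : (0 <= rho_pos_density y)%E.
Proof.
rewrite /rho_pos_density patchE; case: ifPn => //.
rewrite inE/= in_itv/= andbT => y0.
rewrite lee_fin mulr_ge0 ?sin_alpha_ge0//.
have := rho_fun_ge0 ltr01 y0.
by rewrite /rho_fun !mulr1 expr1n (mulrC alpha pi).
Qed.

Lemma measurable_rho_pos_density : measurable_fun [set: R] rho_pos_density.
Proof.
rewrite /rho_pos_density.
apply/(measurable_restrictT rho_density) => //; apply: measurable_funTS.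
rewrite (_ : rho_density =
    EFin \o (fun y => sin (pi * alpha) / pi * rho_fun 1 y)).
  apply/measurable_EFinP/measurable_funM => //.
  exact: (measurable_fun_pair1 (1 : R) measurable_rho_fun).
apply/funext => y.
by rewrite /rho_density /rho_fun /= !mulr1 expr1n (mulrC alpha pi).
Qed.

Definition rho_measure : {measure set R -> \bar R} :=
  measure_of_density measurable_rho_pos_density rho_pos_density_ge0.

Variable nu : {sigma_finite_measure set R -> \bar R}.

Definition rho_nu_pos_density : R -> \bar R := rho_nu_density nu \_ `]0, +oo[.

Lemma rho_nu_pos_density_ge0 x : (0 <= rho_nu_pos_density x)%E.
Proof.
rewrite /rho_nu_pos_density patchE; case: ifPn => //.
rewrite inE/= in_itv/= andbT => x0.
apply: mule_ge0; first by rewrite lee_fin sin_alpha_ge0.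
apply: integral_ge0 => r /=; rewrite in_itv/= andbT => r0.
by rewrite lee_fin rho_fun_ge0.
Qed.

Lemma measurable_rho_nu_pos_density :
  measurable_fun [set: R] rho_nu_pos_density.
Proof.
pose D : set (R * R) := `]0, +oo[%classic `*` `]0, +oo[%classic.
pose h : R * R -> \bar R := (fun z => (rho_fun z.2 z.1)%:E) \_ D.
have mD : measurable D by exact: measurableX.
have mh : measurable_fun setT h.
  rewrite /h; apply/(measurable_restrictT (fun z => (rho_fun z.2 z.1)%:E)) => //; apply: measurable_funTS.
  by apply/measurable_EFinP; exact: measurable_rho_fun.
have h0 z : (0 <= h z)%E.
  rewrite /h patchE; case: ifPn => //; rewrite inE/= /D /=.
  rewrite !in_itv/= !andbT => -[? ?].
  by rewrite lee_fin rho_fun_ge0.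
rewrite (_ : rho_nu_pos_density =
    (fun x => (sin (pi * alpha) / pi)%:E * fubini_F nu h x)%E); last first.
  apply/funext => x; rewrite /rho_nu_pos_density /fubini_F patchE.
  case: ifPn => x0.
    rewrite /rho_nu_density; congr (_ * _)%E; rewrite [LHS]integral_mkcond.
    apply: eq_integral => r _; rewrite /h !patchE.
    by rewrite /D in_setX /= x0.
  rewrite integral0_eq ?mule0// => r _.
  by rewrite /h patchE /D in_setX /= (negbTE x0).
apply: measurable_funeM; exact: measurable_fun_fubini_tonelli_F.
Qed.

Definition rho_nu_measure : {measure set R -> \bar R} :=
  measure_of_density measurable_rho_nu_pos_density rho_nu_pos_density_ge0.

End rho.

Section Lambda.
Context {R : realType}.
Variables (alpha : R) (S : probability R R).

(* S is the law of S_alpha *)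
Definition Lambda_law (p : R) : probability R R :=
  distribution (X_law S) (skew_map alpha p).

Variable nu : {measure set R -> \bar R}.

Definition Lambda_nu (A : set R) : \bar R :=
  (\int[nu]_(r in `]0%R, +oo[) Lambda_law (r / (1 + r))%R A)%E.

Lemma measurable_Lambda_law A : measurable A ->
  measurable_fun [set: R] (fun r : R => Lambda_law (r / (1 + r)) A).
Proof.
move=> mA.
pose F (z : R * R) : R := skew_map alpha (z.1 / (1 + z.1)) z.2.
have mF : measurable_fun setT F.
  apply: (@measurableT_comp _ _ _ _ _ _ (fun z : R * R => skew_map alpha z.1 z.2)
    _ (fun z : R * R => (z.1 / (1 + z.1), z.2))).
    exact: measurable_skew2.
  apply: measurable_fun_pair => //.
  apply: measurable_funM => //; apply: measurable_funVR.
  exact: measurable_funD.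
have mFA : measurable (F @^-1` A) by rewrite -[X in measurable X]setTI; exact: mF.
rewrite (_ : (fun _ => _) = X_law S \o xsection (F @^-1` A)).
  exact: measurable_fun_xsection.
apply/funext => r /=; rewrite /Lambda_law /distribution /pushforward /=.
by congr (X_law S _); apply/seteqP; split => x /=; rewrite xsectionP.
Qed.

Let Lambda_nu0 : Lambda_nu set0 = 0%E.
Proof. by rewrite /Lambda_nu integral0_eq// => r _; rewrite measure0. Qed.

Let Lambda_nu_ge0 A : (0 <= Lambda_nu A)%E.
Proof. exact: integral_ge0. Qed.

Let Lambda_nu_sigma_additive : semi_sigma_additive Lambda_nu.
Proof.
move=> F mF tF mUF; rewrite [X in _ --> X](_ : _ =
  (\int[nu]_(r in `]0%R, +oo[)
     (\sum_(n <oo) Lambda_law (r / (1 + r))%R (F n)))%E); last first.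
  apply: eq_integral => r _.
  by apply/esym/cvg_lim => //; exact: measure_semi_sigma_additive.
apply/cvg_closeP; split.
  by apply: is_cvg_nneseries => n _ _; exact: integral_ge0.
rewrite closeE// integral_nneseries// => n.
by apply: measurable_funTS; exact: measurable_Lambda_law.
Qed.

HB.instance Definition _ := isMeasure.Build _ _ _ Lambda_nu
  Lambda_nu0 Lambda_nu_ge0 Lambda_nu_sigma_additive.

Definition Lambda_nu_measure : {measure set R -> \bar R} := Lambda_nu.

End Lambda.

(* Main.v *)
Require Import Defs.
From mathcomp Require Import all_boot all_order all_algebra.
From mathcomp Require Import ring lra.
From mathcomp Require Import all_classical all_reals all_analysis measurable_realfun.
Set Implicit Arguments.
Unset Strict Implicit.
Unset Printing Implicit Defensive.
Import Order.TTheory GRing.Theory Num.Theory.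
Import numFieldNormedType.Exports.
Local Open Scope classical_set_scope.
Local Open Scope ring_scope.

(* Write psi_nu(l) for the exponent int log(1 + l x) nu(dx).  Everything
   follows from two identities,
     psi_{rho_{alpha,nu}}(l) = psi_nu(l^alpha) / alpha,
     psi_{Lambda_{alpha,nu}}(l) = (psi_nu((1 + l)^alpha) - psi_nu(1)) / alpha,
   together with the fact that a law on the half-line is determined by its
   Laplace transform and by its transform l |-> E[(1 + l X)^(-a)].

   For nu = delta_r the first identity is an integral over the half-line that is
   evaluated by rotating a contour from the positive to the negative axis.  The
   second one comes from E log(1 + c S / S') = log(1 + c^alpha) / alpha, obtained
   by writing the logarithm as a Frullani integral and averaging over S and S'.

   The Laplace transform of Z^(1/alpha) S at l is exp(-theta psi_nu(l^alpha)), and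
   tilting by exp(-c x) shifts l by c and renormalizes: c = 0 and c = 1 give the
   two GGC identities.  In (ii), mixing A_(alpha,p) over xi and tilting M / (M + 1)
   both lead to a multiple of exp(-theta psi_nu((1 + l)^alpha)). *)

(** * Integrals with respect to densities and mixtures *)

(** The measures may be infinite and the densities may take the value [+oo], so exponents are
    computed as extended-real integrals of nonnegative functions: Tonelli and monotone convergence
    then ask for no integrability beforehand, and a difference of logarithms is handled as a sum
    moved to the other side. The contour argument is carried out with real functions. Along
    [z = x exp(- i b)] only the imaginary part of [log(1 - l z) / (1 + z^alpha / r) dz / z] is
    followed. At [b = pi] the logarithm is real and this imaginary part is the wanted integrand. As
    [b] tends to [0] the other factor becomes real and the logarithm has argument [pi] exactly
    beyond [x = 1 / l], which leaves an elementary integral. The delicate point is the singularity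
    of the logarithm at [x = 1 / l], [b = 0]; it is tamed by the vanishing of the imaginary part of
    the other factor. The shift from [l] to [1 + l] in the second identity and in (ii) comes from [1
    + l u / (1 + u) = (1 + (1 + l) u) / (1 + u)]. *)

(* A monotone, additive and homogeneous functional that agrees with a measure on
   indicators is the integral, since every nonnegative measurable function is an
   increasing limit of simple functions. *)
Section ge0_integral_functional.
Local Open Scope ereal_scope.
Context d (Y : measurableType d) (R : realType).
Variables (m : {measure set Y -> \bar R}) (Phi : (Y -> \bar R) -> \bar R).
Hypothesis Phi1 : forall A, measurable A -> Phi (fun y => (\1_A y)%:E) = m A.
Hypothesis PhiD : forall f g, measurable_fun [set: Y] f ->
  measurable_fun [set: Y] g -> (forall y, 0 <= f y) -> (forall y, 0 <= g y) ->
  Phi (fun y => f y + g y) = Phi f + Phi g.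
Hypothesis PhiZ : forall (r : R) f, measurable_fun [set: Y] f ->
  (forall y, 0 <= f y) -> (0 <= r)%R -> Phi (fun y => r%:E * f y) = r%:E * Phi f.
Hypothesis Phi_cvg : forall (g : (Y -> \bar R)^nat) f,
  (forall n, measurable_fun [set: Y] (g n)) -> (forall n y, 0 <= g n y) ->
  (forall y, nondecreasing_seq (g ^~ y)) ->
  (forall y, g n y @[n --> \oo] --> f y) -> Phi (g n) @[n --> \oo] --> Phi f.

Import HBNNSimple.

(** A simple function is a finite combination of indicators of its fibres. The induction over the
    list of values carries measurability and nonnegativity along, because [PhiD] and [PhiZ] ask for
    them. *)
Let Phi_nnsfun (f : {nnsfun Y >-> R}) :
  Phi (fun y => (f y)%:E) = \int[m]_y (f y)%:E.
Proof.
pose h (s : seq R) y : \bar R := \sum_(r <- s) r%:E * (\1_(f @^-1` [set r]) y)%:E.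
have mi r : measurable_fun [set: Y] (fun y => (\1_(f @^-1` [set r]) y : R)%:E).
  by apply/measurable_EFinP/measurable_indic; exact: measurable_sfunP.
have i0 r y : 0 <= (\1_(f @^-1` [set r]) y : R)%:E by rewrite lee_fin.
have key s : (forall r, r \in s -> (0 <= r)%R) ->
    [/\ measurable_fun [set: Y] (h s), forall y, 0 <= h s y &
      Phi (h s) = \int[m]_y h s y].
  elim: s => [_|r s ih rs].
    have -> : h [::] = fun y => (\1_(@set0 Y) y)%:E.
      by apply/funext => y; rewrite /h big_nil indicE in_set0.
    split=> [||] //; first exact/measurable_EFinP/measurable_indic.
    by rewrite Phi1// measure0 integral_indic// set0I measure0.
  have r0 : (0 <= r)%R by apply: rs; rewrite mem_head.
  have [|mh h0 Ph] := ih; first by move=> t ts; apply: rs; rewrite inE ts orbT.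
  have -> : h (r :: s) = fun y => r%:E * (\1_(f @^-1` [set r]) y)%:E + h s y.
    by apply/funext => y; rewrite /h big_cons.
  have m1 : measurable_fun [set: Y] (fun y => r%:E * (\1_(f @^-1` [set r]) y)%:E).
    exact: measurable_funeM.
  have m0 y : 0 <= r%:E * (\1_(f @^-1` [set r]) y)%:E by rewrite mule_ge0.
  split.
  - exact: emeasurable_funD.
  - by move=> y; rewrite adde_ge0.
  - rewrite PhiD// PhiZ// Phi1; last exact: measurable_sfunP.
    rewrite ge0_integralD// Ph ge0_integralZl//.
    by rewrite integral_indic ?setIT//; exact: measurable_sfunP.
have fE : (fun y => (f y)%:E) = h (finmap.enum_fset (fset_set (range f))).
  apply/funext => y; rewrite /h fimfunE fsbig_finite//= -sumEFin.
  by apply: eq_bigr => r _; rewrite EFinM.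
rewrite [LHS](_ : _ = Phi (h (finmap.enum_fset (fset_set (range f))))) ?fE//.
have [|_ _ ->//] := key (finmap.enum_fset (fset_set (range f))).
by move=> r; rewrite in_fset_set// inE => -[y _ <-].
Qed.

Lemma ge0_integral_functional f : measurable_fun [set: Y] f ->
  (forall y, 0 <= f y) -> \int[m]_y f y = Phi f.
Proof.
move=> mf f0; pose g := nnsfun_approx measurableT mf.
have mg n : measurable_fun [set: Y] (fun y => (g n y)%:E) by exact/measurable_EFinP.
have g0 n y : 0 <= (g n y)%:E by rewrite lee_fin.
have ndg y : nondecreasing_seq (fun n => (g n y)%:E).
  by move=> a b ab; rewrite lee_fin; exact/lefP/nd_nnsfun_approx.
have cg y : (g n y)%:E @[n --> \oo] --> f y.
  by apply: cvg_nnsfun_approx => // ? _; exact: f0.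
have := Phi_cvg mg g0 ndg cg.
under eq_fun do rewrite Phi_nnsfun.
apply: cvg_unique => //.
have := @cvg_monotone_convergence _ _ _ m _ measurableT _ mg.
rewrite (_ : (fun x => limn _) = f); last first.
  by apply/funext => y; apply/cvg_lim => //; exact: cg.
by apply => [n y _|y _]; [exact: g0|exact: ndg].
Qed.

End ge0_integral_functional.

Section density_and_mixture.
Local Open Scope ereal_scope.
Context d (Y : measurableType d) (R : realType).

(** The map [phi] lets one statement serve both a plain density ([phi] the identity) and a change of
    measure followed by a push-forward ([phi = to_unit]). *)
Lemma ge0_integral_density d' (X : measurableType d')
    (mu : {measure set X -> \bar R}) (m : {measure set Y -> \bar R})
    (g : X -> \bar R) (phi : X -> Y) :
  measurable_fun [set: X] phi -> measurable_fun [set: X] g -> (forall x, 0 <= g x) ->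
  (forall A, measurable A -> m A = \int[mu]_(x in phi @^-1` A) g x) ->
  forall f, measurable_fun [set: Y] f -> (forall y, 0 <= f y) ->
  \int[m]_y f y = \int[mu]_x (g x * f (phi x)).
Proof.
move=> mphi mg g0 mE f mf f0.
have mc (h : Y -> \bar R) : measurable_fun [set: Y] h -> measurable_fun [set: X] (fun x => h (phi x)).
  by move=> mh; exact: (measurableT_comp mh mphi).
apply: (ge0_integral_functional (Phi := fun f => \int[mu]_x (g x * f (phi x)))) => //.
- move=> A mA; rewrite mE// [RHS]integral_mkcond; apply: eq_integral => x _.
  rewrite patchE indicE (_ : (phi x \in A) = (x \in phi @^-1` A)).
    by case: ifPn; rewrite ?mule1 ?mule0.
  by apply/idP/idP; rewrite !inE.
- move=> f1 f2 mf1 mf2 f10 f20; rewrite -ge0_integralD//.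
  + by apply: eq_integral => y _; rewrite ge0_muleDr.
  + by move=> y _; rewrite mule_ge0.
  + by apply: emeasurable_funM => //; exact: mc.
  + by move=> y _; rewrite mule_ge0.
  + by apply: emeasurable_funM => //; exact: mc.
- move=> r f1 mf1 f10 r0; rewrite -ge0_integralZl//.
  + by apply: eq_integral => y _; rewrite muleCA.
  + by apply: emeasurable_funM => //; exact: mc.
  + by move=> y _; rewrite mule_ge0.
- move=> h f1 mh h0 ndh hf1.
  have := @cvg_monotone_convergence _ _ _ mu _ measurableT (fun n x => g x * h n (phi x)).
  rewrite (_ : (fun x => limn _) = fun x => g x * f1 (phi x)); last first.
    apply/funext => x; apply/cvg_lim => //; set y := phi x.
    have f1E : f1 y = limn (h ^~ y) by apply/esym/cvg_lim => //; exact: hf1.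
    have f10 : 0 <= f1 y.
      rewrite f1E; apply: lime_ge; last exact: nearW.
      by apply/cvg_ex; exists (f1 y); exact: hf1.
    (* The limit product may have the form [0 * +oo], where multiplication is not continuous. If
       [g x = 0] the sequence is constantly 0; if [f1 y = 0], monotonicity forces every [h n y] to
       be 0. *)
    have [g00|gn0] := eqVneq (g x) 0.
      rewrite g00 mul0e; under eq_fun do rewrite mul0e; exact: cvg_cst.
    have [f1y0|f1y0] := eqVneq (f1 y) 0.
      rewrite f1y0 mule0 (_ : (fun n => _) = cst 0); first exact: cvg_cst.
      apply/funext => n; suff -> : h n y = 0 by rewrite mule0.
      apply/eqP; rewrite eq_le h0 andbT -f1y0 f1E.
      rewrite (cvg_lim _ (ereal_nondecreasing_cvgn (ndh y)))//.
      by apply: ereal_sup_ubound; exists n.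
    apply: cvgeM; [|exact: cvg_cst|exact: hf1].
    by apply: neq0_mule_def; rewrite mule_eq0 negb_or gn0 f1y0.
  apply => //.
  + by move=> n; apply: emeasurable_funM => //; exact: mc.
  + by move=> n y _; rewrite mule_ge0.
  + by move=> x _ a b ab; rewrite lee_wpmul2l//; exact: ndh.
Qed.

(** Used twice: for [Lambda_nu], mixed over a possibly infinite measure on the half-line, and for
    the mixture over the law of [xi]. *)
Lemma ge0_integral_mixture d' (X : measurableType d')
    (nu : {measure set X -> \bar R}) (D : set X) (k : X -> {measure set Y -> \bar R})
    (m : {measure set Y -> \bar R}) :
  measurable D ->
  (forall A, measurable A -> measurable_fun [set: X] (k ^~ A)) ->
  (forall A, measurable A -> m A = \int[nu]_(x in D) k x A) ->
  forall f, measurable_fun [set: Y] f -> (forall y, 0 <= f y) ->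
  \int[m]_y f y = \int[nu]_(x in D) \int[k x]_y f y.
Proof.
move=> mD mk mE f mf f0.
have mi h : measurable_fun [set: Y] h -> (forall y, 0 <= h y) ->
    measurable_fun D (fun x => \int[k x]_y h y).
  move=> mh h0; apply: measurable_funTS.
  exact: measurable_fun_integral_kernel.
apply: (ge0_integral_functional
  (Phi := fun f => \int[nu]_(x in D) \int[k x]_y f y)) => //.
- move=> A mA; rewrite mE//; apply: eq_integral => x _.
  by rewrite integral_indic// setIT.
- move=> f1 f2 mf1 mf2 f10 f20; rewrite -ge0_integralD//; first last.
  + exact: mi.
  + by move=> x _; exact: integral_ge0.
  + exact: mi.
  + by move=> x _; exact: integral_ge0.
  by apply: eq_integral => x _; rewrite ge0_integralD.
- move=> r f1 mf1 f10 r0; rewrite -ge0_integralZl//; first last.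
  + by move=> x _; exact: integral_ge0.
  + exact: mi.
  by apply: eq_integral => x _; rewrite ge0_integralZl.
- move=> h f1 mh h0 ndh hf1.
  have f1E : f1 = fun y => limn (h ^~ y).
    by apply/funext => y; apply/esym/cvg_lim => //; exact: hf1.
  have kE x : \int[k x]_y f1 y = limn (fun n => \int[k x]_y h n y).
    by rewrite f1E; exact: monotone_convergence.
  rewrite (eq_integral (fun x => limn (fun n => \int[k x]_y h n y))); last first.
    by move=> x _; exact: kE.
  apply: cvg_monotone_convergence => //.
  + by move=> n; exact: mi.
  + by move=> n x _; exact: integral_ge0.
  + move=> x _ a b ab; apply: ge0_le_integral => // y _; by apply: (ndh y).
Qed.

End density_and_mixture.

(** * Calculus on the half-line *)

Section calculus.
Context {R : realType}.
Local Notation mu := (@lebesgue_measure R).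

Lemma is_derive_continuous (F : R -> R) x df :
  is_derive x (1 : R) F df -> {for x, continuous F}.
Proof.
by move=> [dF _]; apply/differentiable_continuous; rewrite -derivable1_diffP.
Qed.

Lemma cvg_seq_continuous (f : R -> R) (u : nat -> R) (a : R) :
  {for a, continuous f} -> u k @[k --> \oo] --> a -> f (u k) @[k --> \oo] --> f a.
Proof. by move=> cf ua; apply: (cvg_comp u f ua); exact: cf. Qed.

Lemma gt0_cvgnMry (M : R) (u : nat -> R) : 0 < M ->
  u k @[k --> \oo] --> +oo -> M * u k @[k --> \oo] --> +oo.
Proof.
move=> M0 /cvgryPge uy; apply/cvgryPge => A.
by apply: filterS (uy (A / M)) => k; rewrite ler_pdivrMr// mulrC.
Qed.

Lemma FTC_segment (F f : R -> R) (a b : R) : a < b ->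
  (forall x : R, a <= x <= b -> is_derive x (1 : R) F (f x)) ->
  (forall x : R, a <= x <= b -> {for x, continuous f}) ->
  (\int[mu]_(x in `[a, b]) (f x)%:E = (F b - F a)%:E)%E.
Proof.
move=> ab dF cf; rewrite EFinB; apply: continuous_FTC2 => //.
- apply: continuous_in_subspaceT => x /set_mem /=; rewrite in_itv/=; exact: cf.
- split.
  + by move=> x; rewrite in_itv/= => /andP[/ltW ax /ltW xb];
       have [] := dF x; rewrite ?ax.
  + apply: cvg_at_right_filter; apply: is_derive_continuous (dF _ _).
    by rewrite lexx ltW.
  + apply: cvg_at_left_filter; apply: is_derive_continuous (dF _ _).
    by rewrite lexx ltW.
- move=> x; rewrite in_itv/= => /andP[/ltW ax /ltW xb].
  by rewrite derive1E; have [|_ ->//] := dF x; rewrite ax.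
Qed.

Lemma cvgn_S2y : (n.+2%:R : R) @[n --> \oo] --> +oo.
Proof.
apply/cvgryPge => A; near=> n.
apply: le_trans (ltW (truncnS_gt A)) _.
by rewrite ler_nat ltnS leqW//; near: n; exact: nbhs_infty_ge.
Unshelve. all: by end_near. Qed.

Lemma cvgn_invS2 : (n.+2%:R^-1 : R) @[n --> \oo] --> 0.
Proof.
by have := @cvg_harmonic R; rewrite -(cvg_shiftS (@harmonic R)).
Qed.

Lemma S2_itv n : (n.+2%:R^-1 : R) < n.+2%:R.
Proof.
apply: (@lt_trans _ _ 1); last by rewrite ltr1n.
by rewrite invf_lt1 ?ltr1n.
Qed.

(** The half-line is exhausted by segments; [n + 2] makes even the first one nondegenerate. The
    factor [c] gives the images of these segments under [x |-> c x], as a change of scale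
    requires. *)
Lemma ge0_cvg_integral_itv0y_scaled (c : R) (f : R -> \bar R) : 0 < c ->
  measurable_fun (`]0, +oo[%classic : set R) f -> (forall x : R, 0 < x -> (0 <= f x)%E) ->
  (\int[mu]_(x in `[(c * n.+2%:R^-1)%R, (c * n.+2%:R)%R]) f x)%E @[n --> \oo] -->
  (\int[mu]_(x in `]0%R, +oo[) f x)%E.
Proof.
move=> c0 mf f0.
have cupE : `]0, +oo[%classic = \bigcup_n `[c * n.+2%:R^-1, c * n.+2%:R : R]%classic.
  apply/seteqP; split => x /=.
    rewrite in_itv/= andbT => x0; pose z := x / c.
    have z0 : 0 < z by rewrite divr_gt0.
    have xE : x = c * z by rewrite /z mulrC divfK// gt_eqF.
    (* An index above [z + 1 / z] takes care of both end points at once. *)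
    have zlt : z + z^-1 <= (Num.truncn (z + z^-1)).+2%:R.
      by rewrite (le_trans (ltW (truncnS_gt _)))// ler_nat.
    exists (Num.truncn (z + z^-1)) => //=; rewrite in_itv/= xE !ler_pM2l//.
    apply/andP; split; last by rewrite (le_trans _ zlt)// lerDl invr_ge0 ltW.
    rewrite -[leRHS]invrK lef_pV2 ?posrE ?invr_gt0//.
    by rewrite (le_trans _ zlt)// lerDr ltW.
  move=> [n _] /=; rewrite !in_itv/= andbT => /andP[+ _].
  by apply: lt_le_trans; rewrite mulr_gt0// invr_gt0.
move: (mf) (f0); rewrite cupE => mf' f0'.
apply: ge0_nondecreasing_set_cvg_integral => //.
- apply/nondecreasing_seqP => n; rewrite subsetEset.
  by apply: subset_itv; rewrite bnd_simp ler_pM2l// ?lef_pV2 ?posrE// ler_nat.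
- move=> n; apply: measurable_funS mf => //; rewrite cupE => x nx; by exists n.
- move=> n x /=; rewrite in_itv/= => /andP[nx _]; apply: f0.
  by rewrite (lt_le_trans _ nx)// mulr_gt0// invr_gt0.
Qed.

Lemma ge0_cvg_integral_itv0y (f : R -> \bar R) :
  measurable_fun (`]0, +oo[%classic : set R) f -> (forall x : R, 0 < x -> (0 <= f x)%E) ->
  (\int[mu]_(x in `[(n.+2%:R^-1)%R, n.+2%:R%R]) f x)%E @[n --> \oo] -->
  (\int[mu]_(x in `]0%R, +oo[) f x)%E.
Proof.
move=> mf f0; have := ge0_cvg_integral_itv0y_scaled ltr01 mf f0.
by under eq_fun do rewrite !mul1r.
Qed.

Lemma cvgn_invS2_powR (p : R) : 0 < p ->
  (n.+2%:R^-1 : R) `^ p @[n --> \oo] --> 0.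
Proof.
move=> p0; have /cvg_at_rightP := powR_cvg0 p0; apply.
by split; [move=> n; rewrite invr_gt0|exact: cvgn_invS2].
Qed.

(** Since [f] is nonnegative, its integral is the limit over the exhausting segments, so limits of
    [F] along the two sequences of end points suffice. *)
Lemma ge0_FTC_itv0y (F f : R -> R) (l0 l : R) :
  (forall x : R, 0 < x -> is_derive x (1 : R) F (f x)) ->
  (forall x : R, 0 < x -> {for x, continuous f}) ->
  (forall x : R, 0 < x -> 0 <= f x) ->
  F n.+2%:R^-1 @[n --> \oo] --> l0 -> F n.+2%:R @[n --> \oo] --> l ->
  (\int[mu]_(x in `]0%R, +oo[) (f x)%:E = (l - l0)%:E)%E.
Proof.
move=> dF cf f0 Fl0 Fl.
have : (\int[mu]_(x in `[(n.+2%:R^-1)%R, n.+2%:R%R]) (f x)%:E)%E @[n --> \oo] -->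
       (l - l0)%:E.
  rewrite (_ : (fun _ => _) =
      fun n => (F n.+2%:R - F n.+2%:R^-1)%:E); last first.
    apply/funext => n; apply: FTC_segment; first exact: S2_itv.
    - move=> x /andP[nx _]; apply: dF.
      by rewrite (lt_le_trans _ nx)// invr_gt0.
    - move=> x /andP[nx _]; apply: cf.
      by rewrite (lt_le_trans _ nx)// invr_gt0.
  by apply: cvg_EFin; [exact: nearW|exact: cvgB].
have mf : measurable_fun (`]0, +oo[%classic : set R) f.
  apply: open_continuous_measurable_fun => // x.
  by rewrite inE/= in_itv/= andbT; exact: cf.
apply: cvg_unique => //; apply: ge0_cvg_integral_itv0y.
- exact/measurable_EFinP.
- by move=> x x0; rewrite lee_fin f0.
Qed.

Lemma continuous_itv_integrable (f : R -> R) (a c : R) :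
  (forall x : R, a <= x <= c -> {for x, continuous f}) ->
  mu.-integrable `[a, c] (EFin \o f).
Proof.
move=> cf; apply: continuous_compact_integrable; first exact: segment_compact.
by apply: continuous_in_subspaceT => x /set_mem /=; rewrite in_itv/=; exact: cf.
Qed.

Lemma continuous_itv_measurable (f : R -> R) (a c : R) :
  (forall x : R, a <= x <= c -> {for x, continuous f}) ->
  measurable_fun `[a, c] f.
Proof.
move=> cf; apply: subspace_continuous_measurable_fun => //.
by apply: continuous_in_subspaceT => x /set_mem /=; rewrite in_itv/=; exact: cf.
Qed.

End calculus.

Section is_derive_pointwise.
Context {R : realType}.
Implicit Types (f g : R -> R) (x df dg : R).

(** With functions written pointwise, these rules can be nested into a proof term that mirrors the
    expression to be differentiated. The same terms give continuity through [is_derive_continuous],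
    where the value of the derivative is left to unification. *)
Lemma is_deriveDE f g x df dg : is_derive x (1 : R) f df ->
  is_derive x (1 : R) g dg -> is_derive x (1 : R) (fun y => f y + g y) (df + dg).
Proof. by move=> ? ?; exact: is_deriveD. Qed.

Lemma is_deriveBE f g x df dg : is_derive x (1 : R) f df ->
  is_derive x (1 : R) g dg -> is_derive x (1 : R) (fun y => f y - g y) (df - dg).
Proof. by move=> ? ?; exact: is_deriveB. Qed.

Lemma is_deriveME f g x df dg : is_derive x (1 : R) f df ->
  is_derive x (1 : R) g dg ->
  is_derive x (1 : R) (fun y => f y * g y) (df * g x + f x * dg).
Proof.
move=> dfx dgx; apply: is_derive_eq (is_deriveM dfx dgx) _.
by rewrite addrC /GRing.scale/= (mulrC df).
Qed.

Lemma is_deriveVE f x df : f x != 0 -> is_derive x (1 : R) f df ->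
  is_derive x (1 : R) (fun y => (f y)^-1) (- df / f x ^+ 2).
Proof.
move=> fx0 [dfx <-]; split; first exact: derivableV.
by rewrite deriveV// /GRing.scale/= mulNr mulrC -mulNr -exprVn.
Qed.

Lemma is_derive_compE f g x df dg : is_derive (g x) (1 : R) f df ->
  is_derive x (1 : R) g dg -> is_derive x (1 : R) (fun y => f (g y)) (df * dg).
Proof. by move=> ? ?; exact: is_derive1_comp. Qed.

Lemma is_derive_linear (c x : R) : is_derive x (1 : R) (fun y => c * y) c.
Proof.
apply: is_derive_eq (is_deriveME (is_derive_cst c x 1) (is_derive_id x 1)) _.
by rewrite mul0r add0r mulr1.
Qed.

End is_derive_pointwise.

Section fubini_tonelli_in.
Local Open Scope ereal_scope.
Context d1 d2 (T1 : measurableType d1) (T2 : measurableType d2) (R : realType).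
Variables (m1 : {sigma_finite_measure set T1 -> \bar R})
  (m2 : {sigma_finite_measure set T2 -> \bar R}).

(** Nonnegativity is asked only on the rectangle because several integrands below change sign
    outside the positive quadrant; extension by 0 reduces this to Tonelli. *)
Lemma fubini_tonelli_in (A : set T1) (B : set T2) (f : T1 * T2 -> \bar R) :
  measurable A -> measurable B -> measurable_fun [set: T1 * T2] f ->
  (forall x y, A x -> B y -> 0 <= f (x, y)) ->
  \int[m1]_(x in A) \int[m2]_(y in B) f (x, y) =
  \int[m2]_(y in B) \int[m1]_(x in A) f (x, y).
Proof.
move=> mA mB mf f0.
have mAB : measurable (A `*` B) by exact: measurableX.
pose h := f \_ (A `*` B).
have mh : measurable_fun setT h by apply/(measurable_restrictT f) => //; exact: measurable_funTS.
have h0 z : 0 <= h z.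
  by case: z => x y; rewrite /h patchE; case: ifPn => //; rewrite inE => -[/= ? ?]; exact: f0.
have := fubini_tonelli (m1 := m1) (m2 := m2) h mh h0.
have -> : \int[m1]_(x in A) \int[m2]_(y in B) f (x, y) = \int[m1]_x \int[m2]_y h (x, y).
  rewrite integral_mkcond; apply: eq_integral => x _; rewrite patchE; case: ifPn => xA.
    rewrite integral_mkcond; apply: eq_integral => y _.
    by rewrite /h !patchE in_setX xA.
  by rewrite integral0_eq// => y _; rewrite /h patchE in_setX (negbTE xA).
move=> ->; rewrite [RHS]integral_mkcond; apply: eq_integral => y _.
rewrite patchE; case: ifPn => yB.
  rewrite [RHS]integral_mkcond; apply: eq_integral => x _.
  by rewrite /h !patchE in_setX yB andbT.
by rewrite integral0_eq// => x _; rewrite /h patchE in_setX (negbTE yB) andbF.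
Qed.

End fubini_tonelli_in.

(** * The ratio of two stable variables *)

Section frullani.
Context {R : realType}.
Local Notation mu := (@lebesgue_measure R).

Lemma integral_powR_expR (g s : R) : 0 < g -> 0 < s ->
  (\int[mu]_(t in `]0%R, +oo[) (t `^ (g - 1) * expR (- (s * t `^ g)))%:E =
   ((g * s)^-1)%:E)%E.
Proof.
move=> g0 s0; pose F (t : R) : R := - (g * s)^-1 * expR (- (s * t `^ g)).
have dF (t : R) : 0 < t -> is_derive t (1 : R) F (t `^ (g - 1) * expR (- (s * t `^ g))).
  move=> t0; have dp := is_derive1_powR g t0.
  apply: (is_derive_eq (is_deriveME (is_derive_cst (- (g * s)^-1 : R) t 1)
    (is_derive_compE (is_derive_expR _) (is_deriveN (is_deriveME (is_derive_cst (s : R) t 1) dp))))).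
  by rewrite /cst; field; rewrite !gt_eqF.
have cf (t : R) : 0 < t -> {for t, continuous (fun t : R => t `^ (g - 1) * expR (- (s * t `^ g)))}.
  move=> t0.
  exact: (is_derive_continuous (is_deriveME (is_derive1_powR (g - 1) t0)
    (is_derive_compE (is_derive_expR _) (is_deriveN (is_deriveME (is_derive_cst (s : R) t 1) (is_derive1_powR g t0)))))).
have cexp (x : R) : {for x, continuous (@expR R)} by exact: continuous_expR.
rewrite (ge0_FTC_itv0y (l0 := - (g * s)^-1) (l := 0) dF cf)/=.
- by rewrite sub0r opprK.
- by move=> t t0; rewrite mulr_ge0 ?powR_ge0 ?expR_ge0.
- rewrite -[X in _ --> X]mulr1; apply: cvgM; first exact: cvg_cst.
  rewrite -[X in _ --> X](@expR0 R) (_ : 0 = - (s * 0)); last by rewrite mulr0 oppr0.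
  apply: (cvg_seq_continuous (cexp _)); apply: cvgN.
  by apply: cvgM; [exact: cvg_cst|exact: cvgn_invS2_powR].
- rewrite -[X in _ --> X](mulr0 (- (g * s)^-1)); apply: cvgM; first exact: cvg_cst.
  have h : s^-1 * n.+2%:R^-1 `^ g @[n --> \oo] --> 0.
    rewrite -[X in _ --> X](mulr0 (s^-1)).
    by apply: cvgM; [exact: cvg_cst|exact: cvgn_invS2_powR].
  (* The bound is [exp(- u) <= 1 / u], from [1 + u <= exp u]. *)
  apply: (squeeze_cvgr _ (cvg_cst 0) h); apply: nearW => n.
  have x0 : 0 < s * n.+2%:R `^ g by rewrite mulr_gt0// powR_gt0.
  rewrite expR_ge0/= expRN -[n.+2%:R^-1]powR_inv1// -powRrM mulN1r powRN -invfM.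
  rewrite lef_pV2 ?posrE ?expR_gt0// (le_trans _ (expR_ge1Dx _))//.
  by rewrite lerDr.
Qed.

(** The integrand is the integral of [t^(g - 1) exp(- s t^g)] over [s] in [[p, p + q]], and Tonelli
    leaves the integral of [1 / (g s)]. The exponent is [g = 1] when the logarithm is expanded and
    [g = alpha] once both stable variables have been averaged out. *)
Lemma frullani (g p q : R) : 0 < g -> 0 < p -> 0 < q ->
  (\int[mu]_(t in `]0%R, +oo[)
     (expR (- (p * t `^ g)) * (1 - expR (- (q * t `^ g))) / t)%:E =
   (ln ((p + q) / p) / g)%:E)%E.
Proof.
move=> g0 p0 q0; have pq : p < p + q by rewrite ltrDl.
pose f (z : R * R) : \bar R := (z.1 `^ (g - 1) * expR (- (z.2 * z.1 `^ g)))%:E.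
have mf : measurable_fun setT f.
  apply/measurable_EFinP; apply: measurable_funM.
    exact: (measurableT_comp (measurable_powR _)).
  apply: measurableT_comp => //; apply: measurableT_comp => //.
  by apply: measurable_funM => //; exact: (measurableT_comp (measurable_powR _)).
transitivity (\int[mu]_(t in `]0%R, +oo[) \int[mu]_(s in `[p, (p + q)%R]) f (t, s))%E.
  apply: eq_integral => t; rewrite inE/= in_itv/= andbT => t0.
  have ta0 : 0 < t `^ g by rewrite powR_gt0.
  have dF (s : R) : p <= s <= p + q ->
      is_derive s (1 : R) (fun s : R => - (t^-1) * expR (- (s * t `^ g)))
        (t `^ (g - 1) * expR (- (s * t `^ g))).
    move=> _.
    apply: (is_derive_eq (is_deriveME (is_derive_cst (- t^-1 : R) s 1)
      (is_derive_compE (is_derive_expR _)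
       (is_deriveN (is_deriveME (is_derive_id s (1 : R)) (is_derive_cst (t `^ g : R) s 1)))))).
    rewrite powRB ?powRr1 ?(ltW t0) ?(gt_eqF t0) ?implybT// /cst.
    by field; rewrite gt_eqF.
  have cf (s : R) : p <= s <= p + q ->
      {for s, continuous (fun s : R => t `^ (g - 1) * expR (- (s * t `^ g)))}.
    move=> _.
    exact: (is_derive_continuous (is_deriveME (is_derive_cst (t `^ (g - 1) : R) s 1)
      (is_derive_compE (is_derive_expR _)
       (is_deriveN (is_deriveME (is_derive_id s (1 : R)) (is_derive_cst (t `^ g : R) s 1)))))).
  rewrite /f/= (FTC_segment pq dF cf)/= (mulrDl p) opprD expRD; congr EFin.
  by field; rewrite gt_eqF.
rewrite (fubini_tonelli_in mu mu)//; last first.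
  by move=> t s _ _; rewrite /f lee_fin mulr_ge0 ?powR_ge0 ?expR_ge0.
have pos (s : R) : p <= s <= p + q -> 0 < s.
  by move=> /andP[ps _]; exact: lt_le_trans ps.
transitivity (\int[mu]_(s in `[p, (p + q)%R]) ((g * s)^-1)%:E)%E.
  apply: eq_integral => s; rewrite inE/= in_itv/= => /pos s0.
  exact: integral_powR_expR.
have dF (s : R) : p <= s <= p + q -> is_derive s (1 : R) (fun s : R => g^-1 * ln s) ((g * s)^-1).
  move=> /pos s0.
  apply: (is_derive_eq (is_deriveME (is_derive_cst (g^-1 : R) s 1) (is_derive1_ln s0))).
  by rewrite mul0r add0r invfM.
have cf (s : R) : p <= s <= p + q -> {for s, continuous (fun s : R => (g * s)^-1)}.
  move=> /pos s0; have gs : g * s != 0 by rewrite gt_eqF// mulr_gt0.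
  exact: (is_derive_continuous (is_deriveVE gs (is_derive_linear g s))).
rewrite (FTC_segment pq dF cf) ln_div ?posrE ?addr_gt0//.
by congr EFin; ring.
Qed.

End frullani.

Section positive_measures.
Context {R : realType}.
Local Open Scope ereal_scope.
Implicit Types (P : {measure set R -> \bar R}).

Lemma ge0_integral_itv0y P (f : R -> \bar R) : P `]-oo, 0%R]%classic = 0 ->
  measurable_fun [set: R] f -> (forall x, 0 <= f x) ->
  \int[P]_x f x = \int[P]_(x in `]0%R, +oo[) f x.
Proof.
move=> P0 mf f0; rewrite (ge0_negligible_integral (N := (`]-oo, 0%R]%classic : set R)))//.
by rewrite setTD setCitvl.
Qed.

Lemma ge0_integral_itvcy P (f : R -> \bar R) : P `]-oo, 0%R[%classic = 0 ->
  measurable_fun [set: R] f -> (forall x, 0 <= f x) ->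
  \int[P]_x f x = \int[P]_(x in `[0%R, +oo[) f x.
Proof.
move=> P0 mf f0; rewrite (ge0_negligible_integral (N := (`]-oo, 0%R[%classic : set R)))//.
by rewrite setTD setCitvl.
Qed.

Lemma probability_itv0y (Q : probability R R) : Q `]-oo, 0%R]%classic = 0 ->
  Q `]0%R, +oo[%classic = 1.
Proof.
move=> Q0; rewrite (_ : `]0%R, +oo[%classic = ~` (`]-oo, 0%R]%classic : set R)); last by rewrite setCitvl.
by rewrite probability_setC// Q0 sube0.
Qed.

End positive_measures.

Section stable_ratio.
Context {R : realType}.
Variables (alpha : R) (S : probability R R).
Hypotheses (alpha0 : 0 < alpha) (hS : stable_law alpha S).
Local Notation mu := (@lebesgue_measure R).
Local Notation pos := (`]0%R, +oo[%classic : set R).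

Let S0 : S `]-oo, 0%R]%classic = 0%E. Proof. by case: hS. Qed.

Let measurable_expRN (l : R) : measurable_fun [set: R] (fun x : R => (expR (- (l * x)))%:E).
Proof.
by apply/measurable_EFinP; apply: measurableT_comp => //; apply: measurableT_comp.
Qed.

Lemma stable_laplace (l : R) : 0 <= l ->
  (\int[S]_(s in `]0%R, +oo[) (expR (- (l * s)))%:E = (expR (- l `^ alpha))%:E)%E.
Proof.
move=> l0; rewrite -ge0_integral_itv0y//; first by case: hS => _; apply. 
Qed.

Lemma stable_laplace_compl (l : R) : 0 <= l ->
  (\int[S]_(s in `]0%R, +oo[) (1 - expR (- (l * s)))%:E =
   (1 - expR (- l `^ alpha))%:E)%E.
Proof.
move=> l0.
have me : measurable_fun pos (fun x : R => (expR (- (l * x)))%:E).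
  exact: measurable_funTS.
have mc : measurable_fun pos (fun x : R => (1 - expR (- (l * x)))%:E).
  by apply/measurable_EFinP; apply: measurable_funB => //; exact/measurable_EFinP.
have c0 (s : R) : pos s -> (0 <= (1 - expR (- (l * s)))%:E)%E.
  rewrite /= in_itv/= andbT => s0; rewrite lee_fin subr_ge0 -expR0 ler_expR.
  by rewrite oppr_le0 mulr_ge0// ltW.
have : (\int[S]_(s in `]0%R, +oo[) (1 - expR (- (l * s)))%:E +
  \int[S]_(s in `]0%R, +oo[) (expR (- (l * s)))%:E = 1)%E.
  rewrite -ge0_integralD//.
  rewrite (eq_integral (cst 1%E)); last by move=> s _; rewrite -EFinD subrK.
  by rewrite integral_cst// mul1e; exact: probability_itv0y.
rewrite stable_laplace// => h.
have := congr1 (fun z => z - (expR (- l `^ alpha))%:E)%E h.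
by rewrite addeK// => ->.
Qed.

Lemma integral_ln_stable_ratio (c : R) : 0 < c ->
  (\int[X_law S]_(x in `]0%R, +oo[) (ln (1 + c * x))%:E =
   (ln (1 + c `^ alpha) / alpha)%:E)%E.
Proof.
move=> c0.
have mln : measurable_fun [set: R] (fun x => (ln (1 + c * x))%:E).
  apply/measurable_EFinP; apply: measurableT_comp => //.
  by apply: measurable_funD => //; exact: measurable_funM.
pose u := (fun x : R => (ln (1 + c * x))%:E) \_ pos.
have mu_ : measurable_fun [set: R] u.
  apply: (measurable_restrictT _ _).1; [exact: measurable_itv|exact: measurable_funTS].
have u0 x : (0 <= u x)%E.
  rewrite /u patchE; case: ifPn => //; rewrite inE/= in_itv/= andbT => x0.
  by rewrite lee_fin ln_ge0// lerDl mulr_ge0// ltW.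
rewrite integral_mkcond -/u ge0_integral_distribution// fubini_tonelli1//=; last first.
  exact: (measurableT_comp mu_ measurable_ratioR).
rewrite /fubini_F (ge0_integral_itv0y S0); last 2 first.
- apply: (@measurable_fun_fubini_tonelli_F _ _ _ _ _ S (u \o ratioR)) => //.
  exact: (measurableT_comp mu_ measurable_ratioR).
  by move=> z; exact: u0.
- by move=> x; apply: integral_ge0 => y _; exact: u0.
(* Frullani integrand for [ln ((s' + c s) / s')], at [z = (s', t)], with [s] fixed. *)
pose f (s : R) (z : R * R) : \bar R := (expR (- (z.2 * z.1)) * (1 - expR (- (c * s * z.2))) / z.2)%:E.
have f0 (s s' t : R) : 0 < s -> 0 < t -> (0 <= f s (s', t))%E.
  move=> s0 t0; rewrite lee_fin divr_ge0 ?(ltW t0)// mulr_ge0 ?expR_ge0// subr_ge0.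
  by rewrite -expR0 ler_expR oppr_le0 !mulr_ge0// ltW.
have mf s : measurable_fun setT (f s).
  apply/measurable_EFinP; apply: measurable_funM; last exact: measurable_funVR.
  apply: measurable_funM.
    apply: measurableT_comp => //; apply: measurableT_comp => //.
    exact: measurable_funM.
  apply: measurable_funB => //.
  apply: measurableT_comp => //; apply: measurableT_comp => //.
  exact: measurable_funM.
(* What remains at [z = (s, t)] after averaging over [s'], which replaces [exp(- t s')] by
   [exp(- t^alpha)]. *)
pose h (z : R * R) : \bar R := ((1 - expR (- (c * z.2 * z.1))) * (expR (- z.2 `^ alpha) / z.2))%:E.
have mh : measurable_fun setT h.
  apply/measurable_EFinP; apply: measurable_funM.
    apply: measurable_funB => //.
    apply: measurableT_comp => //; apply: measurableT_comp => //.
    by apply: measurable_funM => //; exact: measurable_funM.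
  apply: measurable_funM; last exact: measurable_funVR.
  apply: measurableT_comp => //; apply: measurableT_comp => //.
  exact: (measurableT_comp (measurable_powR _)).
transitivity (\int[S]_(s in pos) \int[mu]_(t in pos) h (s, t))%E.
  apply: eq_integral => s; rewrite inE/= in_itv/= andbT => s0.
  rewrite (ge0_integral_itv0y S0); last 2 first.
  - have mr : measurable_fun [set: R] (fun s' : R => s / s').
      by apply: measurable_funM => //; exact: measurable_invR.
    exact: (measurableT_comp mu_ mr).
  - by move=> x; exact: u0.
  transitivity (\int[S]_(s' in pos) \int[mu]_(t in pos) f s (s', t))%E.
    apply: eq_integral => s'; rewrite inE/= in_itv/= andbT => s'0.
    have rs : 0 < s / s' by rewrite divr_gt0.
    rewrite /u patchE ifT; last by rewrite inE/= in_itv/= andbT.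
    have cs0 : 0 < c * s by rewrite mulr_gt0.
    have -> : (ln (1 + c * (s / s')))%:E = (ln ((s' + c * s) / s') / 1)%:E.
      by rewrite divr1; congr EFin; congr ln; field; rewrite gt_eqF.
    rewrite -(frullani ltr01 s'0 cs0); apply: eq_integral => t.
    rewrite inE/= in_itv/= andbT => t0.
    by rewrite /f/= powRr1 ?(ltW t0)// (mulrC t).
  rewrite (fubini_tonelli_in S mu)//; last first.
    by move=> s' t /=; rewrite !in_itv/= !andbT => _; exact: f0.
    exact: mf.
  apply: eq_integral => t; rewrite inE/= in_itv/= andbT => t0.
  rewrite /h/=.
  have k0 : 0 <= (1 - expR (- (c * t * s))) / t.
    rewrite divr_ge0 ?(ltW t0)// subr_ge0 -expR0 ler_expR oppr_le0 !mulr_ge0//; exact: ltW.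
  rewrite (eq_integral (fun s' => ((1 - expR (- (c * t * s))) / t)%:E * (expR (- (t * s')))%:E)%E).
    rewrite ge0_integralZl//; last exact: measurable_funTS.
    by rewrite stable_laplace ?ltW// -EFinM; congr EFin; ring.
  by move=> s' _; rewrite /f/= -EFinM (mulrAC c); congr EFin; ring.
rewrite (fubini_tonelli_in S mu)//; last first.
  move=> s t /=; rewrite !in_itv/= !andbT => s0 t0; rewrite lee_fin mulr_ge0//.
    by rewrite subr_ge0 -expR0 ler_expR oppr_le0 !mulr_ge0// ltW.
  by rewrite divr_ge0 ?expR_ge0// ltW.
(* Averaging over [s] gives again a Frullani integral, now with exponent [alpha], [p = 1] and
   [q = c^alpha]. *)
have ca0 : 0 < c `^ alpha by rewrite powR_gt0.
have -> : ln (1 + c `^ alpha) / alpha = ln ((1 + c `^ alpha) / 1) / alpha by rewrite divr1.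
rewrite -(frullani alpha0 ltr01 ca0).
apply: eq_integral => t; rewrite inE/= in_itv/= andbT => t0.
have ct0 : 0 <= c * t by rewrite mulr_ge0// ltW.
have k0 : 0 <= expR (- t `^ alpha) / t by rewrite divr_ge0 ?expR_ge0 ?ltW.
rewrite (eq_integral (fun s => (expR (- t `^ alpha) / t)%:E * (1 - expR (- (c * t * s)))%:E)%E).
  rewrite ge0_integralZl//; first last.
  - move=> s /=; rewrite in_itv/= andbT => s0; rewrite lee_fin subr_ge0 -expR0 ler_expR.
    by rewrite oppr_le0 mulr_ge0// ltW.
  - apply/measurable_EFinP; apply: measurable_funB => //.
    by apply: measurable_funTS; apply/measurable_EFinP; exact: measurable_expRN.
  rewrite stable_laplace_compl// -EFinM mul1r powRM ?(ltW c0) ?(ltW t0)//.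
  by congr EFin; ring.
by move=> s _; rewrite /h/= -EFinM; congr EFin; ring.
Qed.

End stable_ratio.

(** * Uniqueness of Laplace transforms *)

Section laplace_uniqueness.
Context {R : realType}.
Implicit Types (m : {measure set R -> \bar R}) (x y v : R).
Local Notation D := (`[0, +oo[%classic : set R).

Lemma bernoulli_ineqB v k : 0 <= v <= 1 -> 1 - k%:R * v <= (1 - v) ^+ k.
Proof.
move=> /andP[v0 v1]; elim: k => [|k ih]; first by rewrite mul0r subr0 expr0.
rewrite exprS; have k0 : 0 <= k%:R * v by rewrite mulr_ge0.
have := ler_wpM2l (_ : 0 <= 1 - v) ih; rewrite subr_ge0 => /(_ v1).
apply: le_trans; rewrite -natr1; have := mulr_ge0 v0 k0; lra.
Qed.

Lemma bernoulli_ineqD v k : 0 <= v -> 1 + k%:R * v <= (1 + v) ^+ k.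
Proof.
move=> v0; elim: k => [|k ih]; first by rewrite mul0r addr0 expr0.
rewrite exprS; have k0 : 0 <= k%:R * v by rewrite mulr_ge0.
have := ler_wpM2l (_ : 0 <= 1 + v) ih; rewrite addr_ge0// => /(_ isT).
apply: le_trans; rewrite -natr1; have := mulr_ge0 v0 k0; lra.
Qed.

(* (1 - u ^ n) ^ N with u = exp (- x) and N ~ n exp (n y) tends to the
   indicator of u < exp (- y), by Bernoulli's inequality on both sides. *)
Definition cutoff y n x : R :=
  (1 - expR (- (n.+1%:R * x))) ^+ (n.+1 * (Num.truncn (expR (n.+1%:R * y))).+1).

Let v01 n x : 0 <= x -> 0 <= expR (- (n.+1%:R * x)) <= 1.
Proof.
by move=> x0; rewrite expR_ge0/= -expR0 ler_expR oppr_le0 mulr_ge0.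
Qed.

Lemma cutoff_ge0_le1 y n x : 0 <= x -> 0 <= cutoff y n x <= 1.
Proof.
move=> /(v01 n) /andP[v0 v1]; rewrite /cutoff exprn_ge0 ?subr_ge0//=.
by rewrite exprn_ile1 ?subr_ge0// lerBlDr lerDl.
Qed.

(** Write [k = n + 1], [a = x - y], [v = exp(- k x)] and [N] for the exponent, so that
    [N <= 2 k exp(k y)]. Then [N v <= 2 k exp(- k a) <= 4 / (k a^2)], because [exp u >= u^2 / 2];
    this is the origin of the constant [4 / a ^+ 2]. *)
Lemma cutoff_cvg1 y x : 0 <= y -> y < x -> cutoff y n x @[n --> \oo] --> (1 : R).
Proof.
move=> y0 yx; have x0 : 0 < x by exact: le_lt_trans yx.
pose a := x - y; have a0 : 0 < a by rewrite subr_gt0.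
have lo : 1 - 4 / a ^+ 2 * harmonic n @[n --> \oo] --> (1 : R).
  rewrite -[X in _ --> X]subr0 -[X in _ - X](mulr0 (4 / a ^+ 2)).
  apply: cvgB; first exact: cvg_cst.
  by apply: cvgM; [exact: cvg_cst|exact: cvg_harmonic].
apply: (squeeze_cvgr _ lo (cvg_cst (1 : R))); apply: nearW => n.
have /andP[_ ->] := cutoff_ge0_le1 y n (ltW x0); rewrite andbT.
rewrite /cutoff; set N := (_ * _)%N; set v := expR _.
apply: le_trans (bernoulli_ineqB N (v01 n (ltW x0))); rewrite lerD2l lerN2.
have n0 : 0 < n.+1%:R :> R by [].
have Nle : N%:R <= n.+1%:R * (2 * expR (n.+1%:R * y)).
  have e1 : 1 <= expR (n.+1%:R * y) by rewrite -expR0 ler_expR mulr_ge0.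
  rewrite natrM ler_pM2l// -natr1.
  by have := truncn_le (expR (n.+1%:R * y)); rewrite expR_ge0; lra.
apply: (@le_trans _ _ (n.+1%:R * (2 * expR (n.+1%:R * y)) * v)).
  by rewrite ler_wpM2r// expR_ge0.
have -> : n.+1%:R * (2 * expR (n.+1%:R * y)) * v = 2 * n.+1%:R * (expR (n.+1%:R * a))^-1.
  rewrite /v -expRN /a mulrBr opprB expRD; ring.
have h1 : (n.+1%:R * a) ^+ 2 / 2 <= expR (n.+1%:R * a).
  have na0 : 0 <= n.+1%:R * a by rewrite mulr_ge0// ltW.
  have := expR_ge1Dxn 1 na0; rewrite (_ : 2`! = 2%N)//; lra.
have h2 : 0 < (n.+1%:R * a) ^+ 2 / 2 by rewrite divr_gt0// exprn_gt0// mulr_gt0.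
apply: (@le_trans _ _ (2 * n.+1%:R * ((n.+1%:R * a) ^+ 2 / 2)^-1)).
  by rewrite ler_wpM2l ?mulr_ge0// lef_pV2 ?posrE ?expR_gt0.
rewrite /harmonic/= le_eqVlt; apply/orP; left; apply/eqP.
move: n.+1%:R n0 => k k0; field; rewrite !gt_eqF//.
Qed.

(** Here [(1 - v)^N (1 + v)^N <= 1] while [(1 + v)^N >= 1 + N v >= n + 1]. The factor [n + 1] in the
    exponent of [cutoff] is what includes the boundary case [x = y]. *)
Lemma cutoff_cvg0 y x : 0 <= x -> x <= y -> cutoff y n x @[n --> \oo] --> (0 : R).
Proof.
move=> x0 xy; apply: (squeeze_cvgr _ (cvg_cst 0) cvg_harmonic); apply: nearW => n.
have /andP[-> _] /= := cutoff_ge0_le1 y n x0.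
rewrite /cutoff; set N := (_ * _)%N; set v := expR _.
have /andP[v0 v1] : 0 <= v <= 1 by exact: v01.
have n0 : 0 < n.+1%:R :> R by [].
have Nv : n.+1%:R <= N%:R * v.
  have Tv : 1 <= (Num.truncn (expR (n.+1%:R * y))).+1%:R * v.
    apply: (@le_trans _ _ (expR (n.+1%:R * y) * v)).
      by rewrite /v -expRD -[leLHS]expR0 ler_expR -mulrBr mulr_ge0 ?subr_ge0.
    by rewrite ler_wpM2r// ltW// truncnS_gt.
  by rewrite natrM -mulrA; have := ler_wpM2l (ltW n0) Tv; rewrite mulr1.
have B := bernoulli_ineqD N v0.
have P : (1 - v) ^+ N * (1 + v) ^+ N <= 1.
  by rewrite -exprMn exprn_ile1//; nra.
rewrite /harmonic -[leRHS]mul1r ler_pdivlMr//; apply: le_trans P.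
by rewrite ler_wpM2l ?exprn_ge0 ?subr_ge0//; lra.
Qed.

Let measurable_expRN (l : R) : measurable_fun [set: R] (fun x : R => expR (- (l * x))).
Proof. by apply: measurableT_comp => //; apply: measurableT_comp. Qed.

Lemma measurable_cutoff y n : measurable_fun [set: R] (cutoff y n).
Proof. by apply: measurable_funX; apply: measurable_funB. Qed.

Section finite.
Variables (m : {measure set R -> \bar R}).
Hypothesis moo : (m [set: R] < +oo)%E.

Lemma bounded_integrable (f : R -> R) : measurable_fun [set: R] f ->
  (forall x, D x -> `|f x| <= 1) -> m.-integrable D (EFin \o f).
Proof.
move=> mf f1; apply: (@le_integrable _ _ _ _ _ _ _ (cst 1%E)) => //.
- by apply/measurable_EFinP; exact: measurable_funTS.
- by move=> x Dx; rewrite /= lee_fin normr1 f1.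
- apply/integrableP; split => //=; rewrite normr1 integral_cst// mul1e.
  by rewrite (le_lt_trans _ moo)// le_measure ?inE.
Qed.

Lemma cutoff_integral_cvg y : 0 <= y ->
  (\int[m]_(x in D) (cutoff y n x)%:E)%E @[n --> \oo] --> m `]y, +oo[%classic.
Proof.
move=> y0.
have [] := @dominated_convergence _ _ _ m D (measurable_itv _)
   (fun n x => (cutoff y n x)%:E) (fun x => (\1_(`]y, +oo[%classic : set R) x)%:E) (cst 1%E).
- by move=> n; apply/measurable_EFinP; exact: measurable_funTS (measurable_cutoff y n).
- by apply/measurable_EFinP; apply: measurable_funTS; exact: measurable_indic.
- apply: aeW => x /=; rewrite in_itv/= andbT => x0.
  apply: cvg_EFin; first exact: nearW.
  rewrite indicE; case: (boolP (x \in _)); rewrite ?inE ?notin_setE/= in_itv/= andbT.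
    by move=> yx; exact: cutoff_cvg1.
  by move=> /negP; rewrite -leNgt => xy; exact: cutoff_cvg0.
- by apply: (@bounded_integrable (cst 1)) => // x _; rewrite normr1.
- apply: aeW => x n /=; rewrite in_itv/= andbT => x0; rewrite lee_fin.
  by have /andP[c0 c1] := cutoff_ge0_le1 y n x0; rewrite ger0_norm.
move=> _ _; rewrite integral_indic// setIidl//.
by move=> x /=; rewrite !in_itv/= !andbT => yx; rewrite (le_trans y0)// ltW.
Qed.

End finite.

Lemma laplace_poly (m1 m2 : {measure set R -> \bar R}) :
  (m1 [set: R] < +oo)%E -> (m2 [set: R] < +oo)%E ->
  (forall k : nat, \int[m1]_(x in D) expR (- (k%:R * x)) =
                   \int[m2]_(x in D) expR (- (k%:R * x))) ->
  forall p : {poly R}, \int[m1]_(x in D) p.[expR (- x)] = \int[m2]_(x in D) p.[expR (- x)].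
Proof.
move=> m1oo m2oo H p.
have E k x : expR (- (k%:R * x)) = expR (- x) ^+ k :> R.
  by rewrite -mulrN expRM_natl.
have iE (m : {measure set R -> \bar R}) k : (m [set: R] < +oo)%E ->
    m.-integrable D (EFin \o (fun x => expR (- (k%:R * x)))).
  move=> moo; apply: bounded_integrable => // x /=; rewrite in_itv/= andbT => x0.
  by rewrite ger0_norm ?expR_ge0// -expR0 ler_expR oppr_le0 mulr_ge0.
have iP (m : {measure set R -> \bar R}) (s : seq nat) (c : nat -> R) :
    (m [set: R] < +oo)%E ->
    m.-integrable D (EFin \o (fun x => \sum_(k <- s) c k * expR (- (k%:R * x)))) /\
    \int[m]_(x in D) (\sum_(k <- s) c k * expR (- (k%:R * x))) =
    \sum_(k <- s) c k * \int[m]_(x in D) expR (- (k%:R * x)).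
  move=> moo; elim: s => [|k s [ih1 ih2]].
    under [X in _.-integrable _ (_ \o X)]eq_fun do rewrite big_nil.
    under eq_Rintegral do rewrite big_nil.
    by rewrite big_nil Rintegral_cst// mul0r; split => //; exact: integrable0.
  have ic : m.-integrable D (EFin \o (fun x => c k * expR (- (k%:R * x)))).
    exact: (integrableZl (measurable_itv _) (c k) (iE m k moo)).
  under [X in _.-integrable _ (_ \o X)]eq_fun do rewrite big_cons.
  under eq_Rintegral do rewrite big_cons.
  rewrite big_cons RintegralD// ih2 RintegralZl//; last exact: iE.
  split => //.
  exact: (integrableD (measurable_itv _) ic ih1).
have PE x : p.[expR (- x)] = \sum_(k <- index_iota 0 (size p)) p`_k * expR (- (k%:R * x)).
  rewrite horner_coef big_mkord; apply: eq_bigr => k _; by rewrite E.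
under eq_Rintegral do rewrite PE.
under [RHS]eq_Rintegral do rewrite PE.
rewrite (iP m1 _ _ m1oo).2 (iP m2 _ _ m2oo).2.
by apply: eq_bigr => k _; rewrite H.
Qed.

(** Integer arguments suffice: [cutoff] is a polynomial in [exp(- x)], so the two measures agree on
    every ray []y, +oo[] with [y >= 0]. For [y < 0] the ray carries the total mass, which is the
    transform at 0. *)
Lemma laplace_unique (m1 m2 : {measure set R -> \bar R}) :
  (m1 [set: R] < +oo)%E -> (m2 [set: R] < +oo)%E ->
  m1 `]-oo, 0[%classic = 0%E -> m2 `]-oo, 0[%classic = 0%E ->
  (forall k : nat, (\int[m1]_x (expR (- (k%:R * x)))%:E =
                    \int[m2]_x (expR (- (k%:R * x)))%:E)%E) ->
  forall A, measurable A -> m1 A = m2 A.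
Proof.
move=> m1oo m2oo m10 m20 H.
have HD (k : nat) : \int[m1]_(x in D) expR (- (k%:R * x)) =
                   \int[m2]_(x in D) expR (- (k%:R * x)).
  have mk : measurable_fun [set: R] (fun x : R => (expR (- (k%:R * x)))%:E).
    exact/measurable_EFinP.
  have k0 (x : R) : (0 <= (expR (- (k%:R * x)))%:E)%E by rewrite lee_fin expR_ge0.
  by rewrite /Rintegral; congr fine; rewrite -!ge0_integral_itvcy//; exact: H.
have P := laplace_poly m1oo m2oo HD.
have tail y : 0 <= y -> m1 `]y, +oo[%classic = m2 `]y, +oo[%classic.
  move=> y0; have c1 := cutoff_integral_cvg m1oo y0; have c2 := cutoff_integral_cvg m2oo y0.
  apply: (cvg_unique _ c1) => //.
  rewrite (_ : (fun _ => _) = (fun n => \int[m2]_(x in D) (cutoff y n x)%:E)%E)//.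
  apply/funext => n.
  pose p : {poly R} := (1 - 'X^(n.+1)) ^+ (n.+1 * (Num.truncn (expR (n.+1%:R * y))).+1).
  have pE x : cutoff y n x = p.[expR (- x)].
    by rewrite /p horner_exp hornerD hornerN hornerXn -polyC1 hornerC /cutoff -mulrN (expRM_natl n.+1 (- x)).
  have ic (m : {measure set R -> \bar R}) : (m [set: R] < +oo)%E ->
      m.-integrable D (EFin \o cutoff y n).
    move=> moo; apply: bounded_integrable; [by []|exact: measurable_cutoff|].
    move=> x /=; rewrite in_itv/= andbT => x0.
    by have /andP[c01 c02] := cutoff_ge0_le1 y n x0; rewrite ger0_norm.
  rewrite -[LHS]fineK; last exact: integrable_fin_num (ic _ m1oo).
  rewrite -[RHS]fineK; last exact: integrable_fin_num (ic _ m2oo).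
  congr EFin; rewrite -/(Rintegral m1 D (cutoff y n)) -/(Rintegral m2 D (cutoff y n)).
  have -> : cutoff y n = fun x => p.[expR (- x)] by apply/funext => x; exact: pE.
  exact: P.
have total : m1 [set: R] = m2 [set: R].
  have := H 0%N; under eq_integral do rewrite mul0r oppr0 expR0.
  under [RHS]eq_integral do rewrite mul0r oppr0 expR0.
  by rewrite !integral_cst// !mul1e.
have full (m : {measure set R -> \bar R}) y : m `]-oo, 0[%classic = 0%E -> y < 0 ->
    m `]y, +oo[%classic = m [set: R].
  move=> m0 y0; apply/eqP; rewrite eq_le le_measure ?inE//=.
  rewrite (_ : [set: R] = `]y, +oo[ `|` `]-oo, 0[)%classic; last first.
    apply/seteqP; split => // x _ /=; rewrite !in_itv/= andbT.
    by have [|] := ltP x 0; [right|left; exact: lt_le_trans y0 _].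
  apply: le_trans (measureU2 _ _ _) _ => //.
  by rewrite [X in (_ + X)%E]m0 adde0.
(* Open rays form a pi-system that generates the Borel sets. *)
move=> A mA; apply: (measure_unique (@RGenOInfty.G R) (fun n => `]- n%:R, +oo[%classic)) => //.
- exact: RGenOInfty.measurableE.
- move=> _ _ [x ->] [y ->]; exists (Num.max x y).
  by apply/seteqP; split => z /=; rewrite !in_itv/= !andbT gt_max; [move=> [-> ->]|move=> /andP].
- by move=> i; exists (- i%:R).
- apply/seteqP; split => // x _; exists (Num.truncn `|x|).+1 => //=.
  rewrite in_itv/= andbT ltrNl (le_lt_trans (ler_norm _))// normrN.
  exact: truncnS_gt.
- move=> _ [y ->]; have [y0|y0] := leP 0 y; first exact: tail.
  by rewrite !full.
- by move=> k; apply: le_lt_trans m1oo; rewrite le_measure ?inE.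
Qed.

End laplace_uniqueness.

(** * The contour integral *)

Section norm_bounds.
Context {R : realType}.
Implicit Types a b A B : R.

Lemma normD_le a b A B : `|a| <= A -> `|b| <= B -> `|a + b| <= A + B.
Proof. by move=> aA bB; rewrite (le_trans (ler_normD _ _))// lerD. Qed.

Lemma normB_le a b A B : `|a| <= A -> `|b| <= B -> `|a - b| <= A + B.
Proof. by move=> aA bB; rewrite (le_trans (ler_normB _ _))// lerD. Qed.

Lemma normM_le a b A B : `|a| <= A -> `|b| <= B -> `|a * b| <= A * B.
Proof. by move=> aA bB; rewrite normrM ler_pM. Qed.

Lemma norm_ln_le a : 0 < a -> `|ln a| <= a + a^-1.
Proof.
move=> a0; have := ln_sublinear a0; have ai : 0 < a^-1 by rewrite invr_gt0.
have := ln_sublinear ai; rewrite lnV// => h1 h2; rewrite ler_norml.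
by apply/andP; split; lra.
Qed.

End norm_bounds.

Section contour.
Context {R : realType}.
Variables (alpha r lam : R).
Implicit Types x b : R.
Hypotheses (alpha01 : 0 < alpha < 1) (r0 : 0 < r) (lam0 : 0 < lam).

(* On the ray z = x exp(- i b), g1 + i g2 is 1 / (1 + z^alpha / r), l1 + i l2 is
   log(1 - lam z) and n1 + i n2 is (z d/dz) log(1 - lam z); D and E are
   |1 + z^alpha / r|^2 and |1 - lam z|^2.  The formula for the argument l2 is
   smooth in x and b, up to b = pi included. *)
Let y (x : R) : R := x `^ alpha / r.
Let D (x b : R) : R := 1 + 2 * y x * cos (alpha * b) + y x ^+ 2.
Let g1 (x b : R) : R := (1 + y x * cos (alpha * b)) / D x b.
Let g2 (x b : R) : R := y x * sin (alpha * b) / D x b.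
Let E (x b : R) : R := 1 - 2 * (lam * x) * cos b + (lam * x) ^+ 2.
Let l1 (x b : R) : R := ln (E x b) / 2.
Let l2 (x b : R) : R :=
  pi / 2 - b / 2 -
  atan ((1 - lam * x) / (1 + lam * x) * (cos (b / 2) / sin (b / 2))).
Let n1 (x b : R) : R := ((lam * x) ^+ 2 - lam * x * cos b) / E x b.
Let n2 (x b : R) : R := lam * x * sin b / E x b.

Let alpha0 : 0 < alpha. Proof. by case/andP: alpha01. Qed.

Let y_gt0 x : 0 < x -> 0 < y x.
Proof. by move=> x0; rewrite divr_gt0// powR_gt0. Qed.

Let dy x : 0 < x -> is_derive x (1 : R) y (alpha * y x / x).
Proof.
move=> x0.
have -> : y = fun x => r^-1 * x `^ alpha by apply/funext => z; rewrite mulrC.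
apply: is_derive_eq (is_deriveME (is_derive_cst (r^-1 : R) x 1) (is_derive1_powR _ x0)) _.
rewrite mul0r add0r /cst powRB ?powRr1 ?(gt_eqF x0) ?implybT ?ltW//.
by field; rewrite !gt_eqF.
Qed.

(** Positive because [alpha < 1]: up to the ray [b = pi] the denominator [1 + z^alpha / r] stays
    away from 0. *)
Let delta : R := (1 + cos (alpha * pi)) / 2.

Let arg_range b : 0 <= b <= pi -> alpha * b \in `[0, pi].
Proof.
case/andP: alpha01 => /ltW a0 /ltW a1 /andP[b0 bpi]; rewrite in_itv/= mulr_ge0//=.
by rewrite (le_trans _ bpi)// ler_piMl.
Qed.

Let pi_range : pi \in `[(0:R), pi].
Proof. by rewrite in_itv/= pi_ge0 lexx. Qed.

Let cos_arg_gtN1 : -1 < cos (alpha * pi).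
Proof.
rewrite -cospi ltr_cos//; last by apply: arg_range; rewrite pi_ge0 lexx.
by case/andP: alpha01 => _ a1; rewrite gtr_pMl// pi_gt0.
Qed.

Let delta_gt0 : 0 < delta.
Proof. by rewrite divr_gt0// -ltrBlDl sub0r. Qed.

(** [1 + 2 y c + y^2 = (1 + c) / 2 (1 + y)^2 + (1 - c) / 2 (1 - y)^2], and the cosine is smallest at
    [b = pi]. *)
Let D_ge x b : 0 < x -> 0 <= b <= pi -> delta * (1 + y x) ^+ 2 <= D x b.
Proof.
move=> x0 bpi; have := y_gt0 x0; rewrite /D; move: (y x) => z z0.
have : cos (alpha * pi) <= cos (alpha * b).
  rewrite leNgt ltr_cos ?arg_range ?pi_ge0 ?lexx// -leNgt ler_pM2l//.
  by case/andP: bpi.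
have := cos_le1 (alpha * pi); rewrite /delta; move: (cos (alpha * pi)) (cos (alpha * b)) => p q p1 pq.
have : 0 <= z * (q - p) by rewrite mulr_ge0 ?(ltW z0) ?subr_ge0.
have : 0 <= (1 - p) * (1 - z) ^+ 2 by rewrite mulr_ge0 ?subr_ge0 ?sqr_ge0.
nra.
Qed.

Let D_gt0 x b : 0 < x -> 0 <= b <= pi -> 0 < D x b.
Proof.
move=> x0 bpi; apply: lt_le_trans (D_ge x0 bpi).
by rewrite mulr_gt0// exprn_gt0// addr_gt0// y_gt0.
Qed.

Let dDx x b : 0 < x ->
  is_derive x (1 : R) (D ^~ b)
    (2 * (alpha * y x / x) * cos (alpha * b) + 2 * y x * (alpha * y x / x)).
Proof.
move=> x0; have h := dy x0.
apply: (is_derive_eq (is_deriveDE (is_deriveDE (is_derive_cst (1 : R) x 1)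
  (is_deriveME (is_deriveME (is_derive_cst (2 : R) x 1) h) (is_derive_cst _ _ _)))
  (is_deriveME h h))).
by rewrite /cst; ring.
Qed.

(** With [g = g1 + i g2], one has [z dg/dz = - alpha (g - g^2)], and on the ray [x d/dx = z d/dz]
    and [d/db = - i z d/dz]. This and the next three derivatives are the real and imaginary
    parts. *)
Let dg1x x b : 0 < x -> 0 <= b <= pi ->
  is_derive x (1 : R) (g1 ^~ b)
    (- alpha * (g1 x b - g1 x b ^+ 2 + g2 x b ^+ 2) / x).
Proof.
move=> x0 bpi; have h := dy x0; have D0 : D x b != 0 by rewrite gt_eqF ?D_gt0.
apply: (is_derive_eq (is_deriveME (is_deriveDE (is_derive_cst (1 : R) x 1)
  (is_deriveME h (is_derive_cst _ _ _))) (@is_deriveVE _ (D ^~ b) x _ D0 (dDx b x0)))).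
have cs := cos2Dsin2 (alpha * b).
rewrite /g1 /g2 /cst; move: D0; rewrite /D.
move: (y x) (cos (alpha * b)) (sin (alpha * b)) cs => z c s cs D0.
have s2 : s ^+ 2 = 1 - c ^+ 2 by rewrite -cs addrC addKr.
by field: s2; rewrite D0 gt_eqF.
Qed.

Let dg2x x b : 0 < x -> 0 <= b <= pi ->
  is_derive x (1 : R) (g2 ^~ b)
    (- alpha * (g2 x b - 2 * g1 x b * g2 x b) / x).
Proof.
move=> x0 bpi; have h := dy x0; have D0 : D x b != 0 by rewrite gt_eqF ?D_gt0.
apply: (is_derive_eq (is_deriveME (is_deriveME h (is_derive_cst _ _ _))
  (@is_deriveVE _ (D ^~ b) x _ D0 (dDx b x0)))).
have cs := cos2Dsin2 (alpha * b).
rewrite /g1 /g2 /cst; move: D0; rewrite /D.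
move: (y x) (cos (alpha * b)) (sin (alpha * b)) cs => z c s cs D0.
have s2 : s ^+ 2 = 1 - c ^+ 2 by rewrite -cs addrC addKr.
by field: s2; rewrite D0 gt_eqF.
Qed.

Let dcos (c b : R) : is_derive b (1 : R) (fun b => cos (c * b)) (- c * sin (c * b)).
Proof.
apply: (is_derive_eq (is_derive_compE (is_derive_cos (c * b)) (is_derive_linear c b))).
by ring.
Qed.

Let dsin (c b : R) : is_derive b (1 : R) (fun b => sin (c * b)) (c * cos (c * b)).
Proof.
apply: (is_derive_eq (is_derive_compE (is_derive_sin (c * b)) (is_derive_linear c b))).
by ring.
Qed.

Let dDb x b : is_derive b (1 : R) (D x) (- (2 * alpha * y x * sin (alpha * b))).
Proof.
apply: (is_derive_eq (is_deriveDE (is_deriveDE (is_derive_cst (1 : R) b 1)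
  (is_deriveME (is_derive_cst (2 * y x) b 1) (dcos alpha b)))
  (is_derive_cst (y x ^+ 2) b 1))).
by rewrite /cst; ring.
Qed.

Let dg1b x b : 0 < x -> 0 <= b <= pi ->
  is_derive b (1 : R) (g1 x) (- alpha * (g2 x b - 2 * g1 x b * g2 x b)).
Proof.
move=> x0 bpi; have D0 : D x b != 0 by rewrite gt_eqF ?D_gt0.
apply: (is_derive_eq (is_deriveME (is_deriveDE (is_derive_cst (1 : R) b 1)
  (is_deriveME (is_derive_cst (y x) b 1) (dcos alpha b)))
  (@is_deriveVE _ (D x) b _ D0 (dDb x b)))).
have cs := cos2Dsin2 (alpha * b).
rewrite /g1 /g2 /cst; move: D0; rewrite /D.
move: (y x) (cos (alpha * b)) (sin (alpha * b)) cs => z c s cs D0.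
have s2 : s ^+ 2 = 1 - c ^+ 2 by rewrite -cs addrC addKr.
by field: s2; rewrite D0.
Qed.

Let dg2b x b : 0 < x -> 0 <= b <= pi ->
  is_derive b (1 : R) (g2 x) (alpha * (g1 x b - g1 x b ^+ 2 + g2 x b ^+ 2)).
Proof.
move=> x0 bpi; have D0 : D x b != 0 by rewrite gt_eqF ?D_gt0.
apply: (is_derive_eq (is_deriveME (is_deriveME (is_derive_cst (y x) b 1) (dsin alpha b))
  (@is_deriveVE _ (D x) b _ D0 (dDb x b)))).
have cs := cos2Dsin2 (alpha * b).
rewrite /g1 /g2 /cst; move: D0; rewrite /D.
move: (y x) (cos (alpha * b)) (sin (alpha * b)) cs => z c s cs D0.
have s2 : s ^+ 2 = 1 - c ^+ 2 by rewrite -cs addrC addKr.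
by field: s2; rewrite D0.
Qed.

Let cos_half b : cos b = 1 - 2 * sin (b / 2) ^+ 2.
Proof.
rewrite {1}(_ : b = (b / 2) *+ 2); last by rewrite -mulr_natr divfK.
by rewrite cos_mulr2n cos2sin2; ring.
Qed.

Let sin_half b : sin b = 2 * sin (b / 2) * cos (b / 2).
Proof.
rewrite {1}(_ : b = (b / 2) *+ 2); last by rewrite -mulr_natr divfK.
by rewrite sin_mulr2n; ring.
Qed.

Let sin_half_gt0 b : 0 < b <= pi -> 0 < sin (b / 2).
Proof.
move=> /andP[b0 bpi]; rewrite sin_gt0_pi// divr_gt0//=.
by rewrite ltr_pdivrMr// (le_lt_trans bpi)// ltr_pMr ?pi_gt0// ltr1n.
Qed.

(** The half-angle form shows that [1 - lam z] vanishes only at [lam x = 1], [b = 0], and at which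
    rate. *)
Let EE x b : E x b = (1 - lam * x) ^+ 2 + 4 * (lam * x) * sin (b / 2) ^+ 2.
Proof. by rewrite /E cos_half; ring. Qed.

Let E_ge x b : 0 < x -> 4 * (lam * x) * sin (b / 2) ^+ 2 <= E x b.
Proof. by move=> x0; rewrite EE lerDr sqr_ge0. Qed.

Let E_gt0 x b : 0 < x -> 0 < b <= pi -> 0 < E x b.
Proof.
move=> x0 bpi; apply: lt_le_trans (E_ge b x0).
by rewrite mulr_gt0 ?exprn_gt0 ?sin_half_gt0// mulr_gt0// mulr_gt0.
Qed.

Let E_le x b : 0 < x -> E x b <= (1 + lam * x) ^+ 2.
Proof.
move=> x0; rewrite EE; have := sin2cos2 (b / 2); have := sqr_ge0 (cos (b / 2)).
move: (cos _) (sin _) => c s c2 ->; have : 0 < lam * x by rewrite mulr_gt0.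
by move: (lam * x) => z z0; have := mulr_ge0 (ltW z0) c2; nra.
Qed.

Let dE_x x b : is_derive x (1 : R) (E ^~ b)
  (- (2 * lam * cos b) + 2 * lam ^+ 2 * x).
Proof.
have h := is_derive_linear lam x.
apply: (is_derive_eq (is_deriveDE (is_deriveBE (is_derive_cst (1 : R) x 1)
  (is_deriveME (is_deriveME (is_derive_cst (2 : R) x 1) h) (is_derive_cst (cos b) x 1)))
  (is_deriveME h h))).
by rewrite /cst; ring.
Qed.

Let dE_b x b : is_derive b (1 : R) (E x) (2 * (lam * x) * sin b).
Proof.
apply: (is_derive_eq (is_deriveDE (is_deriveBE (is_derive_cst (1 : R) b 1)
  (is_deriveME (is_derive_cst (2 * (lam * x)) b 1) (is_derive_cos b)))
  (is_derive_cst ((lam * x) ^+ 2) b 1))).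
by rewrite /cst; ring.
Qed.

Let dl1x x b : 0 < x -> 0 < b <= pi -> is_derive x (1 : R) (l1 ^~ b) (n1 x b / x).
Proof.
move=> x0 bpi; have E0 := E_gt0 x0 bpi.
apply: (is_derive_eq (is_deriveME
  (@is_derive_compE _ _ (E ^~ b) x _ _ (is_derive1_ln E0) (dE_x x b))
  (is_derive_cst (2^-1 : R) x 1))).
by rewrite /n1 /cst; field; rewrite !gt_eqF.
Qed.

Let dl1b x b : 0 < x -> 0 < b <= pi -> is_derive b (1 : R) (l1 x) (n2 x b).
Proof.
move=> x0 bpi; have E0 := E_gt0 x0 bpi.
apply: (is_derive_eq (is_deriveME
  (@is_derive_compE _ _ (E x) b _ _ (is_derive1_ln E0) (dE_b x b))
  (is_derive_cst (2^-1 : R) b 1))).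
by rewrite /n2 /cst; field; rewrite !gt_eqF.
Qed.

Let dl2x x b : 0 < x -> 0 < b <= pi -> is_derive x (1 : R) (l2 ^~ b) (n2 x b / x).
Proof.
move=> x0 bpi; have E0 := E_gt0 x0 bpi; have s0 := sin_half_gt0 bpi.
have p0 : 1 + lam * x != 0 by rewrite gt_eqF// addr_gt0// mulr_gt0.
have h := is_derive_linear lam x.
apply: (is_derive_eq (is_deriveBE (is_derive_cst (pi / 2 - b / 2) x 1)
  (is_derive_compE (is_derive1_atan _)
   (is_deriveME (is_deriveME (is_deriveBE (is_derive_cst (1 : R) x 1) h)
     (@is_deriveVE _ (fun x => 1 + lam * x) x _ p0
        (is_deriveDE (is_derive_cst (1 : R) x 1) h)))
     (is_derive_cst (cos (b / 2) / sin (b / 2)) x 1))))).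
move: E0; rewrite /n2 EE (sin_half b) /cst.
have cs := cos2Dsin2 (b / 2).
move: (cos (b / 2)) (sin (b / 2)) cs s0 => c s cs s0 E0.
have c2 : c ^+ 2 = 1 - s ^+ 2 by rewrite -cs addrK.
(* The denominator [1 + u^2] in the derivative of [atan u] is [E] divided by [((1 + lam x) s)^2], so
   the result is rational with denominator [E]. *)
rewrite (_ : 1 + ((1 - lam * x) / (1 + lam * x) * (c / s)) ^+ 2 =
   ((1 - lam * x) ^+ 2 + 4 * (lam * x) * s ^+ 2) / ((1 + lam * x) * s) ^+ 2).
  by field: c2; rewrite p0 !gt_eqF.
by field: c2; rewrite p0 !gt_eqF.
Qed.

Let dl2b x b : 0 < x -> 0 < b <= pi -> is_derive b (1 : R) (l2 x) (- n1 x b).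
Proof.
move=> x0 bpi; have E0 := E_gt0 x0 bpi; have s0 := sin_half_gt0 bpi.
have p0 : 1 + lam * x != 0 by rewrite gt_eqF// addr_gt0// mulr_gt0.
have h : is_derive b (1 : R) (fun b => b / 2) (2^-1).
  apply: (is_derive_eq (is_deriveME (is_derive_id b (1 : R)) (is_derive_cst (2^-1 : R) b 1))).
  by rewrite /cst mulr0 addr0 mul1r.
have sn0 : sin (b / 2) != 0 by rewrite gt_eqF.
apply: (is_derive_eq (is_deriveBE (is_deriveBE (is_derive_cst (pi / 2 : R) b 1) h)
  (is_derive_compE (is_derive1_atan _)
   (is_deriveME (is_derive_cst ((1 - lam * x) / (1 + lam * x)) b 1)
     (is_deriveME (is_derive_compE (is_derive_cos _) h)
      (@is_deriveVE _ (fun b => sin (b / 2)) b _ sn0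
         (is_derive_compE (is_derive_sin _) h))))))).
move: E0; rewrite /n1 EE (cos_half b) /cst.
have cs := cos2Dsin2 (b / 2).
move: (cos (b / 2)) (sin (b / 2)) cs s0 sn0 => c s cs s0 sn0 E0.
have c2 : c ^+ 2 = 1 - s ^+ 2 by rewrite -cs addrK.
rewrite (_ : 1 + ((1 - lam * x) / (1 + lam * x) * (c / s)) ^+ 2 =
   ((1 - lam * x) ^+ 2 + 4 * (lam * x) * s ^+ 2) / ((1 + lam * x) * s) ^+ 2).
  by field: c2; rewrite p0 !gt_eqF.
  by field: c2; rewrite p0 sn0.
Qed.

(* Psi + i Phi is the holomorphic function F = log(1 - lam z) / (1 + z^alpha / r) on
   the ray; h expresses the Cauchy-Riemann equation dPhi/db = - x dPsi/dx. *)
Let Phi x b : R := g2 x b * l1 x b + g1 x b * l2 x b.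
Let Psi x b : R := g1 x b * l1 x b - g2 x b * l2 x b.
Let h x b : R :=
  (alpha * (g1 x b - g1 x b ^+ 2 + g2 x b ^+ 2) * l1 x b + g2 x b * n2 x b -
   alpha * (g2 x b - 2 * g1 x b * g2 x b) * l2 x b - g1 x b * n1 x b) / x.

Let itv_wide b : 0 < b <= pi -> 0 <= b <= pi.
Proof. by move=> /andP[/ltW -> ->]. Qed.

Let dPhi x b : 0 < x -> 0 < b <= pi ->
  is_derive b (1 : R) (fun b => Phi x b / x) (h x b).
Proof.
move=> x0 bpi; have bpi' := itv_wide bpi.
apply: (is_derive_eq (is_deriveME (is_deriveDE
  (is_deriveME (dg2b x0 bpi') (dl1b x0 bpi))
  (is_deriveME (dg1b x0 bpi') (dl2b x0 bpi))) (is_derive_cst (x^-1 : R) b 1))).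
by rewrite /h /cst; ring.
Qed.

Let dPsi x b : 0 < x -> 0 < b <= pi -> is_derive x (1 : R) (Psi ^~ b) (- h x b).
Proof.
move=> x0 bpi; have bpi' := itv_wide bpi.
apply: (is_derive_eq (is_deriveBE
  (is_deriveME (dg1x x0 bpi') (dl1x x0 bpi))
  (is_deriveME (dg2x x0 bpi') (dl2x x0 bpi)))).
by rewrite /h; ring.
Qed.

Let continuous_h x b : 0 < x -> 0 < b <= pi -> {for x, continuous (h ^~ b)}.
Proof.
move=> x0 bpi; have bpi' := itv_wide bpi.
have a1 := dg1x x0 bpi'; have a2 := dg2x x0 bpi'.
have b1 := dl1x x0 bpi; have b2 := dl2x x0 bpi.
have En0 : E x b != 0 by rewrite gt_eqF// E_gt0.
have xn0 : x != 0 by rewrite gt_eqF.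
have lx := is_derive_linear lam x.
have dE := @is_deriveVE _ (E ^~ b) x _ En0 (dE_x x b).
have c1 : is_derive x (1 : R) (n1 ^~ b) _ := is_deriveME (is_deriveBE (is_deriveME lx lx)
  (is_deriveME lx (is_derive_cst (cos b) x 1))) dE.
have c2 : is_derive x (1 : R) (n2 ^~ b) _ :=
  is_deriveME (is_deriveME lx (is_derive_cst (sin b) x 1)) dE.
have al (f : R -> R) df : is_derive x (1 : R) f df -> is_derive x (1 : R) (fun x => alpha * f x) _
  := fun H => is_deriveME (is_derive_cst alpha x 1) H.
exact: (is_derive_continuous (is_deriveME (is_deriveBE (is_deriveBE (is_deriveDE
  (is_deriveME (al _ _ (is_deriveDE (is_deriveBE a1 (is_deriveME a1 a1)) (is_deriveME a2 a2))) b1)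
  (is_deriveME a2 c2))
  (is_deriveME (al _ _ (is_deriveBE a2 (is_deriveME (is_deriveME (is_derive_cst (2 : R) x 1) a1) a2))) b2))
  (is_deriveME a1 c1)) (is_deriveVE xn0 (is_derive_id x (1 : R))))).
Qed.

Let continuous_Phi x b : 0 < x -> 0 < b <= pi -> {for x, continuous (fun x => Phi x b / x)}.
Proof.
move=> x0 bpi; have bpi' := itv_wide bpi; have xn0 : x != 0 by rewrite gt_eqF.
exact: (is_derive_continuous (is_deriveME (is_deriveDE
  (is_deriveME (dg2x x0 bpi') (dl1x x0 bpi))
  (is_deriveME (dg1x x0 bpi') (dl2x x0 bpi)))
  (is_deriveVE xn0 (is_derive_id x (1 : R))))).
Qed.

(** * Bounds along the rays and differentiation in the angle *)

Let g1_le x b : 0 < x -> 0 <= b <= pi -> `|g1 x b| <= (delta * (1 + y x))^-1.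
Proof.
move=> x0 bpi; have D0 := D_gt0 x0 bpi; have yx := y_gt0 x0.
have y1 : 0 < 1 + y x by rewrite addr_gt0.
rewrite normrM normfV (gtr0_norm D0) ler_pdivrMr//.
apply: le_trans (ler_wpM2l _ (D_ge x0 bpi)); last by rewrite invr_ge0 mulr_ge0 ?ltW.
rewrite [leRHS](_ : _ = 1 + y x); last by field; rewrite !gt_eqF.
rewrite (le_trans (ler_normD _ _))// normr1 lerD2l normrM gtr0_norm//.
by rewrite ler_piMr ?(ltW yx)// cos_max.
Qed.

(** The factor [sin (alpha * b)] is kept because it has to compensate the logarithmic singularity of
    [l1] as [b] tends to 0. *)
Let g2_le x b : 0 < x -> 0 <= b <= pi ->
  `|g2 x b| <= sin (alpha * b) * (y x / (delta * (1 + y x) ^+ 2)).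
Proof.
move=> x0 bpi; have D0 := D_gt0 x0 bpi; have yx := y_gt0 x0.
have y1 : 0 < 1 + y x by rewrite addr_gt0.
have s0 : 0 <= sin (alpha * b).
  by apply: sin_ge0_pi; have := arg_range bpi; rewrite in_itv.
rewrite /g2 normrM normrM normfV (gtr0_norm D0) (gtr0_norm yx) (ger0_norm s0).
rewrite (mulrC (y x)) -mulrA ler_wpM2l// ler_wpM2l ?(ltW yx)//.
rewrite lef_pV2 ?posrE//; first exact: D_ge.
by rewrite mulr_gt0// exprn_gt0.
Qed.

Let l2_le x b : 0 < b <= pi -> `|l2 x b| <= pi.
Proof.
move=> /andP[b0 bpi]; rewrite /l2.
have := atan_gtNpi2 ((1 - lam * x) / (1 + lam * x) * (cos (b / 2) / sin (b / 2))).
have := atan_ltpi2 ((1 - lam * x) / (1 + lam * x) * (cos (b / 2) / sin (b / 2))).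
move: (atan _) => t t1 t2; rewrite ler_norml; apply/andP; split; lra.
Qed.

Let y_ratio_le1 (z : R) : 0 < z -> z / (delta * (1 + z) ^+ 2) <= delta^-1.
Proof.
move=> z0; have z1 : 0 < (1 + z) ^+ 2 by rewrite exprn_gt0// addr_gt0.
rewrite ler_pdivrMr; last by rewrite mulr_gt0.
by rewrite mulrA mulVf ?gt_eqF// mul1r; nra.
Qed.

Let g1_le' x b : 0 < x -> 0 <= b <= pi -> `|g1 x b| <= delta^-1.
Proof.
move=> x0 bpi; apply: le_trans (g1_le x0 bpi) _; have y1 := y_gt0 x0.
have d0 := delta_gt0.
rewrite lef_pV2 ?posrE//; last by rewrite mulr_gt0// addr_gt0.
by have := mulr_gt0 d0 y1; rewrite mulrDr mulr1; lra.
Qed.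

Let g2_le' x b : 0 < x -> 0 <= b <= pi -> `|g2 x b| <= sin (alpha * b) / delta.
Proof.
move=> x0 bpi; apply: le_trans (g2_le x0 bpi) _.
rewrite ler_wpM2l ?y_ratio_le1 ?y_gt0//.
by apply: sin_ge0_pi; have := arg_range bpi; rewrite in_itv.
Qed.

Let sin_arg_le b : 0 < b <= pi -> sin (alpha * b) <= 2 * sin (b / 2).
Proof.
move=> /andP[b0 bpi]; case/andP: alpha01 => a0 a1.
have ab0 : 0 < alpha * b by rewrite mulr_gt0.
have abb : alpha * b <= b by rewrite ler_piMl ?ltW.
have p0 : 0 < pi / 2 :> R by rewrite divr_gt0 ?pi_gt0.
have s0 : 0 <= sin (alpha * b / 2).
  by apply: sin_ge0_pi; have := @pi_gt0 R => pi0; apply/andP; split; lra.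
have ss : sin (alpha * b / 2) <= sin (b / 2).
  by rewrite leNgt ltr_sin ?in_itv/= -?leNgt; [lra|apply/andP; split; lra|apply/andP; split; lra].
rewrite sin_half (le_trans _ (ler_wpM2l _ ss))// ler_piMr ?cos_le1//.
by rewrite mulr_ge0.
Qed.

Local Notation mu := (@lebesgue_measure R).
(** Imaginary part of the integral of [F(z) dz / z] over the part of the ray with radii between [a]
    and [c]; on a ray [dz / z = dx / x]. *)
Let J a c b : R := \int[mu]_(x in `[a, c]) (Phi x b / x).

(** For angles above [u > 0] the modulus [E] is at least [e0 > 0], and a constant then dominates the
    [b]-derivative of the integrand, as differentiation under the integral demands. *)
Let h_bound a c u v : 0 < a -> a < c -> 0 < u -> v <= pi ->
  exists2 M, 0 <= M & forall x b, a <= x <= c -> u < b < v -> `|h x b| <= M.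
Proof.
move=> a0 ac u0 vpi; pose s0 := sin (u / 2); pose K := (1 + lam * c) ^+ 2.
have [upi|piu] := leP u pi; last first.
  by exists 0 => // x b _ /andP[ub bv]; exfalso; move: (lt_trans piu (lt_trans ub bv)); rewrite ltNge vpi.
have s00 : 0 < s0 by apply: sin_half_gt0; rewrite u0.
pose e0 := 4 * (lam * a) * s0 ^+ 2.
have e00 : 0 < e0 by rewrite mulr_gt0 ?exprn_gt0// mulr_gt0// mulr_gt0.
pose L := (K + e0^-1) / 2; pose G := delta^-1; pose N := ((lam * c) ^+ 2 + lam * c) / e0.
have c0 := lt_trans a0 ac.
have lc0 : 0 < lam * c by rewrite mulr_gt0.
have d0 := delta_gt0.
have L0 : 0 <= L by rewrite divr_ge0// addr_ge0 ?sqr_ge0// invr_ge0 ltW.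
have N0 : 0 <= N by rewrite divr_ge0 ?(ltW e00)// addr_ge0 ?sqr_ge0// ltW.
have G0 : 0 <= G by rewrite invr_ge0 ltW.
exists ((alpha * (G + G * G + G * G) * L + G * N + alpha * (G + 2 * G * G) * pi + G * N) * a^-1).
  have := ltW alpha0; have := @pi_ge0 R; have := invr_ge0 a; rewrite (ltW a0).
  by move=> ? ? ?; do ?[rewrite mulr_ge0//|rewrite addr_ge0//].
move=> x b /andP[ax xc] /andP[ub bv].
have x0 : 0 < x by exact: lt_le_trans ax.
have b0 : 0 < b by exact: lt_trans ub.
have bpi : 0 < b <= pi by rewrite b0 (le_trans (ltW bv)).
have bpi' := itv_wide bpi.
have ss : s0 <= sin (b / 2).
  have p0 := @pi_gt0 R; case/andP: bpi => _ ?.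
  by rewrite leNgt ltr_sin ?in_itv/= -?leNgt; [lra|apply/andP; split; lra|apply/andP; split; lra].
have E0 := E_gt0 x0 bpi.
have Ege : e0 <= E x b.
  apply: le_trans (E_ge b x0); rewrite ler_pM ?sqr_ge0//.
  - by rewrite !mulr_ge0// ltW.
  - by rewrite ler_wpM2l// ler_wpM2l// ltW.
  - by rewrite ler_sqr ?nnegrE ?(ltW s00)// (le_trans (ltW s00)).
have Ele : E x b <= K.
  apply: le_trans (E_le b x0) _; rewrite ler_sqr ?nnegrE ?addr_ge0 ?mulr_ge0//; try exact: ltW.
  by rewrite lerD2l ler_wpM2l// ltW.
have HE : `|(E x b)^-1| <= e0^-1 by rewrite gtr0_norm ?invr_gt0// lef_pV2.
have H1 : `|g1 x b| <= G by exact: g1_le'.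
have H2 : `|g2 x b| <= G.
  apply: le_trans (g2_le' x0 bpi') _; rewrite ler_piMl ?sin_le1//.
have Hl1 : `|l1 x b| <= L.
  rewrite /l1 normrM (@gtr0_norm _ 2^-1) ?invr_gt0// ler_wpM2r ?invr_ge0//.
  by apply: le_trans (norm_ln_le E0) _; rewrite lerD// lef_pV2.
have Hl2 := l2_le x bpi.
have lx : `|lam * x| <= lam * c.
  by rewrite gtr0_norm ?mulr_gt0// ler_wpM2l// ltW.
have Hn1 : `|n1 x b| <= N.
  apply: normM_le HE; rewrite expr2; apply: normB_le; first exact: normM_le.
  by rewrite -[leRHS]mulr1; apply: normM_le => //; exact: cos_max.
have Hn2 : `|n2 x b| <= N.
  apply: normM_le HE; rewrite (@le_trans _ _ (lam * c * 1))//.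
    by apply: normM_le => //; exact: sin_max.
  by rewrite mulr1 lerDr sqr_ge0.
have Ha : `|alpha| <= alpha by rewrite gtr0_norm.
have H3 : `|2 : R| <= 2 by rewrite gtr0_norm.
rewrite /h; apply: normM_le; last by rewrite gtr0_norm ?invr_gt0// lef_pV2.
rewrite !expr2.
by do ?[assumption|apply: normB_le|apply: normD_le|apply: normM_le].
Qed.

(** Differentiation under the integral takes place on the neighbourhood []b / 2, pi[] of [b]. By the
    Cauchy-Riemann equation the differentiated integrand [h] is the [x]-derivative of [- Psi], so
    only the two ends contribute. *)
Let J_derive a c b : 0 < a -> a < c -> 0 < b < pi ->
  is_derive b (1 : R) (J a c) (Psi a b - Psi c b).
Proof.
move=> a0 ac /andP[b0 bpi].
have b20 : 0 < b / 2 by rewrite divr_gt0.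
have [M M0 hM] := h_bound a0 ac b20 (lexx pi).
have itv x : x \in `[a, c]%classic -> 0 < x /\ a <= x <= c.
  rewrite inE/= in_itv/= => /andP[ax xc]; split; last by rewrite ax.
  exact: lt_le_trans ax.
have Ib : (`]b / 2, pi[%classic : set R) b.
  by rewrite /= in_itv/= bpi andbT ltr_pdivrMr// ltr_pMr// ltr1n.
have intf b' : (`]b / 2, pi[%classic : set R) b' ->
    mu.-integrable `[a, c] (EFin \o (fun x => Phi x b' / x)).
  rewrite /= in_itv/= => /andP[bb' b'pi]; apply: continuous_itv_integrable => x /andP[ax _].
  by apply: continuous_Phi; [exact: lt_le_trans ax|rewrite (lt_trans b20 bb') ltW].
have d1 b' x : (`]b / 2, pi[%classic : set R) b' -> (`[a, c]%classic : set R) x ->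
    is_derive b' (1 : R) (fun b => Phi x b / x) (h x b').
  rewrite /= !in_itv/= => /andP[bb' b'pi] /andP[ax _].
  by apply: dPhi; [exact: lt_le_trans ax|rewrite (lt_trans b20 bb') ltW].
have derf1 b' x : (`]b / 2, pi[%classic : set R) b' -> (`[a, c]%classic : set R) x ->
    derivable (fun b => Phi x b / x) b' 1.
  by move=> hb hx; have [] := d1 _ _ hb hx.
have intG : mu.-integrable `[a, c] (EFin \o (cst M : R -> R)).
  by apply: continuous_itv_integrable => x _; exact: cst_continuous.
have G_ub b' x : (`]b / 2, pi[%classic : set R) b' -> (`[a, c]%classic : set R) x ->
    `|partial1of2 (fun b x => Phi x b / x) b' x| <= cst M x.
  move=> hb hx; rewrite partial1of2E; have [_ ->] := d1 _ _ hb hx.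
  by apply: hM; move: hb hx; rewrite /= !in_itv.
have G0 (x : R) : 0 <= cst M x by [].
have dJ := derivable_under_integral (mu := mu) (measurable_itv `[a, c]) Ib intf derf1 G0 intG G_ub.
have vJ := differentiation_under_integral (mu := mu) (measurable_itv `[a, c]) Ib intf derf1 G0 intG G_ub.
split; first exact: dJ.
rewrite -derive1E [LHS]vJ.
rewrite (@eq_Rintegral _ _ _ mu _ (fun x => h x b)); last first.
  move=> x xac; rewrite partial1of2E.
  by have [_ ->] := d1 _ _ Ib (set_mem xac).
have bb : 0 < b <= pi by rewrite b0 ltW.
have itv' x : a <= x <= c -> 0 < x by move=> /andP[ax _]; exact: lt_le_trans ax.
have dN x : a <= x <= c -> is_derive x (1 : R) (fun x => - Psi x b) (h x b).
  move=> /itv' x0; apply: is_derive_eq (is_deriveN (dPsi x0 bb)) _.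
  by rewrite opprK.
have ch x : a <= x <= c -> {for x, continuous (h ^~ b)}.
  by move=> /itv' x0; exact: continuous_h.
by rewrite /Rintegral (FTC_segment ac dN ch)/= opprK addrC.
Qed.

(** With [q = lam x <= 1 / 2], [E] lies between [(1 - q)^2] and [(1 + q)^2], and
    [- ln (1 - q) <= 2 q], so [l1] is of order [q]. The other product is of order [y x], that is
    [x^alpha / r]. *)
Let Psi_small_le x b : 0 < x -> lam * x <= 2^-1 -> 0 < b <= pi ->
  `|Psi x b| <= delta^-1 * (2 * lam * x + pi / r * x `^ alpha).
Proof.
move=> x0 lx bpi; have bpi' := itv_wide bpi; have y0 := y_gt0 x0.
have r0' : 0 < lam * x by rewrite mulr_gt0.
have E0 := E_gt0 x0 bpi; have d0 := delta_gt0.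
have Hl : `|l1 x b| <= 2 * lam * x.
  rewrite /l1 normrM (@gtr0_norm _ 2^-1) ?invr_gt0// ler_pdivrMr//.
  have l1x : 0 < 1 - lam * x by lra.
  have e1 : ln (E x b) <= 2 * (lam * x).
    apply: (@le_trans _ _ (ln ((1 + lam * x) ^+ 2))).
      by rewrite ler_ln ?posrE ?E_le// exprn_gt0// addr_gt0.
    rewrite lnXn ?addr_gt0// -mulr_natl.
    have : ln (1 + lam * x) <= lam * x by apply: le_ln1Dx; lra.
    by move=> ?; lra.
  have e2 : - (4 * (lam * x)) <= ln (E x b).
    apply: (@le_trans _ _ (ln ((1 - lam * x) ^+ 2))); last first.
      rewrite ler_ln ?posrE ?exprn_gt0// EE lerDl mulr_ge0 ?sqr_ge0//.
      by rewrite mulr_ge0// ltW.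
    rewrite lnXn// -mulr_natl.
    suff : - ln (1 - lam * x) <= 2 * (lam * x) by move=> ?; lra.
    rewrite -lnV ?posrE//.
    rewrite (_ : (1 - lam * x)^-1 = 1 + lam * x / (1 - lam * x)); last first.
      by field; rewrite gt_eqF.
    have q0 : 0 < lam * x / (1 - lam * x) by rewrite divr_gt0.
    apply: le_trans (le_ln1Dx _) _; first by lra.
    rewrite ler_pdivrMr//; nra.
  rewrite ler_norml; apply/andP; split; nra.
rewrite mulrDr; apply: normB_le.
  by apply: normM_le => //; exact: g1_le'.
rewrite (_ : delta^-1 * _ = (1 * (y x / delta)) * pi); last first.
  by rewrite /y; field; rewrite !gt_eqF.
apply: normM_le; last exact: l2_le.
apply: le_trans (g2_le x0 bpi') _.
have a1 : 0 <= sin (alpha * b).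
  by apply: sin_ge0_pi; have := arg_range bpi'; rewrite in_itv.
rewrite ler_pM ?sin_le1//.
  by rewrite divr_ge0 ?(ltW y0)// mulr_ge0 ?sqr_ge0// ltW.
rewrite ler_wpM2l ?(ltW y0)// lef_pV2 ?posrE//.
  by rewrite ler_peMr ?(ltW d0)// expr_ge1 ?addr_ge0// ?lerDl ltW.
by rewrite mulr_gt0// exprn_gt0// addr_gt0.
Qed.

(** Both [g1] and [g2] decay like [x^(- alpha)], while [l1] grows like
    [ln x <= (2 / alpha) x^(alpha / 2)]; half of the exponent is spent on the logarithm. The
    condition [2 <= lam * x] ensures [E >= 1]. *)
Let Psi_large_le x b : 1 <= x -> 2 <= lam * x -> 0 < b <= pi ->
  `|Psi x b| <= r / delta * ((ln (1 + lam) + pi) * x^-1 `^ alpha +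
                             2 / alpha * x^-1 `^ (alpha / 2)).
Proof.
move=> x1 lx bpi; have x0 : 0 < x by exact: lt_le_trans x1.
have bpi' := itv_wide bpi; have y0 := y_gt0 x0.
have r0' : 0 < lam * x by rewrite mulr_gt0.
have E0 := E_gt0 x0 bpi; have d0 := delta_gt0.
have xa0 : 0 < x `^ alpha by rewrite powR_gt0.
have l0 : 0 < 1 + lam by rewrite addr_gt0.
have Hl : `|l1 x b| <= ln (1 + lam * x).
  have E1 : 1 <= E x b.
    by rewrite EE; have : 0 <= 4 * (lam * x) * sin (b / 2) ^+ 2;
      [rewrite mulr_ge0 ?sqr_ge0// mulr_ge0// ltW|nra].
  rewrite /l1 ger0_norm; last by rewrite divr_ge0// ln_ge0.
  rewrite ler_pdivrMr// mulr_natr -lnXn ?addr_gt0// ler_ln ?posrE ?E_le//.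
  by rewrite exprn_gt0// addr_gt0.
have Hl' : ln (1 + lam * x) <= ln (1 + lam) + 2 / alpha * x `^ (alpha / 2).
  apply: (@le_trans _ _ (ln ((1 + lam) * x))).
    rewrite ler_ln ?posrE ?mulr_gt0 ?addr_gt0//; nra.
  rewrite lnM ?posrE// lerD2l.
  have <- : 2 / alpha * ln (x `^ (alpha / 2)) = ln x.
    by rewrite ln_powR; field; rewrite gt_eqF.
  by rewrite ler_wpM2l ?divr_ge0 ?(ltW alpha0)// ltW// ln_sublinear// powR_gt0.
have -> : r / delta * ((ln (1 + lam) + pi) * x^-1 `^ alpha + 2 / alpha * x^-1 `^ (alpha / 2))
   = (delta * y x)^-1 * (ln (1 + lam) + 2 / alpha * x `^ (alpha / 2)) + (delta * y x)^-1 * pi.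
  have h2 : x `^ alpha = x `^ (alpha / 2) * x `^ (alpha / 2).
    by rewrite -powRD -?splitr// (gt_eqF x0) implybT.
  have xV p : x^-1 `^ p = (x `^ p)^-1.
    by rewrite -(powR_inv1 (ltW x0)) -powRrM mulN1r powRN.
  rewrite !xV /y h2.
  by field; rewrite !gt_eqF// powR_gt0.
apply: normB_le; apply: normM_le.
- apply: le_trans (g1_le x0 bpi') _.
  have dy0 : 0 < delta * y x by rewrite mulr_gt0.
  rewrite lef_pV2 ?posrE//; first by rewrite ler_pM2l// lerDr.
  by rewrite mulr_gt0// addr_gt0.
- exact: (le_trans Hl Hl').
- apply: le_trans (g2_le x0 bpi') _.
  have a1 : 0 <= sin (alpha * b).
    by apply: sin_ge0_pi; have := arg_range bpi'; rewrite in_itv.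
  rewrite -[leRHS]mul1r ler_pM ?sin_le1//.
    by rewrite divr_ge0 ?(ltW y0)// mulr_ge0 ?sqr_ge0// ltW.
  rewrite ler_pdivrMr; last by rewrite mulr_gt0// exprn_gt0// addr_gt0.
  rewrite invfM mulrACA mulVf ?mul1r ?gt_eqF// ler_pdivlMl//; nra.
- exact: l2_le.
Qed.

(** Unlike [h_bound] this is uniform down to [b = 0]: [l1] alone is unbounded near [lam x = 1], but
    [|g2|] is at most a multiple of [sin (b / 2)]. *)
Let Phi_bound (a c : R) : 0 < a -> a < c ->
  exists M, forall x b, a <= x <= c -> 0 < b <= pi -> `|Phi x b / x| <= M.
Proof.
move=> a0 ac; have c0 := lt_trans a0 ac; pose K := (1 + lam * c) ^+ 2.
pose C := K + `|ln (4 * (lam * a))| + 2.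
exists ((2 / delta * (C / 2) + delta^-1 * pi) * a^-1) => x b /andP[ax xc] bpi.
have x0 : 0 < x by exact: lt_le_trans ax.
have bpi' := itv_wide bpi; have d0 := delta_gt0.
have s0 := sin_half_gt0 bpi; have E0 := E_gt0 x0 bpi.
have s1 := sin_le1 (b / 2).
have la0 : 0 < 4 * (lam * a) by rewrite mulr_gt0// mulr_gt0.
apply: normM_le; last by rewrite gtr0_norm ?invr_gt0// lef_pV2.
apply: normD_le; last by apply: normM_le; [exact: g1_le'|exact: l2_le].
have Ele : E x b <= K.
  apply: le_trans (E_le b x0) _; rewrite ler_sqr ?nnegrE ?addr_ge0 ?mulr_ge0//; try exact: ltW.
  by rewrite lerD2l ler_wpM2l// ltW.
(* If [E >= 1] then [ln E <= E <= K]. Otherwise, with [s = sin (b / 2)],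
   [- ln E <= - ln (4 lam a) - 2 ln s], and [s (- ln s) <= 1] since [ln (1 / s) < 1 / s]. *)
have key : sin (b / 2) * `|ln (E x b)| <= C.
  have [E1|E1] := leP 1 (E x b).
    rewrite ger0_norm ?ln_ge0//; have := ln_sublinear E0; have := ln_ge0 E1.
    have := normr_ge0 (ln (4 * (lam * a))).
    move=> n0 l0 l1E; have := ler_wpM2r l0 s1; rewrite mul1r /C; lra.
  have lnE : ln (4 * (lam * a)) + 2 * ln (sin (b / 2)) <= ln (E x b).
    rewrite [2 * _]mulr_natl -lnXn// -lnM ?posrE ?exprn_gt0//.
    rewrite ler_ln ?posrE ?mulr_gt0 ?exprn_gt0//.
    apply: le_trans (E_ge b x0); rewrite ler_wpM2r ?sqr_ge0//.
    by rewrite ler_wpM2l// ler_wpM2l// ltW.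
  have lns : sin (b / 2) * (- ln (sin (b / 2))) <= 1.
    rewrite -lnV ?posrE// -ler_pdivlMl// mulr1 ltW// ln_sublinear// invr_gt0//.
  rewrite ler0_norm; last by rewrite ln_le0 ?ltW.
  have ln1 : - ln (4 * (lam * a)) <= `|ln (4 * (lam * a))| by rewrite ler_normr lexx orbT.
  have ln2 := normr_ge0 (ln (4 * (lam * a))).
  have K0 : 0 <= K by exact: sqr_ge0.
  have := ler_wpM2r ln2 s1; have := ler_wpM2l (ltW s0) lnE.
  rewrite mul1r mulrDr /C; have := ler_wpM2l (ltW s0) ln1.
  have -> : sin (b / 2) * (2 * ln (sin (b / 2))) = - (2 * (sin (b / 2) * - ln (sin (b / 2)))).
    by ring.
  by rewrite !mulrN in lns *; lra.
rewrite normrM /l1 [X in _ * X <= _]normrM (@gtr0_norm _ 2^-1) ?invr_gt0// mulrA mulrA ler_pM2r ?invr_gt0//.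
apply: (@le_trans _ _ (2 * sin (b / 2) / delta * `|ln (E x b)|)).
  rewrite ler_wpM2r//; apply: le_trans (g2_le' x0 bpi') _.
  by rewrite ler_wpM2r ?invr_ge0 ?sin_arg_le// ltW.
rewrite mulrAC [leLHS](_ : _ = 2 / delta * (sin (b / 2) * `|ln (E x b)|)); last first.
  by field; rewrite gt_eqF.
by rewrite ler_wpM2l// divr_ge0// ltW.
Qed.

(** Dominated convergence; the exceptional radius [lam x = 1], where the ray [b = 0] meets the
    branch point, is a null set. *)
Let J_cvg (a c : R) (u : nat -> R) (l : R -> R) : 0 < a -> a < c ->
  (forall k, 0 < u k <= pi) -> measurable_fun `[a, c] l ->
  (forall x, a <= x <= c -> lam * x != 1 -> Phi x (u k) / x @[k --> \oo] --> l x) ->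
  J a c (u k) @[k --> \oo] --> (\int[mu]_(x in `[a, c]) l x : R).
Proof.
move=> a0 ac uk ml ul; have [M hM] := Phi_bound a0 ac.
have pos x : a <= x <= c -> 0 < x by move=> /andP[ax _]; exact: lt_le_trans ax.
have mf k : measurable_fun `[a, c] (fun x => Phi x (u k) / x).
  by apply: continuous_itv_measurable => x /pos x0; exact: continuous_Phi.
have iM : mu.-integrable `[a, c] (EFin \o (cst M : R -> R)).
  by apply: continuous_itv_integrable => x _; exact: cst_continuous.
have [] := @dominated_convergence _ _ _ mu `[a, c]%classic (measurable_itv _)
   (fun k x => (Phi x (u k) / x)%:E) (EFin \o l) (EFin \o cst M).
- by move=> k; apply/measurable_EFinP; exact: mf.
- exact/measurable_EFinP.
- exists [set lam^-1]; split => //; first exact: lebesgue_measure_set1.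
  move=> x /= H; apply: contrapT => xl; apply: H; rewrite in_itv/= => axc.
  apply: cvg_EFin; first exact: nearW.
  apply: ul => //; apply/eqP => lx1; apply: xl.
  by rewrite -[LHS]mul1r -(mulVf (lt0r_neq0 lam0)) -mulrA lx1 mulr1.
- exact: iM.
- apply: aeW => x k /=; rewrite in_itv/= => axc; rewrite lee_fin.
  exact: hM.
move=> il _ /= cv; apply: fine_cvg; rewrite /Rintegral fineK; first exact: cv.
exact: integrable_fin_num.
Qed.

(** * The two extreme rays *)

Let arg_gt1_itv : set R := `[lam^-1, +oo[%classic.

(* As b tends to 0 the argument l2 tends to pi when lam x > 1 and to 0 otherwise. *)
Let lim0 : R -> R := (fun x => pi * g1 x 0 / x) \_ arg_gt1_itv.

Let zero_wide : 0 <= (0 : R) <= pi. Proof. by rewrite lexx pi_ge0. Qed.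

Let cvg_cot_half (u : nat -> R) : (forall k, 0 < u k <= pi) ->
  u k @[k --> \oo] --> 0 -> cos (u k / 2) / sin (u k / 2) @[k --> \oo] --> +oo.
Proof.
move=> uk u0.
have u20 : u k / 2 @[k --> \oo] --> 0.
  by rewrite -(mul0r (2^-1 : R)); apply: cvgM => //; exact: cvg_cst.
have s_0 : sin (u k / 2) @[k --> \oo] --> 0.
  by rewrite -[X in _ --> X](@sin0 R); apply: (cvg_seq_continuous (f := sin)) => //; exact: continuous_sin.
have c_1 : cos (u k / 2) @[k --> \oo] --> (1 : R).
  by rewrite -[X in _ --> X](@cos0 R); apply: (cvg_seq_continuous (f := cos)) => //; exact: continuous_cos.
have c_pos : \forall k \near \oo, 0 < cos (u k / 2).
  by apply: (cvgr_gt 1 c_1); rewrite ltr01.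
apply/gtr0_cvgV0.
  near=> k; rewrite divr_gt0 ?sin_half_gt0//; near: k; exact: c_pos.
rewrite -[X in _ --> X](mul0r (1^-1 : R)).
rewrite [X in X @ _](_ : _ = fun k => sin (u k / 2) * (cos (u k / 2))^-1); last first.
  by apply/funext => k; rewrite /= invf_div.
by apply: cvgM => //; apply: cvgV => //; rewrite oner_eq0.
Unshelve. all: by end_near. Qed.

(** As [cot (b / 2)] tends to [+oo], the sign of [1 - lam x] decides whether the arctangent tends to
    [pi / 2] or to [- pi / 2]. *)
Let l2_cvg0 x (u : nat -> R) : 0 < x -> lam * x != 1 ->
  (forall k, 0 < u k <= pi) -> u k @[k --> \oo] --> 0 ->
  l2 x (u k) @[k --> \oo] --> (if lam * x < 1 then 0 else pi).
Proof.
move=> x0 lx uk u0; have cot := cvg_cot_half uk u0.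
have lx0 : 0 < lam * x by rewrite mulr_gt0.
have u20 : u k / 2 @[k --> \oo] --> 0.
  by rewrite -(mul0r (2^-1 : R)); apply: cvgM => //; exact: cvg_cst.
rewrite /l2; case: ltP => lx1.
  rewrite [X in _ --> X](_ : _ = pi / 2 - 0 - pi / 2); last by ring.
  apply: cvgB; first by apply: cvgB => //; exact: cvg_cst.
  have k0 : 0 < (1 - lam * x) / (1 + lam * x) by rewrite divr_gt0 ?subr_gt0 ?addr_gt0.
  exact: (cvg_comp _ _ (gt0_cvgnMry k0 cot) (@cvgy_atan R)).
rewrite [X in _ --> X](_ : _ = pi / 2 - 0 - - (pi / 2)); last by lra.
apply: cvgB; first by apply: cvgB => //; exact: cvg_cst.
have k0 : 0 < (lam * x - 1) / (1 + lam * x).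
  by rewrite divr_gt0 ?subr_gt0 ?addr_gt0// lt_neqAle eq_sym lx.
rewrite (_ : (fun k => _) = fun k => - atan ((lam * x - 1) / (1 + lam * x) * (cos (u k / 2) / sin (u k / 2)))).
  apply: cvgN.
  exact: (cvg_comp _ _ (gt0_cvgnMry k0 cot) (@cvgy_atan R)).
by apply/funext => k; rewrite -atanN; congr atan; ring.
Qed.

Let Phi_cvg0 x (u : nat -> R) : 0 < x -> lam * x != 1 ->
  (forall k, 0 < u k <= pi) -> u k @[k --> \oo] --> 0 ->
  Phi x (u k) / x @[k --> \oo] --> lim0 x.
Proof.
move=> x0 lx uk u0.
have -> : lim0 x = (g2 x 0 * (ln (E x 0) / 2) + g1 x 0 * (if lam * x < 1 then 0 else pi)) / x.
  rewrite /g2 mulr0 sin0 mulr0 mul0r mul0r add0r /lim0 patchE.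
  have -> : (x \in arg_gt1_itv) = (1 <= lam * x).
    rewrite -(mulfV (lt0r_neq0 lam0)) ler_pM2l// /arg_gt1_itv.
    by apply/idP/idP; rewrite inE/= in_itv/= andbT.
  by rewrite leNgt; case: ltP => _ /=; rewrite ?mulr0 ?mul0r// (mulrC pi).
have E0 : 0 < E x 0.
  rewrite /E cos0 [ltRHS](_ : _ = (1 - lam * x) ^+ 2); last by ring.
  by rewrite lt_neqAle sqr_ge0 andbT eq_sym expf_eq0/= subr_eq0 eq_sym.
apply: cvgM; last exact: cvg_cst.
apply: cvgD; apply: cvgM.
- apply: (cvg_seq_continuous (f := g2 x)) => //; exact: is_derive_continuous (dg2b x0 zero_wide).
- rewrite /l1; apply: cvgM; last exact: cvg_cst.
  have cE : {for 0, continuous (E x)} := is_derive_continuous (dE_b x 0).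
  exact: (cvg_seq_continuous (continuous_ln E0) (cvg_seq_continuous cE u0)).
- apply: (cvg_seq_continuous (f := g1 x)) => //; exact: is_derive_continuous (dg1b x0 zero_wide).
- exact: l2_cvg0.
Qed.

Let J_osc (a c ea ec b1 b2 : R) : 0 < a -> a < c -> 0 < b1 -> b1 <= b2 -> b2 < pi ->
  (forall b, 0 < b <= pi -> `|Psi a b| <= ea) ->
  (forall b, 0 < b <= pi -> `|Psi c b| <= ec) ->
  `|J a c b2 - J a c b1| <= (ea + ec) * pi.
Proof.
move=> a0 ac b10 b12 b2pi Ha Hc.
have d b : b1 <= b <= b2 -> is_derive b (1 : R) (J a c) (Psi a b - Psi c b).
  move=> /andP[bb1 bb2]; apply: J_derive => //.
  by rewrite (lt_le_trans b10)//= (le_lt_trans bb2).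
have [b bI ->] : exists2 b, b \in `[b1, b2]%R &
    J a c b2 - J a c b1 = (Psi a b - Psi c b) * (b2 - b1).
  apply: MVT_segment => //.
  - by move=> b; rewrite in_itv/= => /andP[/ltW ? /ltW ?]; apply: d; apply/andP.
  - apply: continuous_in_subspaceT => b /set_mem/=; rewrite in_itv/= => bI.
    exact: is_derive_continuous (d _ bI).
move: bI; rewrite in_itv/= => /andP[bb1 bb2].
have bpi : 0 < b <= pi by rewrite (lt_le_trans b10)//= (le_trans bb2)// ltW.
apply: normM_le; first by apply: normB_le; [exact: Ha|exact: Hc].
by rewrite ger0_norm ?subr_ge0//; lra.
Qed.

Let measurable_lim0 (a c : R) : 0 < a -> measurable_fun `[a, c] lim0.
Proof.
move=> a0.
have mg : measurable_fun (`]0, +oo[%classic : set R) (fun x => pi * g1 x 0 / x).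
  apply: open_continuous_measurable_fun => // x.
  rewrite inE/= in_itv/= andbT => x0; have xn0 : x != 0 by rewrite gt_eqF.
  exact: (is_derive_continuous (is_deriveME (is_deriveME (is_derive_cst (pi : R) x 1)
    (dg1x x0 zero_wide)) (is_deriveVE xn0 (is_derive_id x (1 : R))))).
have mac : measurable_fun (`[a, c] `&` arg_gt1_itv) (fun x => pi * g1 x 0 / x).
  apply: measurable_funS mg => // x [/=]; rewrite !in_itv/= andbT => /andP[ax _] _.
  exact: lt_le_trans ax.
by apply: (measurable_restrict _ _ _).1 => //; exact: measurable_itv.
Qed.

(* Rotating the ray from b = 0 to b = pi changes the integral only by what Psi
   contributes at the two ends a and c. *)
Let J_ends (a c ea ec : R) : 0 < a -> a < c ->
  (forall b, 0 < b <= pi -> `|Psi a b| <= ea) ->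
  (forall b, 0 < b <= pi -> `|Psi c b| <= ec) ->
  `|J a c pi - \int[mu]_(x in `[a, c]) lim0 x| <= (ea + ec) * pi.
Proof.
move=> a0 ac Ha Hc; have p0 := @pi_gt0 R.
(* The derivative in [b] is available only strictly between 0 and pi, so both extreme rays are
   approached from inside; [k + 2] gives [u1 <= pi / 2 <= u2]. *)
pose u1 (k : nat) : R := pi / k.+2%:R; pose u2 (k : nat) : R := pi - u1 k.
have u1_gt0 k : 0 < u1 k by rewrite divr_gt0.
have u1_le k : u1 k <= pi / 2 by rewrite ler_wpM2l ?(ltW p0)// lef_pV2 ?posrE// ler_nat.
have u1_0 : u1 k @[k --> \oo] --> 0.
  rewrite -(mulr0 (pi : R)); apply: cvgM; [exact: cvg_cst|exact: cvgn_invS2].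
have u2_pi : u2 k @[k --> \oo] --> pi.
  by rewrite -[X in _ --> X](subr0 (pi : R)); apply: cvgB => //; exact: cvg_cst.
have u1k k : 0 < u1 k <= pi by rewrite u1_gt0; have := u1_le k; lra.
have u2k k : 0 < u2 k <= pi by apply/andP; rewrite /u2; have := u1_le k; have := u1_gt0 k; lra.
have J1 := J_cvg a0 ac u1k (measurable_lim0 a0).
have {}J1 : J a c (u1 k) @[k --> \oo] --> (\int[mu]_(x in `[a, c]) lim0 x : R).
  by apply: J1 => x /andP[ax _] lx; apply: Phi_cvg0 => //; exact: lt_le_trans ax.
have J2 : J a c (u2 k) @[k --> \oo] --> J a c pi.
  have pipi : 0 < (pi : R) <= pi by rewrite p0 lexx.
  apply: J_cvg => //.
    apply: continuous_itv_measurable => x /andP[ax _].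
    by apply: continuous_Phi => //; exact: lt_le_trans ax.
  move=> x /andP[ax _] _; have x0 : 0 < x by exact: lt_le_trans ax.
  apply: (cvg_seq_continuous (f := fun b => Phi x b / x)) => //.
  exact: is_derive_continuous (dPhi x0 pipi).
apply: (cvgr_to_le (cvg_norm (cvgB J2 J1))); apply: nearW => k.
apply: J_osc => //; first by rewrite /u2; have := u1_le k; lra.
by rewrite /u2 ltrBlDr ltrDl.
Qed.

(** Antiderivative of [1 / (x (1 + y x))], the value of [g1 x 0 / x], normalized to vanish at
    infinity so that only [T0 lam^-1] survives. *)
Let T0 (x : R) : R := - ln (1 + (y x)^-1) / alpha.

Let dT0 x : 0 < x -> is_derive x (1 : R) T0 (g1 x 0 / x).
Proof.
move=> x0; have y0 := y_gt0 x0; have yn0 : y x != 0 by rewrite gt_eqF.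
have q0 : 0 < 1 + (y x)^-1 by rewrite addr_gt0// invr_gt0.
apply: (is_derive_eq (is_deriveME (is_deriveN
  (@is_derive_compE _ _ (fun x => 1 + (y x)^-1) x _ _ (is_derive1_ln q0)
    (is_deriveDE (is_derive_cst (1 : R) x 1) (is_deriveVE yn0 (dy x0)))))
  (is_derive_cst (alpha^-1 : R) x 1))).
rewrite /g1 /D !mulr0 cos0 /cst !mulr1; move: (y x) y0 yn0 q0 => z z0 zn0 q0.
have d1 : 1 + 2 * z + z ^+ 2 != 0 by rewrite gt_eqF//; nra.
have d2 : 1 + z^-1 != 0 by rewrite gt_eqF.
have d3 : 1 + z != 0 by rewrite gt_eqF//; lra.
have -> : 1 + z^-1 = (1 + z) / z by field.
by field; rewrite d1 zn0 d3 (gt_eqF x0) (gt_eqF alpha0).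
Qed.

Let int_lim0 (a c : R) : 0 < a -> a < lam^-1 -> lam^-1 < c ->
  \int[mu]_(x in `[a, c]) lim0 x = pi * (T0 c - T0 lam^-1).
Proof.
move=> a0 al lc; rewrite -Rintegral_mkcondr /arg_gt1_itv.
have -> : (`[a, c] `&` `[lam^-1, +oo[ = `[lam^-1, c] :> set R)%classic.
  apply/seteqP; split => x /=; rewrite !in_itv/= ?andbT.
    by move=> [/andP[_ ->] ->].
  by move=> /andP[lx ->]; rewrite lx (le_trans (ltW al)).
have pos x : lam^-1 <= x <= c -> 0 < x.
  by move=> /andP[lx _]; rewrite (lt_le_trans _ lx)// invr_gt0.
have dF x : lam^-1 <= x <= c -> is_derive x (1 : R) (fun x => pi * T0 x) (pi * g1 x 0 / x).
  move=> /pos x0.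
  apply: (is_derive_eq (is_deriveME (is_derive_cst (pi : R) x 1) (dT0 x0))).
  by rewrite mul0r add0r mulrA.
have cf x : lam^-1 <= x <= c -> {for x, continuous (fun x => pi * g1 x 0 / x)}.
  move=> /pos x0; have xn0 : x != 0 by rewrite gt_eqF.
  exact: (is_derive_continuous (is_deriveME (is_deriveME (is_derive_cst (pi : R) x 1)
    (dg1x x0 zero_wide)) (is_deriveVE xn0 (is_derive_id x (1 : R))))).
by rewrite /Rintegral (FTC_segment lc dF cf)/= mulrBr.
Qed.

Let err (n : nat) : R :=
  delta^-1 * (2 * lam * n.+2%:R^-1 + pi / r * n.+2%:R^-1 `^ alpha) +
  r / delta * ((ln (1 + lam) + pi) * n.+2%:R^-1 `^ alpha +
               2 / alpha * n.+2%:R^-1 `^ (alpha / 2)).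

Let err_cvg0 : err n * pi @[n --> \oo] --> 0.
Proof.
rewrite [X in _ --> X](_ : _ = (delta^-1 * (2 * lam * 0 + pi / r * 0) +
  r / delta * ((ln (1 + lam) + pi) * 0 + 2 / alpha * 0)) * pi); last by ring.
have h1 := @cvgn_invS2 R; have h2 := cvgn_invS2_powR alpha0.
have a20 : 0 < alpha / 2 := divr_gt0 alpha0 (ltr0n _ 2).
have h3 := cvgn_invS2_powR a20.
by do ?[exact: h1|exact: h2|exact: h3|exact: cvg_cst|apply: cvgD|apply: cvgM].
Qed.

Let near_ends : \forall n \near \oo,
  `|J n.+2%:R^-1 n.+2%:R pi - pi * (T0 n.+2%:R - T0 lam^-1)| <= err n * pi.
Proof.
have h1 := @cvgn_invS2 R; have h2 := @cvgn_S2y R.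
have lV : 0 < lam^-1 by rewrite invr_gt0.
near=> n.
have c_l : 2 * lam^-1 <= n.+2%:R by near: n; move/cvgryPge : h2; exact.
have a_l : n.+2%:R^-1 <= lam^-1 / 2.
  by near: n; apply: (cvgr_le 0 h1); rewrite divr_gt0.
have a_0 : 0 < n.+2%:R^-1 :> R by rewrite invr_gt0.
have a_l' : n.+2%:R^-1 < lam^-1.
  by rewrite (le_lt_trans a_l)// ltr_pdivrMr// ltr_pMr// ltr1n.
have c_l' : lam^-1 < n.+2%:R.
  by apply: lt_le_trans c_l; rewrite ltr_pMl// ltr1n.
rewrite -(int_lim0 a_0 a_l' c_l').
apply: J_ends => //; first exact: S2_itv.
- move=> b bpi; apply: Psi_small_le => //.
  by rewrite -ler_pdivlMl// mulrC.
- move=> b bpi; apply: Psi_large_le => //; first by rewrite ler1n.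
  by rewrite -ler_pdivrMl// mulrC.
Unshelve. all: by end_near. Qed.

Let T0_cvg : T0 n.+2%:R @[n --> \oo] --> 0.
Proof.
rewrite [X in _ --> X](_ : _ = - ln (1 + r * 0) / alpha); last first.
  by rewrite mulr0 addr0 ln1 oppr0 mul0r.
apply: cvgM; last exact: cvg_cst.
apply: cvgN.
have c : {for 1 + r * 0 : R, continuous (@ln R)}.
  by apply: continuous_ln; rewrite mulr0 addr0.
rewrite [X in X @ _](_ : _ = fun n => ln (1 + r * n.+2%:R^-1 `^ alpha)); last first.
  apply/funext => n; congr (ln (1 + _)); rewrite /y invf_div; congr (r * _).
  by rewrite -[n.+2%:R^-1]powR_inv1// -powRrM mulN1r powRN.
apply: (cvg_seq_continuous c); apply: cvgD; first exact: cvg_cst.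
by apply: cvgM; [exact: cvg_cst|exact: (cvgn_invS2_powR alpha0)].
Qed.

(** On the negative axis [1 - lam z = 1 + lam x] is positive, so [l2] vanishes, and the imaginary
    part [g2] is the kernel of [rho_fun] up to the factor [sin (alpha * pi) * x]. *)
Let Phi_pi x : 0 < x -> Phi x pi / x = sin (alpha * pi) * rho_fun alpha r x * ln (1 + lam * x).
Proof.
move=> x0; have xa : 0 < x `^ alpha by rewrite powR_gt0.
have l0 : 0 < 1 + lam * x by rewrite addr_gt0// mulr_gt0.
have pipi : 0 <= (pi : R) <= pi by rewrite pi_ge0 lexx.
have D0 := D_gt0 x0 pipi.
rewrite /Phi /l2 cos_pihalf mul0r mulr0 atan0 subr0 subrr mulr0 addr0.
have -> : l1 x pi = ln (1 + lam * x).
  rewrite /l1 /E cospi (_ : 1 - _ + _ = (1 + lam * x) ^+ 2); last by ring.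
  by rewrite lnXn// mulr2n; field.
rewrite mulrAC; congr (_ * _); rewrite /g2 /rho_fun.
rewrite (mulrC 2 alpha) powRrM powR_mulrn ?powR_ge0//.
rewrite powRB ?powRr1 ?(ltW x0) ?(gt_eqF x0) ?implybT//.
move: D0; rewrite /D /y; move: (x `^ alpha) (cos _) (sin _) xa => z c s z0 D0.
have D1 : z ^+ 2 + 2 * z * r * c + r ^+ 2 != 0.
  rewrite (_ : _ + _ = r ^+ 2 * (1 + 2 * (z / r) * c + (z / r) ^+ 2)); last first.
    by field; rewrite gt_eqF.
  by rewrite mulf_neq0 ?expf_neq0// gt_eqF.
by field; rewrite D1 !gt_eqF.
Qed.

(** The end contributions vanish along [1 / (n + 2)] and [n + 2], which leaves [- pi T0 (1 / lam)].
    Positivity of the integrand on the ray [b = pi] turns the limit over segments into the integral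
    over the half-line. *)
Lemma integral_ln_rho_fun :
  (\int[mu]_(x in `]0%R, +oo[)
     (sin (alpha * pi) * rho_fun alpha r x * ln (1 + lam * x))%:E =
   (pi / alpha * ln (1 + r * lam `^ alpha))%:E)%E.
Proof.
have pipi : 0 < (pi : R) <= pi by rewrite pi_gt0 lexx.
have Jc : J n.+2%:R^-1 n.+2%:R pi @[n --> \oo] --> pi / alpha * ln (1 + r * lam `^ alpha).
  have -> : pi / alpha * ln (1 + r * lam `^ alpha) = pi * (0 - T0 lam^-1).
    rewrite sub0r /T0 mulNr opprK (_ : (y lam^-1)^-1 = r * lam `^ alpha).
      by rewrite mulrAC mulrA.
    rewrite /y invf_div -powR_inv1 ?(ltW lam0)// -powRrM mulN1r powRN invrK//.
  have c0 : pi * (T0 n.+2%:R - T0 lam^-1) @[n --> \oo] --> pi * (0 - T0 lam^-1).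
    by apply: cvgM; [exact: cvg_cst|apply: cvgB; [exact: T0_cvg|exact: cvg_cst]].
  have d0 : J n.+2%:R^-1 n.+2%:R pi - pi * (T0 n.+2%:R - T0 lam^-1) @[n --> \oo] --> 0.
    apply: norm_cvg0; apply: (squeeze_cvgr _ (cvg_cst 0) err_cvg0).
    by near=> n; rewrite normr_ge0/=; near: n; exact: near_ends.
  rewrite -[X in _ --> X]addr0.
  rewrite [X in X @ _](_ : _ = fun n => pi * (T0 n.+2%:R - T0 lam^-1) +
     (J n.+2%:R^-1 n.+2%:R pi - pi * (T0 n.+2%:R - T0 lam^-1))); last first.
    by apply/funext => n; rewrite addrC subrK.
  exact: cvgD.
have mf : measurable_fun (`]0, +oo[%classic : set R) (fun x => Phi x pi / x).
  apply: open_continuous_measurable_fun => // x.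
  by rewrite inE/= in_itv/= andbT => x0; exact: continuous_Phi.
have p0 (x : R) : 0 < x -> (0 <= (Phi x pi / x)%:E)%E.
  move=> x0; rewrite lee_fin Phi_pi// mulr_ge0//.
    rewrite mulr_ge0 ?rho_fun_ge0// sin_ge0_pi//.
    by have := @arg_range pi; rewrite in_itv/=; apply; rewrite pi_ge0 lexx.
  by rewrite ln_ge0// lerDl mulr_ge0// ltW.
transitivity (\int[mu]_(x in `]0%R, +oo[) (Phi x pi / x)%:E)%E.
  by apply: eq_integral => x; rewrite inE/= in_itv/= andbT => x0; rewrite Phi_pi.
have mE : measurable_fun (`]0, +oo[%classic : set R) (fun x => (Phi x pi / x)%:E).
  exact/measurable_EFinP.
have := ge0_cvg_integral_itv0y mE p0.
rewrite [X in X @ _](_ : _ = fun n => (J n.+2%:R^-1 n.+2%:R pi)%:E); last first.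
  apply/funext => n; rewrite /J /Rintegral fineK//.
  apply: integrable_fin_num => //; apply: continuous_itv_integrable => x /andP[nx _].
  by apply: continuous_Phi => //; rewrite (lt_le_trans _ nx)// invr_gt0.
move=> h1; apply: (cvg_unique _ h1) => //.
by apply: cvg_EFin; [exact: nearW|exact: Jc].
Unshelve. all: by end_near. Qed.

End contour.

(** * Gamma integrals and the uniqueness of E[(1 + l X)^(-a)] *)

Section gamma_integral.
Context {R : realType}.
Local Notation mu := (@lebesgue_measure R).
Local Notation pos := (`]0, +oo[%classic : set R).

Lemma ge0_integral_scale (c : R) (G : R -> R) : 0 < c ->
  (forall x : R, 0 < x -> {for x, continuous G}) ->
  (forall x : R, 0 < x -> 0 <= G x) ->
  (\int[mu]_(x in pos) (G x)%:E = c%:E * \int[mu]_(x in pos) (G (c * x))%:E)%E.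
Proof.
move=> c0 cG G0.
have mG : measurable_fun pos G.
  apply: open_continuous_measurable_fun => // x.
  by rewrite inE/= in_itv/= andbT; exact: cG.
have cGc (x : R) : 0 < x -> {for x, continuous (fun x => G (c * x))}.
  move=> x0; apply: continuous_comp.
    exact: (is_derive_continuous (is_derive_linear c x)).
  by apply: cG; rewrite mulr_gt0.
have mGc : measurable_fun pos (fun x => G (c * x)).
  apply: open_continuous_measurable_fun => // x.
  by rewrite inE/= in_itv/= andbT; exact: cGc.
have mE : measurable_fun pos (fun x => (G x)%:E) by exact/measurable_EFinP.
have mEc : measurable_fun pos (fun x => (G (c * x))%:E) by exact/measurable_EFinP.
have E0 (x : R) : 0 < x -> (0 <= (G x)%:E)%E by move=> x0; rewrite lee_fin G0.
have Ec0 (x : R) : 0 < x -> (0 <= (G (c * x))%:E)%E.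
  by move=> x0; rewrite lee_fin G0// mulr_gt0.
have h1 := ge0_cvg_integral_itv0y_scaled c0 mE E0.
have h2 := cvgeZl (y := c%:E) isT (ge0_cvg_integral_itv0y mEc Ec0).
apply: (cvg_unique _ h1) => //.
suff -> : (fun n : nat => (\int[mu]_(x in `[(c * n.+2%:R^-1)%R, (c * n.+2%:R)%R]) (G x)%:E)%E) =
  (fun n : nat => c%:E * \int[mu]_(x in `[(n.+2%:R^-1)%R, n.+2%:R%R]) (G (c * x)%R)%:E)%E.
  exact: h2.
apply/funext => n.
have ab := @S2_itv R n.
have dF (x : R) : is_derive x (1 : R) (fun x => c * x) c := is_derive_linear c x.
have F'E : derive1 (fun x : R => c * x) = cst c.
  by apply/funext => x; rewrite derive1E; have [_ ->] := dF x.
have pos_itv (x : R) : n.+2%:R^-1 <= x -> 0 < x by apply: lt_le_trans; rewrite invr_gt0.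
rewrite (@integration_by_substitution_increasing _ (fun x : R => c * x) G); first last.
- apply: continuous_in_subspaceT => x /set_mem /=; rewrite in_itv/= => /andP[cx _].
  by apply: cG; apply: lt_le_trans cx; rewrite mulr_gt0// invr_gt0.
- split.
  + by move=> x _; have [] := dF x.
  + by apply: cvg_at_right_filter; exact: is_derive_continuous (dF _).
  + by apply: cvg_at_left_filter; exact: is_derive_continuous (dF _).
- by rewrite F'E; apply/cvg_ex; exists c; exact: cvg_cst.
- by rewrite F'E; apply/cvg_ex; exists c; exact: cvg_cst.
- by move=> x _; rewrite F'E; exact: cst_continuous.
- by move=> x y _ _; rewrite ltr_pM2l.
- exact: ltW.
rewrite -ge0_integralZl//; first last.
- by rewrite lee_fin ltW.
- by move=> x /=; rewrite in_itv/= => /andP[/pos_itv x0 _]; exact: Ec0.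
- apply: measurable_funS mEc => //.
  by move=> x /=; rewrite !in_itv/= andbT => /andP[/pos_itv].
by apply: eq_integral => x _; rewrite F'E /= -EFinM mulrC.
Qed.

Variable a : R.
Hypothesis a0 : 0 < a.

(** Equal to [Gamma(a) c^(- a)] for [c > 0]; extended-real valued so that scaling can precede the
    proof of finiteness. *)
Definition gamma_integral (c : R) : \bar R :=
  (\int[mu]_(x in pos) (x `^ (a - 1) * expR (- (c * x)))%:E)%E.

Let continuous_integrand (c x : R) : 0 < x ->
  {for x, continuous (fun x => x `^ (a - 1) * expR (- (c * x)))}.
Proof.
move=> x0; exact: (is_derive_continuous (is_deriveME (is_derive1_powR (a - 1) x0)
  (is_derive_compE (is_derive_expR _) (is_deriveN (is_derive_linear c x))))).
Qed.

Lemma measurable_gamma_integrand (c : R) :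
  measurable_fun [set: R] (fun x => x `^ (a - 1) * expR (- (c * x))).
Proof.
apply: measurable_funM; first exact: measurable_powR.
by apply: measurableT_comp => //; apply: measurableT_comp.
Qed.

Lemma gamma_integral_scale c : 0 < c ->
  gamma_integral c = ((c `^ (- a))%:E * gamma_integral 1)%E.
Proof.
move=> c0; rewrite /gamma_integral (ge0_integral_scale (c := c^-1)) ?invr_gt0//; first last.
- by move=> x x0; rewrite mulr_ge0 ?powR_ge0 ?expR_ge0.
- by move=> x x0; exact: continuous_integrand.
have ca : c `^ (- a) = c^-1 * c^-1 `^ (a - 1).
  rewrite -{2}(powR_inv1 (ltW c0)) -powRrM -[c^-1]powR_inv1 ?(ltW c0)// -powRD; last by rewrite (gt_eqF c0) implybT.
  by congr (_ `^ _); ring.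
rewrite ca EFinM -muleA; congr (_ * _)%E; rewrite -ge0_integralZl//; first last.
- by rewrite lee_fin powR_ge0.
- by move=> x _; rewrite lee_fin mulr_ge0 ?powR_ge0 ?expR_ge0.
- apply/measurable_EFinP; apply: measurable_funTS; exact: measurable_gamma_integrand.
apply: eq_integral => x; rewrite inE/= in_itv/= andbT => x0.
rewrite -EFinM mulrA mulfV ?gt_eqF// mul1r powRM ?invr_ge0 ?(ltW c0) ?(ltW x0)//.
by rewrite mulrA.
Qed.

Let powR_le_expR (p x : R) : 0 < p -> 0 < x -> x `^ p <= p `^ p * expR x.
Proof.
move=> p0 x0; have xp : 0 < x / p by rewrite divr_gt0.
have -> : x `^ p = p `^ p * (x / p) `^ p.
  by rewrite -powRM ?(ltW p0) ?(ltW xp)// mulrC divfK// gt_eqF.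
rewrite ler_wpM2l ?powR_ge0// /powR (gt_eqF xp) ler_expR.
have := ltW (ln_sublinear xp) => h; have := ler_wpM2l (ltW p0) h.
by rewrite [X in _ <= X]mulrC divfK// gt_eqF.
Qed.

(** A comparison function with an elementary antiderivative that behaves like [x^(a - 1)] at 0 and
    is integrable at infinity. *)
Let base_integral :
  (\int[mu]_(x in pos) (a * x `^ (a - 1) / (1 + x `^ a) ^+ 2)%:E = 1)%E.
Proof.
have p0 (x : R) : 1 + x `^ a != 0 by rewrite gt_eqF// ltr_pwDl// powR_ge0.
have dF (x : R) : 0 < x -> is_derive x (1 : R) (fun x => - (1 + x `^ a)^-1)
    (a * x `^ (a - 1) / (1 + x `^ a) ^+ 2).
  move=> x0; apply: (is_derive_eq (is_deriveN (@is_deriveVE _ (fun x : R => 1 + x `^ a) x _ (p0 x)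
    (is_deriveDE (is_derive_cst (1 : R) x 1) (is_derive1_powR a x0))))).
  by rewrite add0r mulNr opprK.
have cf (x : R) : 0 < x -> {for x, continuous (fun x => a * x `^ (a - 1) / (1 + x `^ a) ^+ 2)}.
  move=> x0; have p20 : (1 + x `^ a) * (1 + x `^ a) != 0 by rewrite mulf_neq0.
  have dq := is_deriveDE (is_derive_cst (1 : R) x 1) (is_derive1_powR a x0).
  exact: (is_derive_continuous (is_deriveME (is_deriveME (is_derive_cst (a : R) x 1)
    (is_derive1_powR (a - 1) x0)) (@is_deriveVE _ (fun x : R => (1 + x `^ a) * (1 + x `^ a)) x _ p20 (is_deriveME dq dq)))).
rewrite (ge0_FTC_itv0y (l0 := - (1 + 0)^-1) (l := 0) dF cf)/=.
- by rewrite addr0 invr1 sub0r opprK.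
- by move=> x x0; rewrite divr_ge0 ?sqr_ge0// mulr_ge0 ?powR_ge0// ltW.
- apply: cvgN; apply: cvgV; first by rewrite addr0 oner_eq0.
  by apply: cvgD; [exact: cvg_cst|exact: cvgn_invS2_powR].
- rewrite -[X in _ --> X]oppr0; apply: cvgN.
  apply: (squeeze_cvgr _ (cvg_cst 0) (cvgn_invS2_powR a0)); apply: nearW => n.
  have q0 : 0 < 1 + n.+2%:R `^ a by rewrite ltr_pwDl// powR_ge0.
  rewrite invr_ge0 (ltW q0)/= -[n.+2%:R^-1]powR_inv1// -powRrM mulN1r powRN.
  by rewrite lef_pV2 ?posrE ?powR_gt0// lerDr.
Qed.

Lemma gamma_integral_lty : (gamma_integral 1 < +oo)%E.
Proof.
(* From [(1 + x^a)^2 <= 2 (1 + x^(2 a))] and [x^(2 a) <= (2 a)^(2 a) exp x]; the division by [a]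
   cancels the factor [a] of the comparison function. *)
pose C := 2 * (1 + (2 * a) `^ (2 * a)) / a.
have C0 : 0 <= C by rewrite divr_ge0 ?(ltW a0)// mulr_ge0// addr_ge0 ?powR_ge0.
have a20 : 0 < 2 * a by rewrite mulr_gt0.
have mb : measurable_fun pos (fun x => (a * x `^ (a - 1) / (1 + x `^ a) ^+ 2)%:E).
  apply/measurable_EFinP; apply: measurable_funTS; apply: measurable_funM.
    by apply: measurable_funM => //; exact: measurable_powR.
  apply: measurable_funVR; apply: measurable_funX; apply: measurable_funD => //.
apply: (@le_lt_trans _ _ (\int[mu]_(x in pos) (C%:E * (a * x `^ (a - 1) / (1 + x `^ a) ^+ 2)%:E))%E).
  apply: ge0_le_integral => //.
  - by move=> x _; rewrite lee_fin mulr_ge0 ?powR_ge0 ?expR_ge0.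
  - apply/measurable_EFinP; apply: measurable_funTS; exact: measurable_gamma_integrand.
  - exact: measurable_funeM.
  move=> x /=; rewrite in_itv/= andbT => x0; rewrite -EFinM lee_fin mul1r.
  have q0 : 0 < (1 + x `^ a) ^+ 2 by rewrite exprn_gt0// ltr_pwDl// powR_ge0.
  have -> : C * (a * x `^ (a - 1) / (1 + x `^ a) ^+ 2) =
            x `^ (a - 1) * (2 * (1 + (2 * a) `^ (2 * a)) / (1 + x `^ a) ^+ 2).
    by rewrite /C; field; rewrite (gt_eqF a0) andbT -sqrf_eq0 gt_eqF.
  rewrite ler_wpM2l ?powR_ge0// ler_pdivlMr// mulrC expRN ler_pdivrMr ?expR_gt0//.
  have h1 := powR_le_expR a20 x0; have h2 : 1 <= expR x by rewrite -expR0 ler_expR ltW.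
  have h3 : x `^ (2 * a) = x `^ a ^+ 2 by rewrite mulrC powRrM powR_mulrn// powR_ge0.
  rewrite h3 in h1; move: (x `^ a) h1 => z h1; have := sqr_ge0 (z - 1); nra.
rewrite ge0_integralZl//; last by move=> x _; rewrite lee_fin divr_ge0 ?sqr_ge0// mulr_ge0 ?powR_ge0// ltW.
by rewrite base_integral mule1 ltry.
Qed.

End gamma_integral.

Section stieltjes_uniqueness.
Context {R : realType}.
Local Notation mu := (@lebesgue_measure R).
Local Notation pos := (`]0, +oo[%classic : set R).
Variable a : R.
Hypothesis a0 : 0 < a.
Implicit Types P Q : probability R R.

(* The measure m P with density s^(a-1) exp(-s) E[exp(-s X)] has a Laplace transform
   that only involves E[(1 + l X)^(-a)].  Hence m P, and with it the decreasing
   function s |-> E[exp(-s X)], is determined by these numbers. *)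
Let laplace P (s : R) : \bar R := (\int[P]_(x in pos) (expR (- (s * x)))%:E)%E.

Let measurable_exp2 : measurable_fun [set: R * R] (fun z : R * R => (expR (- (z.1 * z.2)))%:E).
Proof.
apply/measurable_EFinP; apply: measurableT_comp => //; apply: measurableT_comp => //.
exact: measurable_funM.
Qed.

Let measurable_expRN (s : R) : measurable_fun [set: R] (fun x : R => (expR (- (s * x)))%:E).
Proof.
by apply/measurable_EFinP; apply: measurableT_comp => //; apply: measurableT_comp.
Qed.

Let measurable_laplace P : measurable_fun [set: R] (laplace P).
Proof.
rewrite /laplace.
pose h := (fun z : R * R => (expR (- (z.1 * z.2)))%:E) \_ ([set: R] `*` pos).
have mh : measurable_fun setT h.
  apply: (measurable_restrictT _ _).1; last exact: measurable_funTS.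
  by apply: measurableX.
have h0 z : (0 <= h z)%E by rewrite /h patchE; case: ifP => // _; rewrite lee_fin expR_ge0.
rewrite (_ : (fun s => _) = fubini_F P h).
  exact: measurable_fun_fubini_tonelli_F.
apply/funext => s; rewrite /fubini_F [LHS]integral_mkcond; apply: eq_integral => x _.
by rewrite /h !patchE in_setX in_setT.
Qed.

Let laplace_ge0 P s : (0 <= laplace P s)%E.
Proof. by apply: integral_ge0 => x _; rewrite lee_fin expR_ge0. Qed.

Let w (s : R) : \bar R := ((fun s : R => (s `^ (a - 1) * expR (- s))%:E) \_ pos) s.

Let w_ge0 s : (0 <= w s)%E.
Proof.
by rewrite /w patchE; case: ifP => // _; rewrite lee_fin mulr_ge0 ?powR_ge0 ?expR_ge0.
Qed.

Let measurable_w : measurable_fun [set: R] w.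
Proof.
apply: (measurable_restrictT _ _).1; first exact: measurable_itv.
apply: measurable_funTS; apply/measurable_EFinP; apply: measurable_funM.
  exact: measurable_powR.
by apply: measurableT_comp.
Qed.

Let g P (s : R) : \bar R := (w s * laplace P s)%E.

Let g_ge0 P s : (0 <= g P s)%E. Proof. exact: mule_ge0. Qed.

Let measurable_g P : measurable_fun [set: R] (g P).
Proof. exact: emeasurable_funM. Qed.

Let m P : {measure set R -> \bar R} := measure_of_density (measurable_g P) (g_ge0 P).

(** Integrating [s^(a - 1) exp(- (1 + k + x) s)] in [s] first gives [Gamma(a) (1 + k + x)^(- a)],
    and factoring out [1 + k] leaves the transform of [P] at [l = 1 / (1 + k)]. *)
Let m_laplace P (k : R) : 0 <= k ->
  (\int[m P]_s (expR (- (k * s)))%:E =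
   gamma_integral a 1 * ((1 + k) `^ (- a))%:E *
     \int[P]_(x in pos) ((1 + (1 + k)^-1 * x) `^ (- a))%:E)%E.
Proof.
move=> k0; have k1 : 0 < 1 + k by rewrite ltr_pwDl.
have mid : measurable_fun [set: measurableTypeR R] (idfun : measurableTypeR R -> R) by move=> _ B mB; rewrite setTI.
rewrite (ge0_integral_density (mu := mu) (m := m P) mid (measurable_g P) (g_ge0 P))//=.
pose f (z : R * R) : \bar R := (z.1 `^ (a - 1) * expR (- ((1 + k + z.2) * z.1)))%:E.
have mf : measurable_fun setT f.
  apply/measurable_EFinP; apply: measurable_funM.
    exact: (measurableT_comp (measurable_powR _)).
  apply: measurableT_comp => //; apply: measurableT_comp => //.
  by apply: measurable_funM => //; exact: measurable_funD.
transitivity (\int[mu]_(s in pos) \int[P]_(x in pos) f (s, x))%E.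
  rewrite [RHS]integral_mkcond; apply: eq_integral => s _.
  rewrite /g /w !patchE; case: ifPn => sp; last by rewrite !mul0e.
  rewrite muleAC -EFinM -ge0_integralZl//; first last.
  - by rewrite lee_fin !mulr_ge0 ?powR_ge0 ?expR_ge0.
  - exact: measurable_funTS.
  apply: eq_integral => x _; rewrite /f/= -EFinM -!mulrA -!expRD; congr EFin; congr (_ * expR _).
  by ring.
rewrite (fubini_tonelli_in mu P)//; last first.
  by move=> s x _ _; rewrite lee_fin mulr_ge0 ?powR_ge0 ?expR_ge0.
have cE (x : R) : 0 < x -> (1 + k + x) `^ (- a) = (1 + k) `^ (- a) * (1 + (1 + k)^-1 * x) `^ (- a).
  move=> x0; rewrite -powRM ?(ltW k1)//; last by rewrite addr_ge0// mulr_ge0 ?invr_ge0 ?(ltW k1) ?(ltW x0).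
  by congr (_ `^ _); field; rewrite gt_eqF.
transitivity (\int[P]_(x in pos) (gamma_integral a 1 * ((1 + k) `^ (- a))%:E *
   ((1 + (1 + k)^-1 * x) `^ (- a))%:E))%E.
  apply: eq_integral => x; rewrite inE/= in_itv/= andbT => x0.
  by rewrite -muleA -EFinM -cE// muleC -gamma_integral_scale ?(addr_gt0 k1 x0).
rewrite ge0_integralZl//; first last.
- by rewrite mule_ge0 ?lee_fin ?powR_ge0//; apply: integral_ge0 => x _;
    rewrite lee_fin mulr_ge0 ?powR_ge0 ?expR_ge0.
- by move=> x _; rewrite lee_fin powR_ge0.
- apply: measurable_funTS; apply/measurable_EFinP; apply: (measurableT_comp (measurable_powR _)).
  by apply: measurable_funD => //; exact: measurable_funM.
Qed.

Let measurable_stieltjes (l : R) : measurable_fun [set: R] (fun x : R => ((1 + l * x) `^ (- a))%:E).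
Proof.
apply/measurable_EFinP; apply: (measurableT_comp (measurable_powR _)).
by apply: measurable_funD => //; exact: measurable_funM.
Qed.

Let m_lty P : (m P [set: R] < +oo)%E.
Proof.
have -> : m P [set: R] = (\int[m P]_s (expR (- (0 * s)))%:E)%E.
  under eq_integral do rewrite mul0r oppr0 expR0.
  by rewrite integral_cst// mul1e.
rewrite m_laplace// addr0 powR1 mule1 lte_mul_pinfty//.
- by apply: integral_ge0 => x _; rewrite lee_fin mulr_ge0 ?powR_ge0 ?expR_ge0.
- rewrite ge0_fin_numE ?gamma_integral_lty//.
  by apply: integral_ge0 => x _; rewrite lee_fin mulr_ge0 ?powR_ge0 ?expR_ge0.
apply: (@le_lt_trans _ _ (\int[P]_(x in pos) (cst 1%E x))%E).
  apply: ge0_le_integral => //; [by move=> x _; rewrite lee_fin powR_ge0|exact: measurable_funTS|].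
  move=> x /=; rewrite in_itv/= andbT => x0; rewrite lee_fin invr1 mul1r powRN invf_le1 ?powR_gt0 ?addr_gt0//.
  by rewrite -[leLHS](powRr0 (1 + x)) ler_powR ?lerDl ?(ltW x0) ?(ltW a0).
by rewrite integral_cst// mul1e (le_lt_trans (probability_le1 _ _))// ltry.
Qed.

Let m_neg P : m P `]-oo, 0[%classic = 0%E.
Proof.
rewrite /m /measure_of_density/= /density_measure integral0_eq// => s /=.
rewrite in_itv/= => s0; rewrite /g /w patchE ifF ?mul0e//.
by apply/negbTE; rewrite notin_setE/= in_itv/= andbT => /(lt_trans s0); rewrite ltxx.
Qed.

Let laplace_noninc P s t : s <= t -> (laplace P t <= laplace P s)%E.
Proof.
move=> st; apply: ge0_le_integral => //; [exact: measurable_funTS|exact: measurable_funTS|].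
move=> x /=; rewrite in_itv/= andbT => x0.
by rewrite lee_fin ler_expR lerN2 ler_wpM2r// ltW.
Qed.

Let laplace_le1 P s : 0 <= s -> (laplace P s <= 1)%E.
Proof.
move=> s0; apply: (@le_trans _ _ (\int[P]_(x in pos) (cst 1%E x))%E).
  apply: ge0_le_integral => //; first exact: measurable_funTS.
  move=> x /=; rewrite in_itv/= andbT => x0.
  by rewrite lee_fin -expR0 ler_expR oppr_le0 mulr_ge0// ltW.
by rewrite integral_cst// mul1e probability_le1.
Qed.

Let laplace_cvg P (k : R) : 0 <= k ->
  laplace P (k + n.+1%:R^-1) @[n --> \oo] --> laplace P k.
Proof.
move=> k0; rewrite /laplace.
rewrite (_ : (fun x => (expR (- (k * x)))%:E) =
  fun x => limn (fun n : nat => (expR (- ((k + n.+1%:R^-1) * x)))%:E)); last first.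
  apply/funext => x; apply/esym/cvg_lim => //; apply: cvg_EFin; first exact: nearW.
  have c : {for - (k * x), continuous (@expR R)} by exact: continuous_expR.
  apply: (cvg_seq_continuous c); apply: cvgN; apply: cvgM; last exact: cvg_cst.
  by rewrite -[X in _ --> X]addr0; apply: cvgD; [exact: cvg_cst|exact: cvg_harmonic].
apply: cvg_monotone_convergence => //.
- by move=> n; exact: measurable_funTS.
- move=> x /=; rewrite in_itv/= andbT => x0 i j ij.
  rewrite lee_fin ler_expR lerN2 ler_wpM2r ?(ltW x0)// lerD2l.
  by rewrite lef_pV2 ?posrE// ler_nat.
Qed.

(** The test function is the indicator divided by the weight [w], which is positive on [[k, k + d]]
    because [k > 0]. *)
Let laplace_mean P Q (k d : R) : (forall A, measurable A -> m P A = m Q A) ->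
  0 < k -> 0 < d ->
  (\int[mu]_(s in `[k, (k + d)%R]) laplace P s = \int[mu]_(s in `[k, (k + d)%R]) laplace Q s)%E.
Proof.
move=> PQ k0 d0; pose A : set R := `[k, k + d]%classic.
pose f (s : R) : \bar R := (\1_A s * (s `^ (a - 1) * expR (- s))^-1)%:E.
have mf : measurable_fun [set: R] f.
  apply/measurable_EFinP; apply: measurable_funM; first by apply: measurable_indic; exact: measurable_itv.
  apply: measurable_funVR; apply: measurable_funM; first exact: measurable_powR.
  by apply: measurableT_comp.
have f0 s : (0 <= f s)%E.
  by rewrite lee_fin mulr_ge0// invr_ge0 mulr_ge0 ?powR_ge0 ?expR_ge0.
have mid : measurable_fun [set: measurableTypeR R] (idfun : measurableTypeR R -> R) by move=> _ B mB; rewrite setTI.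
have key P' : (\int[m P']_s f s = \int[mu]_(s in A) laplace P' s)%E.
  rewrite (ge0_integral_density (mu := mu) (m := m P') mid (measurable_g P') (g_ge0 P'))//=.
  rewrite [RHS]integral_mkcond; apply: eq_integral => s _.
  rewrite patchE /f indicE; case: ifPn => sA; last by rewrite mul0r mule0.
  have s0 : 0 < s by move: sA; rewrite inE /A/= in_itv/= => /andP[ks _]; exact: lt_le_trans ks.
  rewrite /g /w patchE ifT; last by rewrite inE/= in_itv/= andbT.
  rewrite mul1r muleAC -EFinM mulfV ?mul1e// mulf_neq0// gt_eqF ?powR_gt0 ?expR_gt0//.
by rewrite -!key; apply: eq_measure_integral => B mB _; exact: PQ.
Qed.

(** Equal averages over [[k, k + d]] and monotonicity give [laplace Q (k + d) <= laplace P k]; then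
    [d] tends to 0. Exchanging [P] and [Q] yields equality. *)
Let laplace_le P Q (k : R) : (forall A, measurable A -> m P A = m Q A) ->
  0 < k -> (laplace Q k <= laplace P k)%E.
Proof.
move=> PQ k0.
have fin P' s : 0 <= s -> laplace P' s \is a fin_num.
  by move=> s0; rewrite ge0_fin_numE// (le_lt_trans (@laplace_le1 P' s s0))// ltry.
apply: (cvge_to_le (@laplace_cvg Q k (ltW k0))); apply: nearW => n.
have d0 : 0 < n.+1%:R^-1 :> R by rewrite invr_gt0.
have := laplace_mean PQ k0 d0; set d : R := n.+1%:R^-1; set A : set R := `[k, (k + d)%R]%classic.
have mA : mu A = d%:E.
  by rewrite lebesgue_measure_itv/= lte_fin ltrDl d0 -EFinB addrAC subrr add0r.
have ml P' : measurable_fun A (laplace P') by exact: measurable_funTS.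
have cE c : (\int[mu]_(s in A) cst c s = c * d%:E)%E.
  transitivity (c * mu A)%E; last by rewrite mA.
  by apply: integral_cst; exact: measurable_itv.
have up : (\int[mu]_(s in A) laplace P s <= laplace P k * d%:E)%E.
  rewrite -cE; apply: ge0_le_integral => //; [exact: measurable_itv|exact: ml|].
  by move=> s; rewrite /A/= in_itv/= => /andP[ks _]; exact: laplace_noninc.
have lo : (laplace Q (k + d) * d%:E <= \int[mu]_(s in A) laplace Q s)%E.
  rewrite -cE; apply: ge0_le_integral => //; [exact: measurable_itv|by move=> s _; exact: laplace_ge0|exact: ml|].
  by move=> s; rewrite /A/= in_itv/= => /andP[_ ks]; exact: laplace_noninc.
rewrite -/A => E; rewrite -E in lo; have := le_trans lo up.
by rewrite lee_pmul2r.
Qed.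

Lemma stieltjes_unique P Q : P `]-oo, 0]%classic = 0%E -> Q `]-oo, 0]%classic = 0%E ->
  (forall l : R, 0 <= l -> (\int[P]_x ((1 + l * x) `^ (- a))%:E =
                            \int[Q]_x ((1 + l * x) `^ (- a))%:E)%E) ->
  forall A, measurable A -> P A = Q A.
Proof.
move=> P0 Q0 H.
have mPQ A : measurable A -> m P A = m Q A.
  apply: laplace_unique; [exact: m_lty|exact: m_lty|exact: m_neg|exact: m_neg|].
  move=> k; rewrite !m_laplace//; congr (_ * _)%E.
  rewrite -!ge0_integral_itv0y//; try by move=> x; rewrite lee_fin powR_ge0.
  by apply: H; rewrite invr_ge0.
have null (P' : probability R R) : P' `]-oo, 0]%classic = 0%E -> P' `]-oo, 0[%classic = 0%E.
  move=> P'0; apply: (subset_measure0 _ _ _ P'0) => //.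
  by move=> x /=; rewrite !in_itv/= => /ltW.
have fin (P' : probability R R) : (P' [set: R] < +oo)%E by rewrite probability_setT ltry.
apply: (laplace_unique (fin P) (fin Q) (null _ P0) (null _ Q0)).
move=> [|k].
  under eq_integral do rewrite mul0r oppr0 expR0.
  under [RHS]eq_integral do rewrite mul0r oppr0 expR0.
  by rewrite !integral_cst// !mul1e; exact: (etrans (probability_setT _) (esym (probability_setT _))).
have L (P' : probability R R) : P' `]-oo, 0]%classic = 0%E ->
    (\int[P']_x (expR (- (k.+1%:R * x)))%:E = laplace P' k.+1%:R)%E.
  by move=> P'0; rewrite ge0_integral_itv0y// => x; rewrite lee_fin expR_ge0.
rewrite !L//; apply/eqP; rewrite eq_le !laplace_le//.
by move=> A mA; rewrite mPQ.
Qed.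

End stieltjes_uniqueness.

(** * Exponents of Thorin measures *)

Section ln_integrand.
Context {R : realType}.
Local Notation pos := (`]0, +oo[%classic : set R).

Lemma measurable_lnD (l : R) : measurable_fun [set: R] (fun x : R => (ln (1 + l * x))%:E).
Proof.
apply/measurable_EFinP; apply: measurableT_comp => //.
by apply: measurable_funD => //; exact: measurable_funM.
Qed.

Lemma lnD_ge0 (l x : R) : 0 <= l -> 0 < x -> (0 <= (ln (1 + l * x))%:E)%E.
Proof. by move=> l0 x0; rewrite lee_fin ln_ge0// lerDl mulr_ge0// ltW. Qed.

(** Extension by 0, so that the formulas for densities, mixtures and image laws apply: they want an
    integrand that is nonnegative on the whole line. *)
Definition lnpos (l : R) : R -> \bar R := (fun x => (ln (1 + l * x))%:E) \_ pos.

Lemma measurable_lnpos l : measurable_fun [set: R] (lnpos l).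
Proof.
by apply: (measurable_restrictT _ _).1; [exact: measurable_itv|exact: measurable_funTS (measurable_lnD l)].
Qed.

Lemma lnpos_ge0 l x : 0 <= l -> (0 <= lnpos l x)%E.
Proof.
move=> l0; rewrite /lnpos patchE; case: ifPn => //.
by rewrite inE/= in_itv/= andbT; exact: lnD_ge0.
Qed.

Lemma lnposE l x : 0 < x -> lnpos l x = (ln (1 + l * x))%:E.
Proof. by move=> x0; rewrite /lnpos patchE ifT// inE/= in_itv/= andbT. Qed.

End ln_integrand.

Section exponents.
Context {R : realType}.
Local Notation mu := (@lebesgue_measure R).
Local Notation pos := (`]0, +oo[%classic : set R).

Let mlnD := @measurable_lnD R.
Let mlnpos := @measurable_lnpos R.

Let measurable_idL : measurable_fun [set: measurableTypeR R] (idfun : measurableTypeR R -> R).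
Proof. by move=> _ B mB; rewrite setTI. Qed.

(* ln (1 + x) is bounded below on [1/n, +oo[, which therefore has finite mass. *)
Lemma sigma_finite_ln_integral (m : {measure set R -> \bar R}) :
  m `]-oo, 0]%classic = 0%E ->
  (\int[m]_(x in pos) (ln (1 + x))%:E < +oo)%E -> sigma_finite [set: R] m.
Proof.
move=> m0 moo; exists (fun n => `]-oo, 0] `|` `[n.+1%:R^-1, +oo[)%classic.
  apply/seteqP; split => // x _; exists (Num.truncn x^-1) => //=.
  have [x0|x0] := leP x 0; [left|right]; rewrite in_itv//= andbT.
  rewrite -[leRHS]invrK lef_pV2 ?posrE ?invr_gt0//.
  by rewrite ltW// truncnS_gt.
move=> n; split; first exact: measurableU.
pose d : R := n.+1%:R^-1; have d0 : 0 < d by rewrite invr_gt0.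
apply: le_lt_trans (measureU2 _ _ _) _ => //.
rewrite [X in (X + _)%E](_ : _ = 0%E) ?add0e; last exact: m0.
have ld : 0 < ln (1 + d) by rewrite ln_gt0// ltrDl.
have lem : ((ln (1 + d))%:E * m `[d, +oo[%classic <= \int[m]_(x in pos) (ln (1 + x))%:E)%E.
  have ml1 : measurable_fun [set: R] (fun x : R => (ln (1 + x))%:E).
    by apply/measurable_EFinP; apply: measurableT_comp => //; exact: measurable_funD.
  have dpos : `[d, +oo[%classic `<=` pos.
    by move=> x /=; rewrite !in_itv/= !andbT; exact: lt_le_trans.
  apply: (@le_trans _ _ (\int[m]_(x in `[d, +oo[) (ln (1 + x))%:E)%E); last first.
    apply: ge0_subset_integral => //; first exact: measurable_funTS.
    by move=> x /=; rewrite in_itv/= andbT => x0; rewrite lee_fin ln_ge0// lerDl ltW.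
  rewrite -integral_cst//; apply: ge0_le_integral => //.
  - by move=> x _; rewrite lee_fin ltW.
  - exact: measurable_funTS.
  - move=> x /=; rewrite in_itv/= andbT => dx; rewrite lee_fin ler_ln ?posrE ?lerD2l//.
      by rewrite addr_gt0.
    by rewrite addr_gt0// (lt_le_trans d0).
rewrite ltNge leye_eq; apply/negP => /eqP minf.
by move: lem; rewrite [X in (_ * X)%E]minf gt0_muley ?lte_fin// leNgt moo.
Qed.

Lemma Thorin_exponentE (m : {measure set R -> \bar R}) (l : R) : Thorin m -> 0 <= l ->
  (\int[m]_(x in pos) (ln (1 + l * x))%:E = (Thorin_exponent m l)%:E)%E.
Proof.
move=> [_ _ H] l0; rewrite /Thorin_exponent /Rintegral fineK//.
rewrite ge0_fin_numE; last first.
  by apply: integral_ge0 => x /=; rewrite in_itv/= andbT; exact: lnD_ge0.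
move: l0; rewrite le_eqVlt => /predU1P[<-|l0]; last exact: H.
rewrite integral0_eq ?ltry// => x _.
by rewrite mul0r addr0 ln1.
Qed.

Lemma Thorin_exponent0 (m : {measure set R -> \bar R}) : Thorin_exponent m 0 = 0.
Proof.
rewrite /Thorin_exponent /Rintegral integral0_eq//= => x _.
by rewrite mul0r addr0 ln1.
Qed.

Variable alpha : R.
Hypothesis ha : 0 < alpha < 1.
Variable nu : {sigma_finite_measure set R -> \bar R}.

Let alpha0 : 0 < alpha. Proof. by case/andP: ha. Qed.

Let sin_gt0 : 0 < sin (alpha * pi).
Proof.
apply: sin_gt0_pi; case/andP: ha => a0 a1.
by rewrite mulr_gt0 ?pi_gt0//= gtr_pMl ?pi_gt0.
Qed.

Lemma rho_fun_integral (r l : R) : 0 < r -> 0 < l ->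
  (\int[mu]_(x in pos) ((sin (pi * alpha) / pi)%:E * ((rho_fun alpha r x)%:E * (ln (1 + l * x))%:E)) =
   (alpha^-1)%:E * (ln (1 + l `^ alpha * r))%:E)%E.
Proof.
move=> r0 l0; have p0 := @pi_gt0 R.
have e : (fun x => (sin (pi * alpha) / pi)%:E * ((rho_fun alpha r x)%:E * (ln (1 + l * x))%:E))%E =
    (fun x => (pi^-1)%:E * (sin (alpha * pi) * rho_fun alpha r x * ln (1 + l * x))%:E)%E.
  by apply/funext => x; rewrite -!EFinM (mulrC pi alpha); congr EFin; ring.
have mr : measurable_fun pos (fun x => (sin (alpha * pi) * rho_fun alpha r x * ln (1 + l * x))%:E).
  apply/measurable_EFinP; apply: measurable_funTS; apply: measurable_funM; last first.
    by apply/measurable_EFinP; exact: measurable_lnD.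
  by apply: measurable_funM => //; exact: (measurable_fun_pair1 r (measurable_rho_fun alpha)).
rewrite e ge0_integralZl//; first last.
- by rewrite lee_fin invr_ge0 ltW.
- move=> x /=; rewrite in_itv/= andbT => x0; rewrite lee_fin mulr_ge0//.
    by rewrite mulr_ge0 ?(ltW sin_gt0)// rho_fun_ge0.
  by rewrite -lee_fin lnD_ge0// ltW.
rewrite integral_ln_rho_fun// -!EFinM (mulrC r); congr EFin.
by move: (pi : R) p0 => p p0; field; rewrite !gt_eqF.
Qed.

(** Tonelli reduces the claim to a point mass at [r], which is the contour integral. *)
Lemma rho_nu_integral (l : R) : 0 < l ->
  (\int[rho_nu_measure ha nu]_(x in pos) (ln (1 + l * x))%:E =
   (alpha^-1)%:E * \int[nu]_(r in pos) (ln (1 + l `^ alpha * r))%:E)%E.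
Proof.
move=> l0; pose c : R := sin (pi * alpha) / pi.
have c0 : 0 <= c by exact: sin_alpha_ge0.
rewrite integral_mkcond -/(lnpos l).
rewrite (ge0_integral_density (mu := mu) (m := rho_nu_measure ha nu) measurable_idL
  (measurable_rho_nu_pos_density alpha nu) (rho_nu_pos_density_ge0 ha nu))//; last first.
  by move=> x; apply: lnpos_ge0; exact: ltW.
pose f (z : R * R) : \bar R := (c%:E * ((rho_fun alpha z.2 z.1)%:E * (ln (1 + l * z.1))%:E))%E.
have mrho : measurable_fun setT (fun z : R * R => (rho_fun alpha z.2 z.1)%:E).
  by apply/measurable_EFinP; exact: measurable_rho_fun.
have mf : measurable_fun setT f.
  apply: measurable_funeM; apply: emeasurable_funM => //.
  exact: (measurableT_comp (measurable_lnD l)).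
transitivity (\int[mu]_(x in pos) \int[nu]_(r in pos) f (x, r))%E.
  rewrite [RHS]integral_mkcond; apply: eq_integral => x _ /=.
  rewrite /rho_nu_pos_density !patchE; case: ifPn => xp; last by rewrite mul0e.
  have x0 : 0 < x by move: xp; rewrite inE/= in_itv/= andbT.
  have lx0 := lnD_ge0 (ltW l0) x0.
  have mr : measurable_fun pos (fun r => (rho_fun alpha r x)%:E).
    by apply: measurable_funTS; apply/measurable_EFinP;
      exact: (measurable_fun_pair2 x (measurable_rho_fun alpha)).
  have r0 (r : R) : pos r -> (0 <= (rho_fun alpha r x)%:E)%E.
    by rewrite /= in_itv/= andbT => r0; rewrite lee_fin rho_fun_ge0.
  rewrite lnposE// /rho_nu_density -/c -muleA muleC [X in (X * _)%E]muleC -ge0_integralZl//.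
  rewrite muleC -ge0_integralZl//; first last.
  - by move=> r pr; rewrite mule_ge0// r0.
  - exact: measurable_funeM.
  by apply: eq_integral => r _; rewrite /f/= [X in (_ * X)%E]muleC.
rewrite (fubini_tonelli_in mu nu)//; last first.
  move=> x r /=; rewrite !in_itv/= !andbT => x0 r0.
  by rewrite !mule_ge0// ?lee_fin ?rho_fun_ge0// -lee_fin lnD_ge0// ltW.
rewrite -ge0_integralZl//; first last.
- by rewrite lee_fin invr_ge0 ltW.
- move=> r /=; rewrite in_itv/= andbT; apply: lnD_ge0; exact: powR_ge0.
- exact: measurable_funTS.
apply: eq_integral => r; rewrite inE/= in_itv/= andbT => r0.
exact: rho_fun_integral.
Qed.

Lemma rho_integral (l : R) : 0 < l ->
  (\int[rho_measure ha]_(x in pos) (ln (1 + l * x))%:E =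
   (alpha^-1)%:E * (ln (1 + l `^ alpha))%:E)%E.
Proof.
move=> l0; rewrite integral_mkcond -/(lnpos l).
rewrite (ge0_integral_density (mu := mu) (m := rho_measure ha) measurable_idL
  (measurable_rho_pos_density alpha) (rho_pos_density_ge0 ha))//; last first.
  by move=> x; apply: lnpos_ge0; exact: ltW.
rewrite -[l `^ alpha]mulr1 -(rho_fun_integral ltr01 l0) [RHS]integral_mkcond.
apply: eq_integral => x _ /=; rewrite /rho_pos_density /lnpos !patchE.
case: ifPn => xp; last by rewrite mul0e.
rewrite /rho_density -!EFinM; congr EFin.
by rewrite /rho_fun !mulr1 expr1n (mulrC alpha pi) !mulrA.
Qed.

Hypothesis hnu : Thorin nu.

Let rho_nu_null : rho_nu_measure ha nu `]-oo, 0]%classic = 0%E.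
Proof.
rewrite /rho_nu_measure /measure_of_density/= /density_measure integral0_eq// => x /=.
rewrite in_itv/= => x0; rewrite /rho_nu_pos_density patchE ifF//.
by apply/negbTE; rewrite notin_setE/= in_itv/= andbT => /lt_le_trans/(_ x0); rewrite ltxx.
Qed.

Lemma rho_nu_exponent_fin (l : R) : 0 < l ->
  (\int[rho_nu_measure ha nu]_(x in pos) (ln (1 + l * x))%:E =
   (Thorin_exponent nu (l `^ alpha) / alpha)%:E)%E.
Proof.
move=> l0; rewrite rho_nu_integral// Thorin_exponentE ?powR_ge0//.
by rewrite -EFinM mulrC.
Qed.

Lemma Thorin_rho_nu : Thorin (rho_nu_measure ha nu).
Proof.
split; [|exact: rho_nu_null|by move=> l l0; rewrite rho_nu_exponent_fin// ltry].
apply: sigma_finite_ln_integral => //.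
have := rho_nu_exponent_fin ltr01; under eq_integral do rewrite mul1r.
by move=> ->; rewrite ltry.
Qed.

Lemma Thorin_exponent_rho_nu (l : R) : 0 <= l ->
  Thorin_exponent (rho_nu_measure ha nu) l = Thorin_exponent nu (l `^ alpha) / alpha.
Proof.
rewrite le_eqVlt => /predU1P[<-|l0].
  by rewrite powR0 ?gt_eqF// !Thorin_exponent0 mul0r.
by rewrite {1}/Thorin_exponent /Rintegral rho_nu_exponent_fin.
Qed.

Lemma Thorin_exponent_rho (l : R) : 0 <= l ->
  Thorin_exponent (rho_measure ha) l = ln (1 + l `^ alpha) / alpha.
Proof.
rewrite le_eqVlt => /predU1P[<-|l0].
  by rewrite powR0 ?gt_eqF// Thorin_exponent0 addr0 ln1 mul0r.
by rewrite /Thorin_exponent /Rintegral rho_integral//= mulrC.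
Qed.

End exponents.

Section product_null.
Context {R : realType}.
Implicit Types P Q : probability R R.

Lemma product_null P Q (A : set (R * R)) (N N' : set R) :
  measurable A -> measurable N -> measurable N' -> P N = 0%E -> Q N' = 0%E ->
  (forall x y, A (x, y) -> N x \/ N' y) -> (P \x Q)%E A = 0%E.
Proof.
move=> mA mN mN' P0 Q0 AN.
have sub : A `<=` (N `*` setT) `|` (setT `*` N').
  by move=> [x y] /AN [Nx|N'y]; [left|right].
have mU1 : measurable (N `*` [set: R]) by exact: measurableX.
have mU2 : measurable ([set: R] `*` N') by exact: measurableX.
apply: (subset_measure0 _ _ sub) => //; first exact: measurableU.
apply/eqP; rewrite -measure_le0; apply: le_trans (measureU2 _ mU1 mU2) _.
have e1 : (P \x Q)%E (N `*` setT) = (P N * Q setT)%E by exact: product_measure1E.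
have e2 : (P \x Q)%E (setT `*` N') = (P setT * Q N')%E by exact: product_measure1E.
move: e1 e2; rewrite P0 Q0 mul0e mule0 => e1 e2.
by have -> : ((P \x Q)%E (N `*` setT) + (P \x Q)%E (setT `*` N') = 0)%E by rewrite [X in (X + _)%E]e1 [X in (_ + X)%E]e2 adde0.
Qed.

End product_null.

Section Lambda_exponents.
Context {R : realType}.
Local Notation pos := (`]0, +oo[%classic : set R).
Variables (alpha : R) (S : probability R R).
Hypotheses (ha : 0 < alpha < 1) (hS : stable_law alpha S).

Let alpha0 : 0 < alpha. Proof. by case/andP: ha. Qed.

Lemma X_law_null : X_law S `]-oo, 0]%classic = 0%E.
Proof.
have S0 : S `]-oo, 0]%classic = 0%E by case: hS.
rewrite /X_law /distribution /pushforward/=.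
apply: (product_null _ _ _ S0 S0) => //.
  by rewrite -[X in measurable X]setTI; exact: measurable_ratioR.
move=> x y /=; rewrite /ratioR !in_itv/= => xy.
have [x0|x0] := leP x 0; [by left|right].
by rewrite leNgt; apply/negP => y0; move: xy; rewrite leNgt divr_gt0.
Qed.

Let mlnD := @measurable_lnD R.
Let mlnpos := @measurable_lnpos R.

Lemma skew_mapE (r x : R) : 0 < r ->
  skew_map alpha (r / (1 + r)) x = r `^ alpha^-1 * x / (1 + r `^ alpha^-1 * x).
Proof.
move=> r0; rewrite /skew_map (_ : r / (1 + r) / (1 - r / (1 + r)) = r)//.
have r1 : 1 + r != 0 by rewrite gt_eqF// addr_gt0.
have -> : 1 - r / (1 + r) = (1 + r)^-1 by field.
by rewrite invrK divfK.
Qed.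

Lemma skew_map_gt0 (r x : R) : 0 < r -> 0 < x -> 0 < skew_map alpha (r / (1 + r)) x.
Proof.
move=> r0 x0; have c0 : 0 < r `^ alpha^-1 * x by rewrite mulr_gt0// powR_gt0.
by rewrite skew_mapE// divr_gt0// addr_gt0.
Qed.

Lemma Lambda_law_null (r : R) : 0 < r ->
  Lambda_law alpha S (r / (1 + r)) `]-oo, 0]%classic = 0%E.
Proof.
move=> r0; rewrite /Lambda_law /distribution /pushforward/=.
apply: (subset_measure0 _ _ _ X_law_null) => //.
  by rewrite -[X in measurable X]setTI; exact: measurable_skew.
move=> x /=; rewrite !in_itv/= => h; rewrite leNgt; apply/negP => x0.
by move: h; rewrite leNgt skew_map_gt0.
Qed.

(** For [u = c x] the identity [1 + l u / (1 + u) = (1 + (1 + l) u) / (1 + u)] makes the logarithm a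
    difference of two integrands of [integral_ln_stable_ratio], with [c = r^(1 / alpha)] chosen so
    that [c^alpha = r]. *)
Lemma Lambda_law_ln_integral (l r : R) : 0 < l -> 0 < r ->
  (\int[Lambda_law alpha S (r / (1 + r))]_y lnpos l y =
   (ln (1 + (1 + l) `^ alpha * r) / alpha - ln (1 + 1 * r) / alpha)%:E)%E.
Proof.
move=> l0 r0; pose c := r `^ alpha^-1.
have c0 : 0 < c by rewrite powR_gt0.
have ca : c `^ alpha = r by rewrite /c -powRrM mulVf ?gt_eqF// powRr1// ltW.
have l1 : 0 < 1 + l by rewrite addr_gt0.
rewrite ge0_integral_distribution//; last by move=> y; apply: lnpos_ge0; exact: ltW.
have mc : measurable_fun [set: R] (fun x => lnpos l (skew_map alpha (r / (1 + r)) x)).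
  by exact: (measurableT_comp (measurable_lnpos l) (measurable_skew alpha _)).
rewrite (ge0_integral_itv0y X_law_null)//; last first.
  by move=> x; apply: lnpos_ge0; exact: ltW.
have h : (\int[X_law S]_(x in pos) lnpos l (skew_map alpha (r / (1 + r)) x) +
    \int[X_law S]_(x in pos) (ln (1 + c * x))%:E =
    \int[X_law S]_(x in pos) (ln (1 + (1 + l) * c * x))%:E)%E.
  rewrite -ge0_integralD//; first last.
  - exact: measurable_funTS.
  - by move=> x /=; rewrite in_itv/= andbT; exact: (lnD_ge0 (ltW c0)).
  - exact: measurable_funTS.
  - by move=> x _; apply: lnpos_ge0; exact: ltW.
  apply: eq_integral => x; rewrite inE/= in_itv/= andbT => x0.
  have cx : 0 < c * x by rewrite mulr_gt0.
  rewrite lnposE ?skew_map_gt0// skew_mapE// -/c -EFinD -lnM ?posrE.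
  - by congr EFin; congr ln; field; rewrite gt_eqF// addr_gt0.
  - by rewrite addr_gt0// mulr_gt0// divr_gt0// addr_gt0.
  - by rewrite addr_gt0.
have c1 : 0 < (1 + l) * c by rewrite mulr_gt0.
rewrite (integral_ln_stable_ratio alpha0 hS c0) (integral_ln_stable_ratio alpha0 hS c1) in h.
rewrite powRM ?(ltW l1) ?(ltW c0)// ca in h.
have := congr1 (fun z => z - (ln (1 + r) / alpha)%:E)%E h.
by rewrite addeK// mul1r => ->.
Qed.

Variable nu : {sigma_finite_measure set R -> \bar R}.
Hypothesis hnu : Thorin nu.

Let Lnu := Lambda_nu_measure alpha S nu.

Lemma Lambda_nu_null : Lnu `]-oo, 0]%classic = 0%E.
Proof.
rewrite /Lnu /Lambda_nu_measure/= /Lambda_nu integral0_eq// => r.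
by rewrite /= in_itv/= andbT => r0; exact: Lambda_law_null.
Qed.

Lemma Lambda_nu_ln_integral (l : R) : 0 < l ->
  (\int[Lnu]_(x in pos) (ln (1 + l * x))%:E =
   ((Thorin_exponent nu ((1 + l) `^ alpha) - Thorin_exponent nu 1) / alpha)%:E)%E.
Proof.
move=> l0; have l1 : 0 < 1 + l by rewrite addr_gt0.
have la : 1 <= (1 + l) `^ alpha.
  by rewrite -[leLHS](powRr0 (1 + l)) ler_powR ?lerDl ?(ltW l0) ?(ltW alpha0).
rewrite integral_mkcond -/(lnpos l).
rewrite (ge0_integral_mixture (nu := nu) (D := pos)
  (k := fun r : R => Lambda_law alpha S (r / (1 + r))) (m := Lnu))//; first last.
- by move=> x; apply: lnpos_ge0; exact: ltW.
- exact: measurable_Lambda_law.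
pose f (q : R) (r : R) : \bar R := (ln (1 + q * r) / alpha)%:E.
have mf q : measurable_fun [set: R] (f q).
  apply/measurable_EFinP; apply: measurable_funM => //.
  by apply/measurable_EFinP; exact: measurable_lnD.
have f0 q r : 0 <= q -> 0 < r -> (0 <= f q r)%E.
  by move=> q0 r0; rewrite lee_fin divr_ge0 ?(ltW alpha0)// -lee_fin lnD_ge0.
have fI q : 0 <= q -> (\int[nu]_(r in pos) f q r = (Thorin_exponent nu q / alpha)%:E)%E.
  move=> q0; rewrite /f (eq_integral (fun r => (alpha^-1)%:E * (ln (1 + q * r))%:E)%E); last first.
    by move=> r _; rewrite -EFinM mulrC.
  rewrite ge0_integralZl//; first last.
  - by rewrite lee_fin invr_ge0 ltW.
  - by move=> r /=; rewrite in_itv/= andbT; exact: lnD_ge0.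
  - exact: measurable_funTS.
  by rewrite Thorin_exponentE// -EFinM mulrC.
pose D (r : R) : \bar R := (ln (1 + (1 + l) `^ alpha * r) / alpha - ln (1 + 1 * r) / alpha)%:E.
have h : (\int[nu]_(r in pos) D r + \int[nu]_(r in pos) f 1%R r =
          \int[nu]_(r in pos) f ((1 + l) `^ alpha)%R r)%E.
  rewrite -ge0_integralD//; first last.
  - exact: measurable_funTS.
  - by move=> r /=; rewrite in_itv/= andbT; exact: f0.
  - apply: measurable_funTS; apply/measurable_EFinP; apply: measurable_funB.
      by apply/measurable_EFinP; exact: (mf ((1 + l) `^ alpha)).
    by apply/measurable_EFinP; exact: (mf 1).
  - move=> r /=; rewrite in_itv/= andbT => r0; rewrite lee_fin subr_ge0.
    rewrite ler_pM2r ?invr_gt0// ler_ln ?posrE ?lerD2l ?ler_pM2r//.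
      by rewrite mul1r addr_gt0.
    by rewrite addr_gt0// mulr_gt0// (lt_le_trans ltr01).
  by apply: eq_integral => r _; rewrite /D /f -EFinD subrK.
rewrite !fI ?ler01// ?(le_trans ler01 la)// in h.
rewrite (eq_integral D); last first.
  by move=> r; rewrite inE/= in_itv/= andbT => r0; exact: Lambda_law_ln_integral.
have := congr1 (fun z => z - (Thorin_exponent nu 1 / alpha)%:E)%E h.
by rewrite addeK// => ->; rewrite mulrBl EFinB.
Qed.

Lemma Thorin_Lambda_nu : Thorin Lnu.
Proof.
split; [|exact: Lambda_nu_null|by move=> l l0; rewrite Lambda_nu_ln_integral// ltry].
apply: sigma_finite_ln_integral; first exact: Lambda_nu_null.
have := Lambda_nu_ln_integral ltr01; under eq_integral do rewrite mul1r.
by move=> ->; rewrite ltry.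
Qed.

Lemma Thorin_exponent_Lambda_nu (l : R) : 0 <= l ->
  Thorin_exponent Lnu l =
  (Thorin_exponent nu ((1 + l) `^ alpha) - Thorin_exponent nu 1) / alpha.
Proof.
rewrite le_eqVlt => /predU1P[<-|l0].
  by rewrite addr0 powR1 Thorin_exponent0 subrr mul0r.
by rewrite {1}/Thorin_exponent /Rintegral Lambda_nu_ln_integral.
Qed.

End Lambda_exponents.

(** * Laws *)

Section law_uniqueness.
Context {R : realType}.
Implicit Types (P Q : probability R R) (m : {measure set R -> \bar R}) (a : R).

Lemma same_law_integral P Q (f : R -> \bar R) : same_law P Q ->
  (\int[P]_x f x = \int[Q]_x f x)%E.
Proof. by move=> PQ; apply: eq_measure_integral => A mA _; exact: PQ. Qed.

Lemma GGC_law_is_the_law a m P : GGC_law a m P -> is_the_law (GGC_law a m) P.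
Proof.
move=> [mT P0 HP] Q; split => [[_ Q0 HQ]|QP].
  apply: laplace_unique => //.
  - exact: le_lt_trans (probability_le1 _ measurableT) (ltry 1).
  - exact: le_lt_trans (probability_le1 _ measurableT) (ltry 1).
  - by move=> k; rewrite HP// HQ.
split => //; first by rewrite QP.
by move=> l l0; rewrite (same_law_integral _ QP) HP.
Qed.

Lemma M_law_is_the_law a m P : 0 < a -> M_law a m P -> is_the_law (M_law a m) P.
Proof.
move=> a0 [mT P0 HP] Q; split => [[_ Q0 HQ]|QP].
  by apply: (stieltjes_unique a0) => // l l0; rewrite HP// HQ.
split => //; first by rewrite QP.
by move=> l l0; rewrite (same_law_integral _ QP) HP.
Qed.

End law_uniqueness.

Section product_integrals.
Context {R : realType}.
Local Notation mu := (@lebesgue_measure R).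
Local Notation pos := (`]0, +oo[%classic : set R).
Implicit Types (P Q : probability R R) (nu : {measure set R -> \bar R}).

Lemma eq_integral_itv0y nu (f g : R -> \bar R) :
  nu `]-oo, 0]%classic = 0%E ->
  measurable_fun [set: R] f -> measurable_fun [set: R] g ->
  (forall x, (0 <= f x)%E) -> (forall x, (0 <= g x)%E) ->
  (forall x, 0 < x -> f x = g x) -> (\int[nu]_x f x = \int[nu]_x g x)%E.
Proof.
move=> P0 mf mg f0 g0 fg; rewrite (ge0_integral_itv0y P0 mf f0) (ge0_integral_itv0y P0 mg g0).
by apply: eq_integral => x; rewrite inE/= in_itv/= andbT; exact: fg.
Qed.

Lemma eq_integral_itvcy nu (f g : R -> \bar R) :
  nu `]-oo, 0[%classic = 0%E ->
  measurable_fun [set: R] f -> measurable_fun [set: R] g ->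
  (forall x, (0 <= f x)%E) -> (forall x, (0 <= g x)%E) ->
  (forall x, 0 <= x -> f x = g x) -> (\int[nu]_x f x = \int[nu]_x g x)%E.
Proof.
move=> P0 mf mg f0 g0 fg; rewrite (ge0_integral_itvcy P0 mf f0) (ge0_integral_itvcy P0 mg g0).
by apply: eq_integral => x; rewrite inE/= in_itv/= andbT; exact: fg.
Qed.

Lemma measurable_product_integral P (phi : {mfun (R * R)%type >-> R}) (f : R -> \bar R) :
  measurable_fun [set: R] f -> (forall x, (0 <= f x)%E) ->
  measurable_fun [set: R] (fun y => \int[P]_x f (phi (x, y)))%E.
Proof.
move=> mf f0; apply: (measurable_fun_fubini_tonelli_G (m1 := P) (fun z => f (phi z))) => //.
exact: measurableT_comp.
Qed.

Lemma ge0_integral_product_map P Q (phi : {mfun (R * R)%type >-> R}) (f : R -> \bar R) :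
  measurable_fun [set: R] f -> (forall x, (0 <= f x)%E) ->
  (\int[distribution (P \x Q)%E phi]_y f y = \int[Q]_y \int[P]_x f (phi (x, y)))%E.
Proof.
move=> mf f0; rewrite ge0_integral_distribution//.
rewrite (fubini_tonelli2 (m1 := P) (m2 := Q) (fun z => f (phi z)))//.
exact: measurableT_comp.
Qed.

Lemma measurable_expRM (l : R) : measurable_fun [set: R] (fun x : R => (expR (- (l * x)))%:E).
Proof.
apply/measurable_EFinP; apply: measurableT_comp => //.
by apply: measurableT_comp => //; exact: measurable_funM.
Qed.

Lemma measurable_powRD (l a : R) : measurable_fun [set: R] (fun x : R => ((1 + l * x) `^ a)%:E).
Proof.
apply/measurable_EFinP; apply: (measurableT_comp (measurable_powR a)).
by apply: measurable_funD => //; exact: measurable_funM.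
Qed.

Lemma expRN_ln (t y : R) : 0 < y -> expR (- (t * ln y)) = y `^ (- t).
Proof. by move=> y0; rewrite /powR gt_eqF// mulNr. Qed.

End product_integrals.

(** * Products with an independent gamma variable *)

Section gamma_product.
Context {R : realType}.
Local Notation mu := (@lebesgue_measure R).
Local Notation pos := (`]0, +oo[%classic : set R).
Variables (a : R) (G : probability R R).
Hypotheses (a0 : 0 < a) (hG : gamma_law a G).

Let gamma_fun_ge0 : 0 <= gamma_fun a.
Proof.
by apply: Rintegral_ge0 => x _; rewrite mulr_ge0 ?powR_ge0 ?expR_ge0.
Qed.

Lemma gamma_law_null : G `]-oo, 0]%classic = 0%E.
Proof.
case: hG => _ _ ->; last exact: measurable_itv.
by apply: integral0_eq => x /=; rewrite in_itv/= => x0; rewrite ltNge x0.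
Qed.

Let gamma_laplace_integral (c : R) : 0 <= c ->
  (\int[G]_x (expR (- (c * x)))%:E = (gamma_fun a)^-1%:E * gamma_integral a (1 + c))%E.
Proof.
move=> c0; case: hG => mg g0 HG.
have mid : measurable_fun [set: measurableTypeR R] (idfun : measurableTypeR R -> R).
  by move=> _ B mB; rewrite setTI.
have mg' := (measurable_EFinP _ _).2 mg.
have g0' (x : R) : (0 <= (if (0 < x)%R then x `^ (a - 1) * expR (- x) / gamma_fun a else 0)%:E)%E.
  by rewrite lee_fin.
rewrite (ge0_integral_density (mu := mu) (m := G) mid (mg') g0' HG
  (measurable_expRM c) (fun x => expR_ge0 _)).
rewrite /gamma_integral -ge0_integralZl//; first last.
- by rewrite lee_fin invr_ge0.
- by move=> x _; rewrite lee_fin mulr_ge0 ?powR_ge0 ?expR_ge0.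
- by apply/measurable_EFinP; apply: measurable_funTS; exact: measurable_gamma_integrand.
rewrite [RHS]integral_mkcond; apply: eq_integral => x _; rewrite patchE mem_setE/= in_itv/= andbT.
case: ifPn => _; last by rewrite mul0e.
rewrite -!EFinM mulrDl mul1r opprD expRD; congr EFin; ring.
Qed.

(** The product of the normalizing constant with [gamma_integral a 1] is the total mass of [G], read
    off at [c = 0]. *)
Lemma gamma_laplace (c : R) : 0 <= c ->
  (\int[G]_x (expR (- (c * x)))%:E = ((1 + c) `^ (- a))%:E)%E.
Proof.
move=> c0; have := gamma_laplace_integral (lexx 0).
rewrite addr0; under eq_integral do rewrite mul0r oppr0 expR0.
rewrite integral_cst// mul1e [X in (X = _)%E]probability_setT => h.
rewrite gamma_laplace_integral// gamma_integral_scale; last by rewrite ltr_pwDl.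
by rewrite muleCA -h mule1.
Qed.

(** Given [M = x], the gamma factor contributes [E exp(- l x G) = (1 + l x)^(- a)]. *)
Lemma GGC_law_gamma_product m M : M_law a m M -> GGC_law a m (product_law G M).
Proof.
move=> [mT M0 HM]; split => // [|l l0].
  apply: (product_null _ _ _ gamma_law_null M0) => //.
    by rewrite -[X in measurable X]setTI; exact: measurable_prodR.
  move=> x y /=; rewrite /prodR !in_itv/= => xy.
  have [x0|x0] := leP x 0; [by left|right].
  by rewrite leNgt; apply/negP => y0; move: xy; rewrite ltNge mulr_ge0// ltW.
have me := measurable_expRM l.
have e0 x : (0 <= (expR (- (l * x)))%:E)%E by rewrite lee_fin expR_ge0.
rewrite ge0_integral_product_map// -HM//; apply: (eq_integral_itv0y M0).
- exact: (measurable_product_integral _ _ me).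
- exact: measurable_powRD.
- by move=> x; apply: integral_ge0.
- by move=> x; rewrite lee_fin powR_ge0.
move=> x x0; rewrite -gamma_laplace; last by rewrite mulr_ge0// ltW.
by apply: eq_integral => y _; rewrite /= /prodR/= (mulrC y x) mulrA.
Qed.

End gamma_product.

(** * Laplace transforms of stable mixtures and of their exponential tilts *)

Section tilting.
Context {R : realType}.
Local Notation mu := (@lebesgue_measure R).
Variables (alpha theta : R) (S : probability R R).
Hypotheses (ha : 0 < alpha < 1) (hS : stable_law alpha S).
Variable nu : {measure set R -> \bar R}.

Let alpha0 : 0 < alpha. Proof. by case/andP: ha. Qed.

Lemma powRMV (l x : R) : 0 <= l -> 0 <= x -> (l * x `^ alpha^-1) `^ alpha = l `^ alpha * x.
Proof.
move=> l0 x0; rewrite powRM ?powR_ge0// -powRrM mulVf ?gt_eqF//.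
by rewrite powRr1.
Qed.

(** Given [Z = z], the stable law contributes [exp(- (l z^(1 / alpha))^alpha) = exp(- l^alpha z)],
    so the transform of [Z] is evaluated at [l^alpha]. *)
Lemma root_scaled_laplace (Z : probability R R) (l : R) :
  GGC_law theta nu Z -> 0 <= l ->
  (\int[root_scaled_law alpha S Z]_x (expR (- (l * x)))%:E =
   (expR (- (theta * Thorin_exponent nu (l `^ alpha))))%:E)%E.
Proof.
move=> [_ Z0 HZ] l0; have la0 : 0 <= l `^ alpha by exact: powR_ge0.
rewrite ge0_integral_product_map//; first last.
- exact: measurable_expRM.
rewrite -HZ//; apply: (eq_integral_itvcy Z0).
- exact: (measurable_product_integral _ _ (measurable_expRM l)).
- exact: measurable_expRM.
- by move=> z; apply: integral_ge0.
- by move=> z; rewrite lee_fin expR_ge0.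
move=> z z0; rewrite -powRMV//.
case: hS => _ <-; last by rewrite mulr_ge0// powR_ge0.
by apply: eq_integral => x _; rewrite /= /mul_root/= (mulrC x) mulrA.
Qed.

Lemma root_scaled_null (Z : probability R R) : root_scaled_law alpha S Z `]-oo, 0[%classic = 0%E.
Proof.
have S0 : S `]-oo, 0]%classic = 0%E by case: hS.
apply: (product_null _ _ _ S0 (measure0 Z)) => //.
  by rewrite -[X in measurable X]setTI; exact: measurable_mul_root.
move=> x y /=; rewrite /mul_root !in_itv/= => xy; left.
by rewrite leNgt; apply/negP => x0; move: xy; rewrite ltNge mulr_ge0// ?powR_ge0// ltW.
Qed.

Lemma tilted_integral (W L : probability R R) (f q : R -> R) :
  has_density f W -> has_density (fun x => q x * f x) L ->
  measurable_fun [set: R] q -> (forall x, 0 <= q x) ->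
  forall h : R -> \bar R, measurable_fun [set: R] h -> (forall x, 0 <= h x)%E ->
  (\int[L]_x h x = \int[W]_x ((q x)%:E * h x))%E.
Proof.
move=> [mf f0 HW] [mqf qf0 HL] mq q0 h mh h0.
have mid : measurable_fun [set: measurableTypeR R] (idfun : measurableTypeR R -> R).
  by move=> _ B mB; rewrite setTI.
have mf' := (measurable_EFinP _ _).2 mf.
have mqf' := (measurable_EFinP _ _).2 mqf.
have mq' := (measurable_EFinP _ _).2 mq.
have f0' x : (0 <= (f x)%:E)%E by rewrite lee_fin.
have q0' x : (0 <= (q x)%:E)%E by rewrite lee_fin.
have qf0' x : (0 <= (q x * f x)%:E)%E by rewrite lee_fin.
have qh0 x : (0 <= (q x)%:E * h x)%E by rewrite mule_ge0.
rewrite (ge0_integral_density (mu := mu) (m := L) mid mqf' qf0' HL mh h0).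
rewrite (ge0_integral_density (mu := mu) (m := W) mid mf' f0' HW (emeasurable_funM mq' mh) qh0).
by apply: eq_integral => x _; rewrite /= muleA -EFinM mulrC.
Qed.

Lemma GGC_alpha_law_laplace (c : R) (L : probability R R) : 0 <= c ->
  GGC_alpha_law alpha S 1 c theta nu L ->
  L `]-oo, 0[%classic = 0%E /\
  forall l, 0 <= l -> (\int[L]_x (expR (- (l * x)))%:E =
    (expR (- (theta * (Thorin_exponent nu ((c + l) `^ alpha) -
                       Thorin_exponent nu (c `^ alpha)))))%:E)%E.
Proof.
move=> c0 [Z [f [hZ hf [k k0 hL]]]].
pose q (x : R) := k * expR (- (c * x)).
have mq : measurable_fun [set: R] q.
  by apply: measurable_funM => //; apply/measurable_EFinP; exact: measurable_expRM.
have q0 x : 0 <= q x by rewrite mulr_ge0 ?expR_ge0// ltW.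
have hL' : has_density (fun x => q x * f x) L.
  rewrite (_ : (fun x => q x * f x) =
    (fun x => k * (expR (- (c / 1 * x)) * (1^-1 * f (x / 1)))))//.
  by apply/funext => x; rewrite !divr1 invr1 mul1r mulrA.
have LW := tilted_integral hf hL' mq q0.
have LE l : 0 <= l -> (\int[L]_x (expR (- (l * x)))%:E =
    k%:E * (expR (- (theta * Thorin_exponent nu ((c + l) `^ alpha))))%:E)%E.
  move=> l0; rewrite LW; last first.
  - by move=> x; rewrite lee_fin expR_ge0.
  - exact: measurable_expRM.
  rewrite -(root_scaled_laplace hZ (addr_ge0 c0 l0)).
  transitivity (\int[root_scaled_law alpha S Z]_x
      (k%:E * (expR (- ((c + l) * x)))%:E))%E; last first.
    apply: ge0_integralZl => //; first exact: measurable_expRM.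
    by rewrite lee_fin ltW.
  by apply: eq_integral => x _; rewrite /q -!EFinM mulrDl opprD expRD mulrA.
(* At [l = 0] the total mass is 1, which forces [k = exp(theta psi_nu(c^alpha))]. *)
have kE := LE _ (lexx 0).
move: kE; under eq_integral do rewrite mul0r oppr0 expR0.
rewrite integral_cst// mul1e [X in (X = _)%E]probability_setT addr0 => -[kE].
split => [|l l0].
  pose A := `]-oo, 0[%classic : set R.
  have mA : measurable A by exact: measurable_itv.
  rewrite -[LHS]mul1e -(integral_cst L mA 1) integral_mkcond LW; last first.
  - by move=> x; rewrite patchE; case: ifPn.
  - by apply: (measurable_restrictT _ _).1.
  rewrite (_ : (fun x => _) = ((fun x => (q x)%:E) \_ A)); last first.
    by apply/funext => x; rewrite !patchE; case: ifPn; rewrite ?mule1 ?mule0.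
  rewrite -integral_mkcond null_set_integral//.
    by apply/measurable_EFinP; exact: measurable_funTS.
  exact: root_scaled_null.
rewrite LE// -EFinM mulrBr opprB expRD; congr EFin.
congr (_ * _); move: kE; set e := theta * _ => kE.
by rewrite -[LHS]mulr1 -(expRxMexpNx_1 e) (mulrC (expR e)) mulrA -kE mul1r.
Qed.

End tilting.

(** * Transforms of the mean functionals and of the occupation time *)

Section mean_functionals.
Context {R : realType}.
Variables (alpha theta : R) (S : probability R R).
Hypotheses (ha : 0 < alpha < 1) (htheta : 0 < theta).
Variable nu : {sigma_finite_measure set R -> \bar R}.
Hypothesis hnu : Thorin nu.

Let alpha0 : 0 < alpha. Proof. by case/andP: ha. Qed.

Let alpha_neq0 : alpha != 0. Proof. by rewrite gt_eqF. Qed.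

(** Given [N = n], the transform of [M0] at [l n^(1 / alpha)] is [(1 + l^alpha n)^(- theta)],
    because the exponent of [rho_alpha] is [ln (1 + l^alpha) / alpha]. Averaging over [n] gives the
    transform of [N] at [l^alpha]. *)
Lemma M_law_root_scaled (N M0 : probability R R) :
  M_law theta nu N -> M_law (alpha * theta) (rho_measure ha) M0 ->
  M_law (alpha * theta) (rho_nu_measure ha nu) (root_scaled_law alpha M0 N).
Proof.
move=> [_ N0 HN] [_ M00 HM0]; split; first exact: Thorin_rho_nu.
  apply: (product_null _ _ _ M00 N0) => //.
    by rewrite -[X in measurable X]setTI; exact: measurable_mul_root.
  move=> x y /=; rewrite /mul_root !in_itv/= => xy.
  have [x0|x0] := leP x 0; [by left|right].
  by rewrite leNgt; apply/negP => y0; move: xy; rewrite leNgt mulr_gt0// powR_gt0.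
move=> l l0; have la0 : 0 <= l `^ alpha by exact: powR_ge0.
rewrite ge0_integral_product_map//; first last.
- by move=> x; rewrite lee_fin powR_ge0.
- exact: measurable_powRD.
rewrite Thorin_exponent_rho_nu// (_ : alpha * theta * (_ / alpha) =
  theta * Thorin_exponent nu (l `^ alpha)); last by field.
rewrite -HN//; apply: (eq_integral_itv0y N0).
- apply: (measurable_product_integral _ _ (measurable_powRD _ _)) => x.
  by rewrite lee_fin powR_ge0.
- exact: measurable_powRD.
- by move=> z; apply: integral_ge0 => x _; rewrite lee_fin powR_ge0.
- by move=> z; rewrite lee_fin powR_ge0.
move=> n n0; have ln0 : 0 <= l * n `^ alpha^-1 by rewrite mulr_ge0// powR_ge0.
transitivity (\int[M0]_x ((1 + l * n `^ alpha^-1 * x) `^ (- (alpha * theta)))%:E)%E.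
  by apply: eq_integral => x _; rewrite /= /mul_root/= (mulrC x) mulrA.
rewrite HM0// Thorin_exponent_rho// powRMV// ?ltW//.
rewrite (_ : alpha * theta * (_ / alpha) = theta * ln (1 + l `^ alpha * n)); last by field.
by rewrite expRN_ln// ltr_pwDl// mulr_ge0// ltW.
Qed.

Hypothesis hS : stable_law alpha S.

Let Lnu := Lambda_nu_measure alpha S nu.

(* The constant k is forced by the value at l = 0. *)
Lemma M_law_Lambda_nu (P : probability R R) (k : R) :
  P `]-oo, 0]%classic = 0%E ->
  (forall l : R, 0 <= l -> (\int[P]_x ((1 + l * x) `^ (- (alpha * theta)))%:E =
    k%:E * (expR (- (theta * Thorin_exponent nu ((1 + l) `^ alpha))))%:E)%E) ->
  M_law (alpha * theta) Lnu P.
Proof.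
move=> P0 HP; split => //; first exact: Thorin_Lambda_nu.
move=> l l0; rewrite HP// Thorin_exponent_Lambda_nu//.
have I1 : (\int[P]_x ((1 + 0 * x) `^ (- (alpha * theta)))%:E = 1)%E.
  transitivity (\int[P]_x (cst 1 x))%E.
    by apply: eq_integral => x _; rewrite mul0r addr0 powR1.
  by rewrite integral_cst// mul1e [LHS]probability_setT.
have kE := HP _ (lexx 0).
rewrite I1 addr0 powR1 -EFinM in kE.
have := EFin_inj kE; rewrite -EFinM; move=> {}kE; congr EFin; move: kE.
set psi1 := Thorin_exponent nu 1; set psi := Thorin_exponent nu _ => kE.
rewrite (_ : - (alpha * theta * ((psi - psi1) / alpha)) = theta * psi1 - theta * psi); last by field.
rewrite expRD; congr (_ * _).
by rewrite -[LHS]mulr1 -(expRxMexpNx_1 (theta * psi1)) (mulrC (expR (theta * _))) mulrA -kE mul1r.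
Qed.

Lemma to_unit_gt0_lt1 (m : R) : 0 < m -> 0 < to_unit m < 1.
Proof.
move=> m0; have m1 : 0 < m + 1 by rewrite addr_gt0.
by rewrite /to_unit divr_gt0//= ltr_pdivrMr// mul1r ltrDl.
Qed.

(** [(1 + m)^(- a) (1 + l m / (m + 1))^(- a) = (1 + (1 + l) m)^(- a)]: the tilt turns the transform
    of [Y] at [l] into a multiple of that of [M] at [1 + l]. *)
Lemma M_law_Y (M Y : probability R R) :
  M_law (alpha * theta) (rho_nu_measure ha nu) M -> Y_law (alpha * theta) M Y ->
  M_law (alpha * theta) Lnu Y.
Proof.
move=> [_ M0 HM] HY; pose a := alpha * theta.
pose k := (\int[M]_m (1 + m) `^ (- a))^-1.
have k0 : 0 <= k by rewrite invr_ge0; apply: Rintegral_ge0 => x _; exact: powR_ge0.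
pose g (m : R) := (k * (1 + m) `^ (- a))%:E.
have mpow : measurable_fun [set: R] (fun m : R => ((1 + m) `^ (- a))%:E).
  by have := measurable_powRD 1 (- a); under eq_fun do rewrite mul1r.
have mg : measurable_fun [set: R] g.
  by apply/measurable_EFinP; apply: measurable_funM => //; exact/measurable_EFinP.
have g0 m : (0 <= g m)%E by rewrite lee_fin mulr_ge0 ?powR_ge0.
have YE B : measurable B -> Y B = (\int[M]_(m in to_unit @^-1` B) g m)%E.
  move=> mB; rewrite HY// /g; under [RHS]eq_integral do rewrite EFinM.
  rewrite ge0_integralZl//.
  - by rewrite -[X in measurable X]setTI; exact: measurable_to_unit.
  - exact: measurable_funTS.
  - by move=> x _; rewrite lee_fin powR_ge0.
apply: (@M_law_Lambda_nu _ k).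
  rewrite YE; last exact: measurable_itv.
  have mB : measurable (to_unit @^-1` (`]-oo, 0]%classic : set R)).
    by rewrite -[X in measurable X]setTI; exact: measurable_to_unit.
  rewrite null_set_integral//; first exact: measurable_funTS.
  apply: (subset_measure0 _ _ _ M0) => //.
  move=> x /=; rewrite !in_itv/= => h; rewrite leNgt; apply/negP => x0.
  by move: h; rewrite leNgt; have /andP[-> _] := to_unit_gt0_lt1 x0.
move=> l l0; have l1 : 0 <= 1 + l by rewrite addr_ge0.
rewrite (ge0_integral_density (mu := M) (m := Y) measurable_to_unit mg g0 YE
  (measurable_powRD l (- a)) (fun x => powR_ge0 _ _)).
have := HM _ l1; rewrite Thorin_exponent_rho_nu//.
rewrite (_ : alpha * theta * (_ / alpha) =
  theta * Thorin_exponent nu ((1 + l) `^ alpha)); last by field.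
move=> <-.
transitivity (\int[M]_x (k%:E * ((1 + (1 + l) * x) `^ (- a))%:E))%E; last first.
  apply: ge0_integralZl => //; first exact: measurable_powRD.
  by move=> x _; rewrite lee_fin powR_ge0.
have mT := measurableT_comp (measurable_powRD l (- a)) measurable_to_unit.
apply: (eq_integral_itv0y M0).
- exact: emeasurable_funM.
- by apply: emeasurable_funM => //; exact: measurable_powRD.
- by move=> m; rewrite mule_ge0// lee_fin powR_ge0.
- by move=> m; rewrite mule_ge0// lee_fin powR_ge0.
move=> m m0; have m1 : 0 < 1 + m by rewrite addr_gt0.
have /andP[t0 _] := to_unit_gt0_lt1 m0.
rewrite /g -!EFinM -mulrA -powRM ?(ltW m1)//; last first.
  by rewrite addr_ge0// mulr_ge0// ltW.
congr EFin; congr (_ * _ `^ _); rewrite /to_unit; field.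
by rewrite gt_eqF// addrC.
Qed.

(** [M_law] asks for a law on the open half-line, whereas [A_law] only places it on [[0, 1]]; what
    has to be excluded is an atom at 0. *)
Lemma A_law_null (p : R) (m : {measure set R -> \bar R}) :
  0 < p < 1 -> m [set: R] = 1%E -> A_law alpha theta p m ->
  m `]-oo, 0]%classic = 0%E.
Proof.
move=> /andP[p0 p1] m1 [mI Hm]; pose a := alpha * theta.
have mfin (B : set R) : measurable B -> m B \is a fin_num.
  move=> mB; rewrite ge0_fin_numE//; apply: (@le_lt_trans _ _ 1%E); last exact: ltry.
  by rewrite -m1 le_measure ?inE.
have mN : m `]-oo, 0[%classic = 0%E.
  apply: (subset_measure0 (B := ~` (`[0, 1]%classic : set R))) => //.
  - by apply: measurableC; exact: measurable_itv.
  - by move=> x /=; rewrite !in_itv/= => x0; rewrite leNgt x0.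
  - pose I := `[0, 1]%classic : set R; have mI' : measurable I by exact: measurable_itv.
    have h : m (I `|` ~` I) = (m I + m (~` I))%E.
      by apply: measureU => //; [exact: measurableC|exact: setICr].
    move: h; rewrite setUv [in LHS]m1 [X in (X + _)%E]mI => h.
    have := congr1 (fun z => z - 1)%E h.
    by rewrite subee// addeAC subee// add0e => /esym.
(* An atom at 0 would bound the transform from below, but it tends to 0. *)
have m00 : m [set 0] = 0%E.
  apply/eqP/negPn/negP => mn0.
  have f0 := mfin _ (measurable_set1 (0 : R)).
  pose e := fine (m [set 0]).
  have e0 : 0 < e by rewrite fine_gt0// lt0e mn0 measure_ge0/= ltey_eq f0.
  (* With [l] chosen so that [(1 + l)^alpha = 1 + t / p], the transform equals
     [(1 + t)^(- theta) <= t^(- theta) = e / 2], less than the supposed atom [e]. *)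
  pose t := (e / 2) `^ (- theta^-1).
  have e20 : 0 < e / 2 by rewrite divr_gt0.
  have t0 : 0 < t by exact: powR_gt0.
  have tp : 0 <= t / p by rewrite divr_ge0// ltW.
  pose l := (1 + t / p) `^ alpha^-1 - 1.
  have l0 : 0 <= l.
    by rewrite subr_ge0 -[leLHS](powRr0 (1 + t / p)) ler_powR ?lerDl// invr_ge0 ltW.
  have l1E : 1 + l = (1 + t / p) `^ alpha^-1 by rewrite /l addrC subrK.
  have := Hm l l0; rewrite l1E -powRrM mulVf// powRr1 ?addr_ge0//.
  rewrite (_ : 1 - p + p * (1 + t / p) = 1 + t); last by field; rewrite gt_eqF.
  move=> h.
  have : (m [set 0%R] <= ((1 + t) `^ (- theta))%:E)%E.
    rewrite -h -[leLHS]mul1e -(integral_cst m (measurable_set1 _) 1).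
    rewrite (_ : (\int[m]_(x in [set 0%R]) cst 1 x)%E =
      (\int[m]_(x in [set 0%R]) ((1 + l * x) `^ (- a))%:E)%E); last first.
      by apply: eq_integral => x; rewrite inE/= => ->; rewrite mulr0 addr0 powR1.
    apply: ge0_subset_integral => //.
    - exact: measurable_powRD.
    - by move=> x _; rewrite lee_fin powR_ge0.
  rewrite -[m _]fineK// lee_fin -/e; apply/negP; rewrite -ltNge.
  apply: (@le_lt_trans _ _ (t `^ (- theta))).
    rewrite !powRN lef_pV2 ?posrE ?powR_gt0 ?addr_gt0//.
    by rewrite ge0_ler_powR ?nnegrE ?addr_ge0 ?lerDr// ltW.
  rewrite /t -powRrM mulrNN mulVf ?gt_eqF// powRr1 ?ltW//.
  by rewrite ltr_pdivrMr// ltr_pMr// ltrDl.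
pose A := `]-oo, 0]%classic : set R.
have mD : measurable (A `\` [set 0]).
  by apply: measurableD; [exact: measurable_itv|exact: measurable_set1].
have D0 : m (A `\` [set 0]) = 0%E.
  apply: (subset_measure0 mD (measurable_itv `]-oo, 0[) _ mN) => x /= [].
  by rewrite /A/= !in_itv/= lt_neqAle => -> /eqP ->.
have := measureU2 m (measurable_set1 0) mD.
rewrite setDUK; last by move=> x /= ->; rewrite /A/= in_itv/=.
by rewrite [X in (_ <= X + _)%E]m00 [X in (_ <= _ + X)%E]D0 adde0 measure_le0 => /eqP.
Qed.

(** For [p = n / (n + 1)] and [q = (1 + l)^alpha], the weight of [xi] times the transform of [A]
    given [p] is [(1 - p)^theta (1 - p + p q)^(- theta) = (1 + q n)^(- theta)]: the mixture is a
    multiple of the transform of [N] at [q]. *)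
Lemma M_law_A (N Xi A : probability R R) :
  M_law theta nu N -> xi_law theta N Xi -> A_mixture_law alpha theta Xi A ->
  M_law (alpha * theta) Lnu A.
Proof.
move=> [_ N0 HN] [k k0 HXi] [K HK HA]; pose a := alpha * theta.
pose g (u : R) := (k * (1 - u) `^ theta)%:E.
have mpow : measurable_fun [set: R] (fun u : R => ((1 - u) `^ theta)%:E).
  by have := measurable_powRD (-1) theta; under eq_fun do rewrite mulN1r.
have mg : measurable_fun [set: R] g.
  by apply/measurable_EFinP; apply: measurable_funM => //; exact/measurable_EFinP.
have g0 u : (0 <= g u)%E by rewrite lee_fin mulr_ge0 ?powR_ge0// ltW.
have XiE B : measurable B -> Xi B = (\int[unit_law N]_(u in idfun @^-1` B) g u)%E.
  move=> mB; rewrite HXi// /g; under [RHS]eq_integral do rewrite EFinM.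
  rewrite ge0_integralZl//.
  - exact: measurable_funTS.
  - by move=> x _; rewrite lee_fin powR_ge0.
  - by rewrite lee_fin ltW.
have XiI (h : R -> \bar R) : measurable_fun [set: R] h -> (forall p, 0 <= h p)%E ->
    (\int[Xi]_p h p = \int[N]_n (g (to_unit n) * h (to_unit n)))%E.
  move=> mh h0; rewrite (ge0_integral_density (mu := unit_law N) (m := Xi)
    (@measurable_id _ _ setT) mg g0 XiE mh h0).
  rewrite ge0_integral_distribution//.
  - exact: emeasurable_funM.
  - by move=> y; rewrite mule_ge0.
have mgT := measurableT_comp mg measurable_to_unit.
have mK B : measurable B -> measurable_fun [set: R] (fun p => K p B).
  by move=> mB; exact: measurable_kernel.
apply: (@M_law_Lambda_nu _ k).
  pose B := `]-oo, 0]%classic : set R.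
  have mB : measurable B by exact: measurable_itv.
  rewrite (HA _ mB) (XiI _ (mK _ mB))//.
  rewrite (eq_integral_itv0y (g := cst 0%E) N0)//.
  - by rewrite integral0.
  - apply: emeasurable_funM => //; exact: (measurableT_comp (mK _ mB) measurable_to_unit).
  - by move=> x; rewrite mule_ge0.
  - move=> n /to_unit_gt0_lt1 n0.
    by rewrite (A_law_null n0 _ (HK _ n0)) ?mule0//; exact: prob_kernel.
move=> l l0; have l1 : 0 <= 1 + l by rewrite addr_ge0.
pose q := (1 + l) `^ alpha; have q0 : 0 <= q by exact: powR_ge0.
have mf := measurable_powRD l (- a).
have f0 (x : R) : (0 <= ((1 + l * x) `^ (- a))%:E)%E by rewrite lee_fin powR_ge0.
rewrite (ge0_integral_mixture (nu := Xi) (D := setT) (k := K) (m := A) measurableT mK HA mf f0).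
have mh := measurable_fun_integral_kernel mK f0 mf.
have h0 (p : R) : (0 <= \int[K p]_y ((1 + l * y) `^ (- a))%:E)%E.
  by apply: integral_ge0 => x _; exact: f0.
rewrite (XiI _ mh h0) -(HN _ q0).
transitivity (\int[N]_x (k%:E * ((1 + q * x) `^ (- theta))%:E))%E; last first.
  apply: ge0_integralZl => //; first exact: measurable_powRD.
  - by move=> x _; rewrite lee_fin powR_ge0.
  - by rewrite lee_fin ltW.
apply: (eq_integral_itv0y N0).
- by apply: emeasurable_funM => //; exact: (measurableT_comp mh measurable_to_unit).
- by apply: emeasurable_funM => //; exact: measurable_powRD.
- by move=> n; rewrite mule_ge0.
- by move=> n; rewrite mule_ge0// lee_fin ?powR_ge0// ltW.
move=> n n0; have n01 := to_unit_gt0_lt1 n0.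
have n1 : 0 < 1 + n by rewrite addr_gt0.
have [_ ->//] := HK _ n01.
have e1 : 1 - to_unit n = (1 + n)^-1.
  by rewrite /to_unit; field; rewrite gt_eqF// addrC.
have e2 : (1 + n)^-1 + to_unit n * q = (1 + n)^-1 * (1 + q * n).
  by rewrite /to_unit; field; rewrite !gt_eqF// addrC.
rewrite /g -/q e1 e2 powRM ?invr_ge0 ?(ltW n1)//; last first.
  by rewrite addr_ge0// mulr_ge0// ltW.
rewrite -!EFinM -mulrA; congr (_ * _)%:E; rewrite mulrA -powRD; last first.
  by apply/implyP => _; rewrite gt_eqF// invr_gt0.
by rewrite subrr powRr0 mul1r.
Qed.

End mean_functionals.

Theorem proposition5p7 (R : realType) (alpha theta : R)
  (ha : 0 < alpha < 1) (htheta : 0 < theta)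
  (nu : {sigma_finite_measure set R -> \bar R}) (hnu : Thorin nu)
  (S : probability R R) (hS : stable_law alpha S) :
  [/\ (* GGC_alpha^(1,0)(theta, nu) = GGC(alpha theta, rho_(alpha,nu)) *)
      forall L : probability R R,
        GGC_alpha_law alpha S 1 0 theta nu L ->
        is_the_law (GGC_law (alpha * theta) (rho_nu_measure ha nu)) L /\
        forall G M : probability R R,
          gamma_law (alpha * theta) G ->
          M_law (alpha * theta) (rho_nu_measure ha nu) M ->
          same_law L (product_law G M),
      (* GGC_alpha^(1,1)(theta, nu) = GGC(alpha theta, Lambda_(alpha,nu)) *)
      forall L : probability R R,
        GGC_alpha_law alpha S 1 1 theta nu L ->
        is_the_law (GGC_law (alpha * theta) (Lambda_nu_measure alpha S nu)) L /\
        forall G M : probability R R,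
          gamma_law (alpha * theta) G ->
          M_law (alpha * theta) (Lambda_nu_measure alpha S nu) M ->
          same_law L (product_law G M),
      (* M_(alpha theta)(rho_(alpha,nu)) =
         M_(alpha theta)(rho_alpha) * M_theta(nu)^(1/alpha) in law *)
      forall N M0 : probability R R,
        M_law theta nu N ->
        M_law (alpha * theta) (rho_measure ha) M0 ->
        is_the_law (M_law (alpha * theta) (rho_nu_measure ha nu))
          (root_scaled_law alpha M0 N) &
      (* A_(alpha,xi) = M_(alpha theta)(Lambda_(alpha,nu)) = Y in law *)
      forall N Xi A M Y : probability R R,
        M_law theta nu N ->
        xi_law theta N Xi ->
        A_mixture_law alpha theta Xi A ->
        M_law (alpha * theta) (rho_nu_measure ha nu) M ->
        Y_law (alpha * theta) M Y ->
        is_the_law (M_law (alpha * theta) (Lambda_nu_measure alpha S nu)) A /\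
        same_law A Y].

Proof.
have alpha0 : 0 < alpha by case/andP: ha.
have a0 : 0 < alpha * theta by rewrite mulr_gt0.
have G_same m L G M : GGC_law (alpha * theta) m L -> gamma_law (alpha * theta) G ->
    M_law (alpha * theta) m M -> same_law L (product_law G M).
  move=> hL hG hM A mA; apply/esym; move: A mA.
  exact/(GGC_law_is_the_law hL)/GGC_law_gamma_product.
have M_same m P Q : M_law (alpha * theta) m P -> M_law (alpha * theta) m Q -> same_law Q P.
  by move=> hP; case: (M_law_is_the_law a0 hP Q).
split.
- move=> L hL.
  (* For [c = 0] the subtracted exponent is taken at [0^alpha = 0], where it vanishes, so no
     renormalization remains; for [c = 1] below it is [psi_nu(1)], the constant in the exponent of
     [Lambda_nu]. *)
  have [L0 HL] := GGC_alpha_law_laplace ha hS (lexx 0) hL.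
  suff h : GGC_law (alpha * theta) (rho_nu_measure ha nu) L.
    by split; [exact: (GGC_law_is_the_law h)|move=> G M; exact: G_same].
  split => //; first exact: Thorin_rho_nu.
  move=> l l0; rewrite HL// Thorin_exponent_rho_nu// powR0 ?gt_eqF// Thorin_exponent0 add0r subr0.
  by congr (expR (- _))%:E; field; rewrite gt_eqF.
- move=> L hL.
  have [L0 HL] := GGC_alpha_law_laplace ha hS ler01 hL.
  suff h : GGC_law (alpha * theta) (Lambda_nu_measure alpha S nu) L.
    by split; [exact: (GGC_law_is_the_law h)|move=> G M; exact: G_same].
  split => //; first exact: Thorin_Lambda_nu.
  move=> l l0; rewrite HL// Thorin_exponent_Lambda_nu// powR1.
  by congr (expR (- _))%:E; field; rewrite gt_eqF.
- move=> N M0 hN hM0; exact: (M_law_is_the_law a0 (M_law_root_scaled hnu hN hM0)).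
- move=> N Xi A M Y hN hXi hA hM hY.
  have hA' : M_law (alpha * theta) (Lambda_nu_measure alpha S nu) A.
    exact: (M_law_A ha htheta hnu hS hN hXi hA).
  have hY' : M_law (alpha * theta) (Lambda_nu_measure alpha S nu) Y.
    exact: (M_law_Y hnu hS hM hY).
  by split; [exact: (M_law_is_the_law a0 hA')|exact: (M_same _ _ _ hY' hA')].
Qed.
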